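(* Let $A, B, \alpha, \beta, \gamma, \delta \in \mathbb{R}$ and consider the ODE \[ A\,u'(z)^2 + B\,u(z)\,u''(z) = u'''(z) + \alpha\,u''(z) + \beta\,u'(z) + \gamma\,u(z) + \delta . \] Assume the following three conditions hold: (i) $AB(A+B) \neq 0$; (ii) $\dfrac{B}{A+B} \notin \mathbb{Z}\setminus\{0\}$; (iii) $\dfrac{7A+8B \pm \sqrt{25A^2+16AB-32B^2}}{2(A+2B)} \notin \mathbb{N}\cup\{0\}$, for both choices of the sign. Then every meromorphic solution $u$ of this ODE on $\mathbb{C}$ is either a rational function of the form \[ u(z) = \frac{u_0}{z-z_0} + P(z), \] where $u_0, z_0 \in \mathbb{C}$ and $P$ is a polynomial of degree at most two, or a simply periodic function of the form \[ u(z) = \frac{h_0}{e^{kz}-\zeta_0} + c_0, \qquad h_0, k, \zeta_0 \in \mathbb{C}\setminus\{0\},\ c_0 \in \mathbb{C}. \]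
   Context: A meromorphic function means a function meromorphic on the whole complex plane $\mathbb{C}$ (no singularities other than poles); the independent variable $z$ is complex. Conditions (i)–(iii) are what the paper calls the ''generic case''. *)

(* Defs.v *)
From Stdlib Require Import Reals ZArith.
From Coquelicot Require Import Coquelicot.
Open Scope R_scope.

Definition Cexp (z : C) : C :=
  (exp (fst z) * cos (snd z), exp (fst z) * sin (snd z)).

(* a square root of a real number, taken in C (sign ambiguity irrelevant
   since both signs are considered) *)
Definition csqrt_R (d : R) : C :=
  if Rle_dec 0 d then RtoC (sqrt d) else (0, sqrt (- d)).

Definition C_differentiable (f : C -> C) (z : C) : Prop :=
  @ex_derive C_AbsRing C_NormedModule f z.

Definition meromorphic_with_poles (u : C -> C) (S : C -> Prop) : Prop :=
  (forall z : C, exists r : R, 0 < r /\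
      forall w : C, 0 < Cmod (w - z) < r -> ~ S w) /\
  (forall z : C, ~ S z -> C_differentiable u z) /\
  (forall p : C, S p -> forall M : R, exists r : R, 0 < r /\
      forall w : C, 0 < Cmod (w - p) < r -> M < Cmod (u w)).

Definition D1 (u : C -> C) : C -> C := C_derive u.
Definition D2 (u : C -> C) : C -> C := C_derive (C_derive u).
Definition D3 (u : C -> C) : C -> C := C_derive (C_derive (C_derive u)).

Definition solves_ode (A B al be ga de : R) (u : C -> C) (S : C -> Prop) : Prop :=
  forall z : C, ~ S z ->
    (RtoC A * D1 u z * D1 u z + RtoC B * u z * D2 u z =
     D3 u z + RtoC al * D2 u z + RtoC be * D1 u z + RtoC ga * u z + RtoC de)%C.

Definition fuchs_index (A B s : R) : C :=
  ((RtoC (7 * A + 8 * B) + RtoC s * csqrt_R (25 * A ^ 2 + 16 * A * B - 32 * B ^ 2))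
    / RtoC (2 * (A + 2 * B)))%C.

(* Main.v *)
(* At a pole of order n the quadratic terms have order 2 n + 2, so the hypothesis on B / (A + B)
   forces n = 1 and the residue is rho = -6 / (A + 2 B). If two solutions with this principal part
   differ, the order m of their difference at the pole makes m + 1 a Fuchs index; hence all Laurent
   expansions of u at its poles coincide, and the difference of any two poles is a period.

   Growth is controlled by an elementary substitute for Wiman-Valiron theory. Let lam be |z|, or
   Re (e z) with |e| = 1, and suppose that |u| (X - lam)^N is almost maximal at z0, where
   d = X - lam z0 and N = n^2. If lam z0 is comparable to X, then u (z0 + s) is
   comparable to u (z0) exp (k s) for |s| < d / n, where |k| = N / d. As |k| d / n = n is large,
   Cauchy's estimates turn the left-hand side of the equation into about (A + B) k^2 u^2, while
   the right-hand side is linear in u; this bounds u by a multiple of X^2. Otherwise the maximum of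
   |u| grows by a bounded factor when X doubles. Either way u grows polynomially.

   With at most one pole, comparing leading terms at infinity gives growth of order at most two,
   and Liouville's theorem the rational form. If the periods have rank one, subtracting
   h0 / (exp (k z) - zeta0) leaves a periodic entire function of polynomial growth, which is
   constant. Rank two is impossible, because there would be a period cell with a single simple pole. *)
Require Import Defs.
From Stdlib Require Import Reals ZArith Lra Lia List Classical ClassicalEpsilon.
From Coquelicot Require Import Coquelicot.
Open Scope R_scope.

(** * Complex derivatives *)

(** Hypothesis (ii) acts at both ends of the order scale. A pole of order n >= 2 has leading
    coefficient A n^2 + B n (n + 1) on the left and would force B / (A + B) = -n; growth of exact
    order c >= 3 at infinity has A c^2 + B c (c - 1) and would force B / (A + B) = c. Hypothesis
    (iii) enters through the linearised equation at a pole: up to a constant factor its indicial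
    polynomial in the order c of a perturbation is (c + 2) ((A + 2 B) c^2 - (5 A + 4 B) c + 6 B),
    where c + 2 belongs to moving the pole. The values of [u] on [S] are arbitrary, so local
    statements live on punctured neighbourhoods and reach the regular points by continuity. The
    function theory rests on two devices. Compactness and connectedness arguments are instances of
    one bisection principle for rectangles. Circles are vertical segments seen through the
    exponential, so Goursat's theorem on rectangles together with periodicity replaces the
    deformation of contours; the same device yields the jump across a column of poles that rules out
    rank two. *)

Definition near (z : C) (P : C -> Prop) : Prop :=
  exists d : R, 0 < d /\ forall w : C, 0 < Cmod (w - z) < d -> P w.

Lemma near_and (z : C) (P Q : C -> Prop) :
  near z P -> near z Q -> near z (fun w => P w /\ Q w).
Proof.
  intros [d [Hd H1]] [e [He H2]].
  exists (Rmin d e); split; [now apply Rmin_pos|].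
  intros w Hw; pose proof (Rmin_l d e); pose proof (Rmin_r d e).
  split; [apply H1 | apply H2]; lra.
Qed.

Lemma near_imp (z : C) (P Q : C -> Prop) :
  (forall w, P w -> Q w) -> near z P -> near z Q.
Proof. intros H [d [Hd H1]]; exists d; split; auto. Qed.

Lemma near_ball (z : C) (r : R) : 0 < r -> near z (fun w => 0 < Cmod (w - z) < r).
Proof. intros Hr; exists r; split; auto. Qed.

Lemma Cminus_diag_eq (a b : C) : (a - b)%C = 0%C -> a = b.
Proof. intros H; replace a with ((a - b) + b)%C by ring; rewrite H; ring. Qed.

Lemma Cminus_neq (a b : C) : a <> b -> (a - b)%C <> 0%C.
Proof. intros H H0; apply H, Cminus_diag_eq, H0. Qed.

Lemma Cmod_minus_gt0 (a b : C) : a <> b -> 0 < Cmod (a - b).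
Proof. intros H; apply Cmod_gt_0, Cminus_neq, H. Qed.

Lemma Cmod_sym (a b : C) : Cmod (a - b) = Cmod (b - a).
Proof. rewrite <- Cmod_opp; f_equal; ring. Qed.

Lemma Cmod_tri (a b c : C) : Cmod (a - c) <= Cmod (a - b) + Cmod (b - c).
Proof. replace (a - c)%C with ((a - b) + (b - c))%C by ring; apply Cmod_triangle. Qed.

Lemma Cmod_tri2 (a b : C) : Cmod a <= Cmod b + Cmod (a - b).
Proof. replace a with (b + (a - b))%C at 1 by ring; apply Cmod_triangle. Qed.

Lemma Cmod_diag (a : C) : Cmod (a - a) = 0.
Proof. replace (a - a)%C with (RtoC 0) by ring; apply Cmod_0. Qed.

Lemma near_point (z : C) (r : R) : 0 < r -> exists w, 0 < Cmod (w - z) < r.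
Proof.
  intros Hr; exists (z + RtoC (r / 2))%C.
  replace (z + RtoC (r / 2) - z)%C with (RtoC (r / 2)) by ring.
  rewrite Cmod_R, Rabs_pos_eq; lra.
Qed.

Lemma near_exists (z : C) (P : C -> Prop) : near z P -> exists w, P w.
Proof. intros [d [Hd H]]; destruct (near_point z d Hd) as [w Hw]; eauto. Qed.

Lemma punctured_disc_open (p z : C) (r : R) : 0 < Cmod (z - p) < r ->
  exists d, 0 < d /\ forall w, Cmod (w - z) < d -> 0 < Cmod (w - p) < r.
Proof.
  intros Hz; exists (Rmin (Cmod (z - p)) (r - Cmod (z - p))); split; [apply Rmin_pos; lra|].
  intros w Hw; pose proof (Rmin_l (Cmod (z - p)) (r - Cmod (z - p)));
  pose proof (Rmin_r (Cmod (z - p)) (r - Cmod (z - p))).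
  pose proof (Cmod_tri w z p); pose proof (Cmod_tri z w p); rewrite (Cmod_sym z w) in *; lra.
Qed.

Lemma near_neq (z : C) : near z (fun w => w <> z).
Proof.
  exists 1; split; [lra|]; intros w [Hw _] ->; rewrite Cmod_diag in Hw; lra.
Qed.

Definition tends (f : C -> C) (z l : C) : Prop :=
  forall e : R, 0 < e -> near z (fun w => Cmod (f w - l) < e).

Definition ccont (f : C -> C) (z : C) : Prop := tends f z (f z).

Definition cder (f : C -> C) (z l : C) : Prop :=
  tends (fun w => ((f w - f z) / (w - z))%C) z l.

Lemma tends_ext (f g : C -> C) (z l : C) :
  near z (fun w => f w = g w) -> tends f z l -> tends g z l.
Proof.
  intros H Hf e He; generalize (near_and _ _ _ H (Hf e He)).
  apply near_imp; intros w [H1 H2]; now rewrite <- H1.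
Qed.

Lemma tends_eq (f : C -> C) (z l m : C) : l = m -> tends f z l -> tends f z m.
Proof. now intros ->. Qed.

Lemma tends_unique (f : C -> C) (z l m : C) : tends f z l -> tends f z m -> l = m.
Proof.
  intros Hl Hm; apply NNPP; intros Hn; pose proof (Cmod_minus_gt0 _ _ Hn).
  destruct (near_exists _ _ (near_and _ _ _ (Hl (Cmod (l - m) / 2) ltac:(lra)) (Hm (Cmod (l - m) / 2) ltac:(lra))))
    as [w [H1 H2]].
  pose proof (Cmod_tri l (f w) m); rewrite (Cmod_sym l (f w)) in *; lra.
Qed.

Lemma tends_const (c z : C) : tends (fun _ => c) z c.
Proof. intros e He; exists 1; split; [lra|]; intros; rewrite Cmod_diag; lra. Qed.

Lemma tends_id (z : C) : tends (fun w => w) z z.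
Proof. intros e He; exists e; split; auto; intros; lra. Qed.

Lemma tends_plus (f g : C -> C) (z l m : C) :
  tends f z l -> tends g z m -> tends (fun w => f w + g w)%C z (l + m)%C.
Proof.
  intros Hf Hg e He.
  generalize (near_and _ _ _ (Hf (e / 2) ltac:(lra)) (Hg (e / 2) ltac:(lra))).
  apply near_imp; intros w [H1 H2].
  replace (f w + g w - (l + m))%C with ((f w - l) + (g w - m))%C by ring.
  pose proof (Cmod_triangle (f w - l) (g w - m)); lra.
Qed.

Lemma tends_mult (f g : C -> C) (z l m : C) :
  tends f z l -> tends g z m -> tends (fun w => f w * g w)%C z (l * m)%C.
Proof.
  intros Hf Hg e He.
  set (K := Cmod l + Cmod m + 1).
  pose proof (Cmod_ge_0 l); pose proof (Cmod_ge_0 m).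
  assert (HK : 0 < K) by (unfold K; lra).
  assert (He' : 0 < Rmin 1 (e / (2 * K))).
  { apply Rmin_pos; [lra|]; apply Rdiv_lt_0_compat; lra. }
  pose proof (Rmin_l 1 (e / (2 * K))); pose proof (Rmin_r 1 (e / (2 * K))).
  set (e' := Rmin 1 (e / (2 * K))) in *.
  assert (e' * K <= e / 2).
  { apply Rle_trans with (e / (2 * K) * K); [apply Rmult_le_compat_r; lra|].
    right; field; lra. }
  generalize (near_and _ _ _ (Hf e' He') (Hg e' He')).
  apply near_imp; intros w [H5 H6].
  replace (f w * g w - l * m)%C with ((f w - l) * (g w - m) + ((f w - l) * m + l * (g w - m)))%C by ring.
  eapply Rle_lt_trans; [apply Cmod_triangle|].
  eapply Rle_lt_trans; [apply Rplus_le_compat_l, Cmod_triangle|].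
  rewrite !Cmod_mult.
  pose proof (Cmod_ge_0 (f w - l)); pose proof (Cmod_ge_0 (g w - m)).
  assert (Cmod (f w - l) * Cmod (g w - m) <= e' * 1) by (apply Rmult_le_compat; lra).
  assert (Cmod (f w - l) * Cmod m <= e' * Cmod m) by (apply Rmult_le_compat_r; lra).
  assert (Cmod l * Cmod (g w - m) <= Cmod l * e') by (apply Rmult_le_compat_l; lra).
  unfold K in *; nra.
Qed.

Lemma tends_opp (f : C -> C) (z l : C) : tends f z l -> tends (fun w => - f w)%C z (- l)%C.
Proof.
  intros Hf e He; generalize (Hf e He); apply near_imp; intros w Hw.
  replace (- f w - - l)%C with (- (f w - l))%C by ring; now rewrite Cmod_opp.
Qed.

Lemma tends_minus (f g : C -> C) (z l m : C) :
  tends f z l -> tends g z m -> tends (fun w => f w - g w)%C z (l - m)%C.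
Proof. intros; apply tends_plus; auto; now apply tends_opp. Qed.

Lemma tends_neq0 (f : C -> C) (z l : C) :
  l <> 0%C -> tends f z l -> near z (fun w => Cmod l / 2 < Cmod (f w)).
Proof.
  intros Hl Hf; apply Cmod_gt_0 in Hl.
  generalize (Hf (Cmod l / 2) ltac:(lra)); apply near_imp; intros w Hw.
  pose proof (Cmod_tri2 l (f w)); rewrite Cmod_sym in Hw; lra.
Qed.

Lemma tends_inv (f : C -> C) (z l : C) :
  l <> 0%C -> tends f z l -> tends (fun w => / f w)%C z (/ l)%C.
Proof.
  intros Hl Hf e He; pose proof (tends_neq0 _ _ _ Hl Hf) as Hn.
  pose proof (proj1 (Cmod_gt_0 l) Hl) as Hl'.
  assert (He' : 0 < e * (Cmod l * Cmod l / 2)) by (apply Rmult_lt_0_compat; nra).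
  generalize (near_and _ _ _ Hn (Hf _ He')); apply near_imp; intros w [H1 H2].
  assert (H3 : f w <> 0%C) by (apply Cmod_gt_0; lra).
  replace (/ f w - / l)%C with ((l - f w) / (f w * l))%C by (field; auto).
  rewrite Cmod_div, Cmod_mult, Cmod_sym by (now apply Cmult_neq_0).
  apply (Rmult_lt_reg_r (Cmod (f w) * Cmod l)); [nra|].
  unfold Rdiv; rewrite Rmult_assoc, Rinv_l, Rmult_1_r by nra.
  eapply Rlt_le_trans; [apply H2|].
  apply Rmult_le_compat_l; [lra|]; nra.
Qed.

Lemma tends_div (f g : C -> C) (z l m : C) :
  m <> 0%C -> tends f z l -> tends g z m -> tends (fun w => f w / g w)%C z (l / m)%C.
Proof. intros; apply tends_mult; auto; now apply tends_inv. Qed.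

Lemma near_nbhd (z : C) (P : C -> Prop) : near z P -> P z ->
  exists d, 0 < d /\ forall w, Cmod (w - z) < d -> P w.
Proof.
  intros [d [Hd H]] Hz; exists d; split; auto; intros w Hw.
  destruct (classic (w = z)) as [-> | Hn]; auto.
  apply H; split; auto; now apply Cmod_minus_gt0.
Qed.

Lemma ccont_nbhd (f : C -> C) (z : C) : ccont f z -> forall e, 0 < e ->
  exists d, 0 < d /\ forall w, Cmod (w - z) < d -> Cmod (f w - f z) < e.
Proof. intros Hf e He; apply near_nbhd; [auto | rewrite Cmod_diag; lra]. Qed.

Lemma tends_comp_ccont (f g : C -> C) (z l : C) :
  tends g z l -> ccont f l -> tends (fun w => f (g w)) z (f l).
Proof.
  intros Hg Hf e He; destruct (ccont_nbhd f l Hf e He) as [d [Hd H]].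
  generalize (Hg d Hd); apply near_imp; auto.
Qed.

Lemma cder_ccont (f : C -> C) (z l : C) : cder f z l -> ccont f z.
Proof.
  intros H; unfold ccont.
  apply (tends_ext (fun w => f z + ((f w - f z) / (w - z)) * (w - z))%C).
  - generalize (near_neq z); apply near_imp; intros w Hw; field; now apply Cminus_neq.
  - apply (tends_eq _ _ (f z + l * (z - z))%C); [ring|].
    apply tends_plus; [apply tends_const|]; apply tends_mult; auto.
    apply tends_minus; [apply tends_id | apply tends_const].
Qed.

Lemma cder_const (c z : C) : cder (fun _ => c) z 0%C.
Proof.
  apply (tends_ext (fun _ => 0%C)); [|apply tends_const].
  generalize (near_neq z); apply near_imp; intros w Hw; field; now apply Cminus_neq.
Qed.

Lemma cder_id (z : C) : cder (fun w => w) z 1%C.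
Proof.
  apply (tends_ext (fun _ => 1%C)); [|apply tends_const].
  generalize (near_neq z); apply near_imp; intros w Hw; field; now apply Cminus_neq.
Qed.

Lemma cder_plus (f g : C -> C) (z l m : C) :
  cder f z l -> cder g z m -> cder (fun w => f w + g w)%C z (l + m)%C.
Proof.
  intros Hf Hg; generalize (tends_plus _ _ _ _ _ Hf Hg); apply tends_ext.
  generalize (near_neq z); apply near_imp; intros w Hw; field; now apply Cminus_neq.
Qed.

Lemma cder_opp (f : C -> C) (z l : C) : cder f z l -> cder (fun w => - f w)%C z (- l)%C.
Proof.
  intros Hf; generalize (tends_opp _ _ _ Hf); apply tends_ext.
  generalize (near_neq z); apply near_imp; intros w Hw; field; now apply Cminus_neq.
Qed.

Lemma cder_minus (f g : C -> C) (z l m : C) :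
  cder f z l -> cder g z m -> cder (fun w => f w - g w)%C z (l - m)%C.
Proof. intros; apply cder_plus; auto; now apply cder_opp. Qed.

Lemma cder_mult (f g : C -> C) (z l m : C) :
  cder f z l -> cder g z m -> cder (fun w => f w * g w)%C z (l * g z + f z * m)%C.
Proof.
  intros Hf Hg.
  generalize (tends_plus _ _ _ _ _ (tends_mult _ _ _ _ _ Hf (cder_ccont _ _ _ Hg))
     (tends_mult _ _ _ _ _ (tends_const (f z) z) Hg)); apply tends_ext.
  generalize (near_neq z); apply near_imp; intros w Hw; field; now apply Cminus_neq.
Qed.

Lemma cder_inv (f : C -> C) (z l : C) :
  f z <> 0%C -> cder f z l -> cder (fun w => / f w)%C z (- l / (f z * f z))%C.
Proof.
  intros Hz Hf; pose proof (cder_ccont _ _ _ Hf) as Hc.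
  assert (Hzz : (f z * f z)%C <> 0%C) by now apply Cmult_neq_0.
  generalize (tends_div _ _ _ _ _ Hzz (tends_opp _ _ _ Hf)
     (tends_mult _ _ _ _ _ Hc (tends_const (f z) z))); apply tends_ext.
  generalize (near_and _ _ _ (near_neq z) (tends_neq0 _ _ _ Hz Hc)); apply near_imp.
  intros w [Hw Hw2]; pose proof (Cmod_ge_0 (f z)).
  assert (f w <> 0%C) by (apply Cmod_gt_0; lra).
  field; repeat split; auto; now apply Cminus_neq.
Qed.

Lemma cder_eq (f : C -> C) (z l m : C) : l = m -> cder f z l -> cder f z m.
Proof. now intros ->. Qed.

Lemma cder_ext (f g : C -> C) (z l : C) :
  near z (fun w => f w = g w) -> f z = g z -> cder f z l -> cder g z l.
Proof.
  intros H Hz; apply tends_ext; generalize H; apply near_imp; intros w Hw.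
  now rewrite Hw, Hz.
Qed.

Lemma cder_ext_ball (f g : C -> C) (z l : C) (r : R) :
  0 < r -> (forall w, Cmod (w - z) < r -> f w = g w) -> cder f z l -> cder g z l.
Proof.
  intros Hr H; apply cder_ext.
  - exists r; split; auto; intros w Hw; apply H; lra.
  - apply H; rewrite Cmod_diag; lra.
Qed.

(** Division of [f - f z] by [w - z], with the hole at [w = z] filled by [l]. For [l = C_derive f z]
    it preserves holomorphy, and iterating it takes the place of power series. *)
Definition dquot (f : C -> C) (z l w : C) : C :=
  if excluded_middle_informative (w = z) then l else ((f w - f z) / (w - z))%C.

Lemma dquot_diag (f : C -> C) (z l : C) : dquot f z l z = l.
Proof. unfold dquot; destruct excluded_middle_informative as [_|n]; [auto | now destruct n]. Qed.

Lemma dquot_off (f : C -> C) (z l w : C) : w <> z -> dquot f z l w = ((f w - f z) / (w - z))%C.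
Proof. intros H; unfold dquot; now destruct excluded_middle_informative. Qed.

Lemma dquot_eq (f : C -> C) (z l w : C) : (f w = f z + (w - z) * dquot f z l w)%C.
Proof.
  unfold dquot; destruct excluded_middle_informative as [->|n]; [ring|].
  field; now apply Cminus_neq.
Qed.

Lemma dquot_ccont (f : C -> C) (z l : C) : cder f z l -> ccont (dquot f z l) z.
Proof.
  unfold ccont; rewrite dquot_diag; apply tends_ext; generalize (near_neq z); apply near_imp.
  intros w Hw; now rewrite dquot_off.
Qed.

Lemma cder_comp (f g : C -> C) (z l m : C) :
  cder g z l -> cder f (g z) m -> cder (fun w => f (g w)) z (m * l)%C.
Proof.
  intros Hg Hf; rewrite <- (dquot_diag f (g z) m).
  generalize (tends_mult _ _ _ _ _
    (tends_comp_ccont _ _ _ _ (cder_ccont _ _ _ Hg) (dquot_ccont _ _ _ Hf)) Hg).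
  apply tends_ext; generalize (near_neq z); apply near_imp; intros w Hw.
  rewrite (dquot_eq f (g z) m (g w)); field; now apply Cminus_neq.
Qed.

Lemma cder_scal (c : C) (f : C -> C) (z l : C) :
  cder f z l -> cder (fun w => c * f w)%C z (c * l)%C.
Proof.
  intros H; eapply cder_eq; [|apply (cder_mult _ _ _ _ _ (cder_const c z) H)]; simpl; ring.
Qed.

Lemma cder_pow (z : C) (n : nat) (a : C) :
  cder (fun w => (w - a) ^ n)%C z (RtoC (INR n) * (z - a) ^ (pred n))%C.
Proof.
  induction n.
  - apply (cder_eq _ _ 0%C); [simpl; ring | exact (cder_const 1%C z)].
  - assert (H : cder (fun w => w - a)%C z 1%C).
    { eapply cder_eq; [|apply cder_minus; [apply cder_id | apply cder_const]]; ring. }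
    eapply cder_eq; [|exact (cder_mult _ _ _ _ _ H IHn)].
    rewrite S_INR, RtoC_plus; destruct n; simpl; ring.
Qed.

Lemma cder_is_derive (f : C -> C) (z l : C) :
  cder f z l <-> @is_derive C_AbsRing C_NormedModule f z l.
Proof.
  split.
  - intros H; split; [apply is_linear_scal_l|].
    intros x Hx e.
    apply (@is_filter_lim_locally_unique _ (AbsRing_NormedModule C_AbsRing) z x) in Hx; subst x.
    destruct (H e (cond_pos e)) as [d [Hd H1]].
    exists (mkposreal d Hd); intros y Hy.
    change (Cmod (f y - f z - (y - z) * l) <= e * Cmod (y - z)).
    change (Cmod (y - z) < d) in Hy.
    destruct (classic (y = z)) as [-> | Hn].
    + replace (f z - f z - (z - z) * l)%C with (RtoC 0) by ring.
      rewrite Cmod_0, Cmod_diag; lra.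
    + pose proof (Cmod_minus_gt0 _ _ Hn).
      replace (f y - f z - (y - z) * l)%C with (((f y - f z) / (y - z) - l) * (y - z))%C
        by (field; now apply Cminus_neq).
      rewrite Cmod_mult; apply Rmult_le_compat_r; [lra|].
      left; apply H1; split; auto.
  - intros [_ H] e He.
    destruct (H z (fun P HP => HP) (mkposreal (e / 2) ltac:(lra))) as [d H1].
    exists d; split; [apply cond_pos|]; intros w [Hw1 Hw2].
    specialize (H1 w Hw2).
    change (Cmod (f w - f z - (w - z) * l) <= e / 2 * Cmod (w - z)) in H1.
    assert (Hn : (w - z)%C <> 0%C) by (apply Cmod_gt_0; auto).
    replace ((f w - f z) / (w - z) - l)%C with ((f w - f z - (w - z) * l) / (w - z))%C
      by (field; auto).
    rewrite Cmod_div by auto.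
    apply Rle_lt_trans with (e / 2); [|lra].
    apply (Rmult_le_reg_r (Cmod (w - z))); auto.
    unfold Rdiv at 1; rewrite Rmult_assoc, Rinv_l; lra.
Qed.

(* [C_derive] is a limit along the real direction only: it is meaningful once differentiability is known. *)
Lemma C_derive_cder (f : C -> C) (z l : C) : cder f z l -> C_derive f z = l.
Proof. intros H; apply is_C_derive_unique, cder_is_derive, H. Qed.

Lemma ccont_plus (f g : C -> C) (z : C) : ccont f z -> ccont g z -> ccont (fun w => f w + g w)%C z.
Proof. exact (tends_plus f g z (f z) (g z)). Qed.

Lemma ccont_minus (f g : C -> C) (z : C) : ccont f z -> ccont g z -> ccont (fun w => f w - g w)%C z.
Proof. exact (tends_minus f g z (f z) (g z)). Qed.

Lemma ccont_mult (f g : C -> C) (z : C) : ccont f z -> ccont g z -> ccont (fun w => f w * g w)%C z.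
Proof. exact (tends_mult f g z (f z) (g z)). Qed.

Lemma ccont_inv (f : C -> C) (z : C) : f z <> 0%C -> ccont f z -> ccont (fun w => / f w)%C z.
Proof. exact (tends_inv f z (f z)). Qed.

Lemma ccont_div (f g : C -> C) (z : C) :
  g z <> 0%C -> ccont f z -> ccont g z -> ccont (fun w => f w / g w)%C z.
Proof. exact (tends_div f g z (f z) (g z)). Qed.

Lemma ccont_const (c z : C) : ccont (fun _ => c) z.
Proof. exact (tends_const c z). Qed.

Lemma ccont_id (z : C) : ccont (fun w => w) z.
Proof. exact (tends_id z). Qed.

Lemma ccont_comp (f g : C -> C) (z : C) : ccont g z -> ccont f (g z) -> ccont (fun w => f (g w)) z.
Proof. exact (tends_comp_ccont f g z (g z)). Qed.

Lemma cder_div (f g : C -> C) (z l m : C) :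
  g z <> 0%C -> cder f z l -> cder g z m ->
  cder (fun w => f w / g w)%C z ((l * g z - f z * m) / (g z * g z))%C.
Proof.
  intros Hg Hf Hm; eapply cder_eq; [|apply cder_mult; [exact Hf | apply cder_inv; eauto]].
  simpl; field; auto.
Qed.

Lemma cder_sub_const (z c : C) : cder (fun w => w - c)%C z 1%C.
Proof. apply (cder_eq _ _ (1 - 0)%C); [ring | apply cder_minus; [apply cder_id | apply cder_const]]. Qed.

Lemma dquot_cder (f : C -> C) (z l w m : C) :
  w <> z -> cder f w m -> exists k, cder (dquot f z l) w k.
Proof.
  intros Hn Hf; eexists.
  apply (cder_ext (fun y => (f y - f z) / (y - z))%C).
  - exists (Cmod (w - z)); split; [now apply Cmod_minus_gt0|].
    intros y Hy; rewrite dquot_off; auto; intros ->; rewrite Cmod_sym in Hy; lra.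
  - now rewrite dquot_off.
  - apply cder_div; [now apply Cminus_neq | | apply cder_sub_const].
    apply cder_minus; [exact Hf | apply cder_const].
Qed.

(** Tailored to integrals with a parameter, because a bounded second-order remainder survives
    integration. [Rabs M + 1] keeps the denominator positive whatever the sign of [M]. *)
Lemma cder_of_expansion (f : C -> C) (z l : C) (r M : R) :
  0 < r -> (forall w, Cmod (w - z) < r -> exists J, Cmod J <= M /\ f w = (f z + (w - z) * l + (w - z) * (w - z) * J)%C) -> cder f z l.
Proof.
  intros Hr H e He; pose proof (Rabs_pos M).
  assert (Hq : 0 < e / (Rabs M + 1)) by (apply Rdiv_lt_0_compat; lra).
  exists (Rmin r (e / (Rabs M + 1))); split; [now apply Rmin_pos|].
  intros w [H1 H2]; pose proof (Rmin_l r (e / (Rabs M + 1))); pose proof (Rmin_r r (e / (Rabs M + 1))).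
  destruct (H w ltac:(lra)) as [J [HJ E]].
  rewrite E; replace ((f z + (w - z) * l + (w - z) * (w - z) * J - f z) / (w - z) - l)%C
    with ((w - z) * J)%C by (field; apply Cmod_gt_0; auto).
  rewrite Cmod_mult; pose proof (Cmod_ge_0 J); pose proof (Rle_abs M).
  apply Rle_lt_trans with (Cmod (w - z) * Rabs M); [apply Rmult_le_compat_l; lra|].
  apply Rle_lt_trans with (Cmod (w - z) * (Rabs M + 1) - Cmod (w - z)); [lra|].
  assert (Cmod (w - z) * (Rabs M + 1) <= e); [|lra].
  apply Rle_trans with (e / (Rabs M + 1) * (Rabs M + 1)); [apply Rmult_le_compat_r; lra|].
  right; field; lra.
Qed.

(** * Bisection of rectangles and integrals of complex-valued functions *)

(** Every right endpoint bounds every left endpoint, so the supremum of the left endpoints lies in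
    all the intervals. *)
Lemma nested_point (xs : nat -> R) (W : R) :
  0 <= W -> (forall n, xs n <= xs (S n)) ->
  (forall n, xs (S n) + W / 2 ^ (S n) <= xs n + W / 2 ^ n) ->
  exists a, forall n, xs n <= a <= xs n + W / 2 ^ n.
Proof.
  intros HW H1 H2.
  assert (Hm : forall n k, xs n <= xs (n + k)%nat).
  { intros n k; induction k; [rewrite Nat.add_0_r; lra|].
    rewrite Nat.add_succ_r; eapply Rle_trans; eauto. }
  assert (Hd : forall n k, xs (n + k)%nat + W / 2 ^ (n + k) <= xs n + W / 2 ^ n).
  { intros n k; induction k; [rewrite Nat.add_0_r; lra|].
    rewrite Nat.add_succ_r; eapply Rle_trans; eauto. }
  assert (Hp : forall n, 0 <= W / 2 ^ n).
  { intros n; apply Rdiv_le_0_compat; auto; apply pow_lt; lra. }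
  assert (Hb : forall n m, xs m <= xs n + W / 2 ^ n).
  { intros n m; destruct (Nat.le_ge_cases n m) as [Hl|Hl].
    - replace m with (n + (m - n))%nat by lia.
      pose proof (Hd n (m - n)%nat); pose proof (Hp (n + (m - n))%nat); lra.
    - pose proof (Hm m (n - m)%nat) as Hx; replace (m + (n - m))%nat with n in Hx by lia.
      pose proof (Hp n); lra. }
  destruct (completeness (fun y => exists n, y = xs n)) as [a [Ha1 Ha2]].
  - exists (xs 0%nat + W / 2 ^ 0); intros y [n ->]; apply Hb.
  - exists (xs 0%nat), 0%nat; auto.
  - exists a; intros n; split.
    + apply Ha1; eauto.
    + apply Ha2; intros y [m ->]; apply Hb.
Qed.

Lemma pow2_small (W e : R) : 0 < e -> exists n, Rabs W / 2 ^ n < e.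
Proof.
  intros He; destruct (pow_lt_1_zero (1 / 2) ltac:(rewrite Rabs_pos_eq; lra) (e / (Rabs W + 1))) as [n Hn].
  { apply Rdiv_lt_0_compat; auto; pose proof (Rabs_pos W); lra. }
  exists n; specialize (Hn n (le_n n)); pose proof (Rabs_pos W).
  assert (Hp : 0 < 2 ^ n) by (apply pow_lt; lra).
  rewrite Rabs_pos_eq in Hn by (apply pow_le; lra).
  unfold Rdiv at 1 in Hn; rewrite Rmult_1_l, pow_inv in Hn.
  apply (Rmult_lt_compat_r (Rabs W + 1)) in Hn; [|lra].
  unfold Rdiv in Hn at 1; rewrite (Rmult_assoc e), Rinv_l, Rmult_1_r in Hn by lra.
  assert (0 < / 2 ^ n) by (now apply Rinv_0_lt_compat).
  unfold Rdiv; nra.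
Qed.

(* A rectangle is given by its lower left corner, width and height. *)
Lemma bisection (P : R -> R -> R -> R -> Prop) (X Y W H : R) :
  0 <= W -> 0 <= H ->
  (forall x y w h, 0 <= w -> 0 <= h -> X <= x -> x + w <= X + W -> Y <= y -> y + h <= Y + H ->
     P x y (w / 2) (h / 2) -> P (x + w / 2) y (w / 2) (h / 2) ->
     P x (y + h / 2) (w / 2) (h / 2) -> P (x + w / 2) (y + h / 2) (w / 2) (h / 2) ->
     P x y w h) ->
  (forall a b, X <= a <= X + W -> Y <= b <= Y + H ->
     exists e, 0 < e /\ forall x y w h, 0 <= w < e -> 0 <= h < e ->
       X <= x -> x + w <= X + W -> Y <= y -> y + h <= Y + H ->
       x <= a <= x + w -> y <= b <= y + h -> P x y w h) ->
  P X Y W H.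
Proof.
  intros HW HH Hq Hl; apply NNPP; intros HP.
  set (wn := fun n => W / 2 ^ n); set (hn := fun n => H / 2 ^ n).
  (* The next rectangle is the first quarter on which [P] fails. The upper right quarter is the
     default: if [P] held on all four, [Hq] would give it on the parent. *)
  set (step := fun (n : nat) (p : R * R) =>
    let x := fst p in let y := snd p in let w := wn (S n) in let h := hn (S n) in
    if excluded_middle_informative (~ P x y w h) then (x, y) else
    if excluded_middle_informative (~ P (x + w) y w h) then (x + w, y) else
    if excluded_middle_informative (~ P x (y + h) w h) then (x, y + h) else
    (x + w, y + h)).
  set (s := fix s (n : nat) : R * R := match n with O => (X, Y) | S m => step m (s m) end).
  assert (Hwn : forall n, wn (S n) = wn n / 2).
  { intros n; unfold wn; simpl; field; apply pow_nonzero; lra. }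
  assert (Hhn : forall n, hn (S n) = hn n / 2).
  { intros n; unfold hn; simpl; field; apply pow_nonzero; lra. }
  assert (Hw0 : forall n, 0 <= wn n).
  { intros n; apply Rdiv_le_0_compat; auto; apply pow_lt; lra. }
  assert (Hh0 : forall n, 0 <= hn n).
  { intros n; apply Rdiv_le_0_compat; auto; apply pow_lt; lra. }
  assert (Hst : forall n p, let q := step n p in
     (fst q = fst p \/ fst q = fst p + wn (S n)) /\ (snd q = snd p \/ snd q = snd p + hn (S n))).
  { intros n p; unfold step; simpl.
    destruct excluded_middle_informative; simpl; auto.
    destruct excluded_middle_informative; simpl; auto.
    destruct excluded_middle_informative; simpl; auto. }
  assert (Hin : forall n, X <= fst (s n) /\ fst (s n) + wn n <= X + W /\
                          Y <= snd (s n) /\ snd (s n) + hn n <= Y + H).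
  { induction n.
    - simpl; unfold wn, hn; simpl; rewrite !Rdiv_1_r; lra.
    - destruct (Hst n (s n)) as [[E1|E1] [E2|E2]]; change (step n (s n)) with (s (S n)) in *;
      rewrite E1, E2; rewrite Hwn, Hhn in *; pose proof (Hw0 n); pose proof (Hh0 n); lra. }
  assert (HnP : forall n, ~ P (fst (s n)) (snd (s n)) (wn n) (hn n)).
  { induction n.
    - simpl; unfold wn, hn; simpl; rewrite !Rdiv_1_r; auto.
    - intros HS; apply IHn.
      destruct (Hin n) as (I1 & I2 & I3 & I4).
      revert HS; change (s (S n)) with (step n (s n)); unfold step.
      rewrite Hwn, Hhn.
      destruct excluded_middle_informative as [n1|n1]; simpl; [intros; now destruct n1|].
      destruct excluded_middle_informative as [n2|n2]; simpl; [intros; now destruct n2|].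
      destruct excluded_middle_informative as [n3|n3]; simpl; [intros; now destruct n3|].
      intros HS; apply NNPP in n1; apply NNPP in n2; apply NNPP in n3.
      apply Hq; auto. }
  destruct (nested_point (fun n => fst (s n)) W HW) as [a Ha].
  { intros n; destruct (Hst n (s n)) as [[E|E] _]; change (step n (s n)) with (s (S n)) in *;
    rewrite E; pose proof (Hw0 (S n)); lra. }
  { intros n; fold (wn (S n)); fold (wn n);
    destruct (Hst n (s n)) as [[E|E] _]; change (step n (s n)) with (s (S n)) in *;
    rewrite E; rewrite Hwn; pose proof (Hw0 n); lra. }
  destruct (nested_point (fun n => snd (s n)) H HH) as [b Hb].
  { intros n; destruct (Hst n (s n)) as [_ [E|E]]; change (step n (s n)) with (s (S n)) in *;
    rewrite E; pose proof (Hh0 (S n)); lra. }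
  { intros n; fold (hn (S n)); fold (hn n);
    destruct (Hst n (s n)) as [_ [E|E]]; change (step n (s n)) with (s (S n)) in *;
    rewrite E; rewrite Hhn; pose proof (Hh0 n); lra. }
  destruct (Hl a b) as [e [He Hloc]].
  { pose proof (Ha 0%nat) as HH0; simpl in HH0; rewrite Rdiv_1_r in HH0; lra. }
  { pose proof (Hb 0%nat) as HH0; simpl in HH0; rewrite Rdiv_1_r in HH0; lra. }
  destruct (pow2_small (W + H) e He) as [n Hn].
  assert (Hs : wn n + hn n < e).
  { unfold wn, hn; rewrite Rabs_pos_eq in Hn by lra; lra. }
  destruct (Hin n) as (I1 & I2 & I3 & I4).
  pose proof (Hw0 n); pose proof (Hh0 n).
  apply (HnP n), Hloc; auto; lra.
Qed.

(** * Integrals of complex-valued functions of a real variable *)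

Definition rcont (f : R -> C) (t : R) : Prop :=
  forall e, 0 < e -> exists d, 0 < d /\ forall s, Rabs (s - t) < d -> Cmod (f s - f t) < e.

Lemma rcont_fst (f : R -> C) (t : R) : rcont f t -> continuous (fun s => fst (f s)) t.
Proof.
  intros H; apply filterlim_locally; intros e.
  destruct (H e (cond_pos e)) as [d [Hd H1]].
  exists (mkposreal d Hd); intros s Hs; specialize (H1 s Hs).
  pose proof (Rmax_Cmod (f s - f t)%C) as H2; pose proof (Rmax_l (Rabs (fst (f s - f t)%C)) (Rabs (snd (f s - f t)%C))).
  change (Rabs (fst (f s) - fst (f t)) < e).
  change (fst (f s - f t)%C) with (fst (f s) + - fst (f t)) in *; unfold Rminus; lra.
Qed.

Lemma rcont_snd (f : R -> C) (t : R) : rcont f t -> continuous (fun s => snd (f s)) t.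
Proof.
  intros H; apply filterlim_locally; intros e.
  destruct (H e (cond_pos e)) as [d [Hd H1]].
  exists (mkposreal d Hd); intros s Hs; specialize (H1 s Hs).
  pose proof (Rmax_Cmod (f s - f t)%C) as H2; pose proof (Rmax_r (Rabs (fst (f s - f t)%C)) (Rabs (snd (f s - f t)%C))).
  change (Rabs (snd (f s) - snd (f t)) < e).
  change (snd (f s - f t)%C) with (snd (f s) + - snd (f t)) in *; unfold Rminus; lra.
Qed.

Lemma Cmod_le_sum (a b : R) : Cmod (a, b) <= Rabs a + Rabs b.
Proof.
  replace (a, b) with (RtoC a + Ci * RtoC b)%C by (unfold Ci, RtoC, Cplus, Cmult; simpl; f_equal; ring).
  eapply Rle_trans; [apply Cmod_triangle|].
  rewrite Cmod_mult, !Cmod_R, Cmod_Ci; lra.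
Qed.

Lemma Cmod_pair_minus (a b a' b' : R) : Cmod ((a', b') - (a, b)) <= Rabs (a' - a) + Rabs (b' - b).
Proof.
  replace ((a', b') - (a, b))%C with (a' - a, b' - b) by (unfold Cminus, Cplus, Copp; simpl; f_equal; ring).
  apply Cmod_le_sum.
Qed.

Lemma rect_dist (x y w h a b a' b' : R) : x <= a <= x + w -> y <= b <= y + h ->
  x <= a' <= x + w -> y <= b' <= y + h -> Cmod ((a', b') - (a, b)) <= w + h.
Proof.
  intros; eapply Rle_trans; [apply Cmod_pair_minus|]; apply Rplus_le_compat; apply Rabs_le; lra.
Qed.

Lemma rcont_comp (f : C -> C) (g : R -> C) (t : R) :
  ccont f (g t) -> rcont g t -> rcont (fun s => f (g s)) t.
Proof.
  intros Hf Hg e He; destruct (ccont_nbhd _ _ Hf e He) as [d [Hd H]].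
  destruct (Hg d Hd) as [d' [Hd' H']]; exists d'; split; auto.
Qed.

Lemma rcont_vert (x t : R) : rcont (fun s => (x, s)) t.
Proof.
  intros e He; exists e; split; auto; intros s Hs.
  eapply Rle_lt_trans; [apply Cmod_pair_minus|]; rewrite Rminus_diag, Rabs_R0; lra.
Qed.

Lemma rcont_horiz (y t : R) : rcont (fun s => (s, y)) t.
Proof.
  intros e He; exists e; split; auto; intros s Hs.
  eapply Rle_lt_trans; [apply Cmod_pair_minus|]; rewrite Rminus_diag, Rabs_R0; lra.
Qed.

Definition CInt (f : R -> C) (a b : R) : C :=
  (RInt (fun t => fst (f t)) a b, RInt (fun t => snd (f t)) a b).

Definition rcont_on (f : R -> C) (a b : R) : Prop := forall t, a <= t <= b -> rcont f t.

Lemma ex_RInt_fst (f : R -> C) (a b : R) : a <= b -> rcont_on f a b -> ex_RInt (fun t => fst (f t)) a b.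
Proof.
  intros Hab H; apply (ex_RInt_continuous (V := R_CompleteNormedModule)); intros z Hz.
  rewrite Rmin_left, Rmax_right in Hz by auto; apply rcont_fst, H, Hz.
Qed.

Lemma ex_RInt_snd (f : R -> C) (a b : R) : a <= b -> rcont_on f a b -> ex_RInt (fun t => snd (f t)) a b.
Proof.
  intros Hab H; apply (ex_RInt_continuous (V := R_CompleteNormedModule)); intros z Hz.
  rewrite Rmin_left, Rmax_right in Hz by auto; apply rcont_snd, H, Hz.
Qed.

Lemma CInt_ext (f g : R -> C) (a b : R) :
  a <= b -> (forall t, a <= t <= b -> f t = g t) -> CInt f a b = CInt g a b.
Proof.
  intros Hab H; unfold CInt; f_equal; apply (RInt_ext (V := R_CompleteNormedModule));
  rewrite Rmin_left, Rmax_right by auto; intros x Hx; rewrite H; auto; lra.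
Qed.

Lemma CInt_plus (f g : R -> C) (a b : R) :
  a <= b -> rcont_on f a b -> rcont_on g a b ->
  CInt (fun t => f t + g t)%C a b = (CInt f a b + CInt g a b)%C.
Proof.
  intros Hab Hf Hg; unfold CInt, Cplus; simpl; f_equal;
  apply (RInt_plus (V := R_CompleteNormedModule)); auto using ex_RInt_fst, ex_RInt_snd.
Qed.

Lemma CInt_scal (c : C) (f : R -> C) (a b : R) :
  a <= b -> rcont_on f a b -> CInt (fun t => c * f t)%C a b = (c * CInt f a b)%C.
Proof.
  intros Hab Hf; pose proof (ex_RInt_fst _ _ _ Hab Hf) as H1; pose proof (ex_RInt_snd _ _ _ Hab Hf) as H2.
  unfold CInt, Cmult; simpl; f_equal.
  - rewrite (RInt_minus (V := R_CompleteNormedModule) (fun x => fst c * fst (f x)) (fun x => snd c * snd (f x))).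
    + rewrite !(RInt_scal (V := R_CompleteNormedModule)) by auto; reflexivity.
    + now apply (ex_RInt_scal (V := R_CompleteNormedModule)).
    + now apply (ex_RInt_scal (V := R_CompleteNormedModule)).
  - rewrite (RInt_plus (V := R_CompleteNormedModule) (fun x => fst c * snd (f x)) (fun x => snd c * fst (f x))).
    + rewrite !(RInt_scal (V := R_CompleteNormedModule)) by auto; reflexivity.
    + now apply (ex_RInt_scal (V := R_CompleteNormedModule)).
    + now apply (ex_RInt_scal (V := R_CompleteNormedModule)).
Qed.

Lemma CInt_const (c : C) (a b : R) : CInt (fun _ => c) a b = (RtoC (b - a) * c)%C.
Proof.
  unfold CInt, Cmult, RtoC; simpl; rewrite !RInt_const.
  unfold scal; simpl; unfold mult; simpl; f_equal; ring.
Qed.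

Lemma CInt_Chasles (f : R -> C) (a b c : R) :
  a <= b -> b <= c -> rcont_on f a c -> (CInt f a b + CInt f b c)%C = CInt f a c.
Proof.
  intros Hab Hbc Hf.
  assert (rcont_on f a b) by (intros t Ht; apply Hf; lra).
  assert (rcont_on f b c) by (intros t Ht; apply Hf; lra).
  unfold CInt, Cplus; simpl; f_equal; apply (RInt_Chasles (V := R_CompleteNormedModule));
  auto using ex_RInt_fst, ex_RInt_snd.
Qed.

(** The factor 2 comes from estimating the real and the imaginary part separately; the later
    estimates all have room for it. *)
Lemma CInt_bound (f : R -> C) (a b M : R) :
  a <= b -> rcont_on f a b -> (forall t, a <= t <= b -> Cmod (f t) <= M) ->
  Cmod (CInt f a b) <= 2 * M * (b - a).
Proof.
  intros Hab Hf HM; eapply Rle_trans; [apply Cmod_le_sum|].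
  assert (Rabs (RInt (fun t => fst (f t)) a b) <= (b - a) * M).
  { apply abs_RInt_le_const; auto using ex_RInt_fst; intros t Ht.
    eapply Rle_trans; [|apply HM, Ht]; eapply Rle_trans; [|apply Rmax_Cmod]; apply Rmax_l. }
  assert (Rabs (RInt (fun t => snd (f t)) a b) <= (b - a) * M).
  { apply abs_RInt_le_const; auto using ex_RInt_snd; intros t Ht.
    eapply Rle_trans; [|apply HM, Ht]; eapply Rle_trans; [|apply Rmax_Cmod]; apply Rmax_r. }
  lra.
Qed.

Lemma CInt_shift (f : R -> C) (a b c : R) :
  a <= b -> rcont_on f (a + c) (b + c) -> CInt (fun t => f (t + c)) a b = CInt f (a + c) (b + c).
Proof.
  intros Hab Hf; unfold CInt; f_equal.
  - pose proof (RInt_comp_lin (V := R_CompleteNormedModule) (fun t => fst (f t)) 1 c a b) as H.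
    rewrite !Rmult_1_l in H; rewrite <- H by (apply ex_RInt_fst; auto; lra).
    apply (RInt_ext (V := R_CompleteNormedModule)); intros x _; unfold scal; simpl; unfold mult; simpl.
    now rewrite !Rmult_1_l.
  - pose proof (RInt_comp_lin (V := R_CompleteNormedModule) (fun t => snd (f t)) 1 c a b) as H.
    rewrite !Rmult_1_l in H; rewrite <- H by (apply ex_RInt_snd; auto; lra).
    apply (RInt_ext (V := R_CompleteNormedModule)); intros x _; unfold scal; simpl; unfold mult; simpl.
    now rewrite !Rmult_1_l.
Qed.

Lemma RInt_affine (p q a b : R) :
  RInt (fun t => p + q * t) a b = p * (b - a) + q * (b ^ 2 - a ^ 2) / 2.
Proof.
  apply is_RInt_unique.
  assert (H : is_RInt (fun t => p + q * t) a b
    (minus ((fun t => p * t + q * t ^ 2 / 2) b) ((fun t => p * t + q * t ^ 2 / 2) a))).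
  { apply (is_RInt_derive (V := R_CompleteNormedModule) (fun t => p * t + q * t ^ 2 / 2)).
    - intros x _; auto_derive; auto; field.
    - intros x _; apply (continuous_plus (V := R_NormedModule)); [apply continuous_const|].
      apply (continuous_scal_r (V := R_NormedModule)), continuous_id. }
  replace (p * (b - a) + q * (b ^ 2 - a ^ 2) / 2) with
    (p * b + q * b ^ 2 / 2 + - (p * a + q * a ^ 2 / 2)) by field.
  exact H.
Qed.

Lemma CInt_affine (p q : C) (a b : R) :
  CInt (fun t => p + q * RtoC t)%C a b = (p * RtoC (b - a) + q * RtoC ((b ^ 2 - a ^ 2) / 2))%C.
Proof.
  unfold CInt, Cplus, Cmult, RtoC; simpl; f_equal.
  - transitivity (RInt (fun t => fst p + fst q * t) a b).
    + apply (RInt_ext (V := R_CompleteNormedModule)); intros x _; simpl; ring.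
    + rewrite RInt_affine; simpl; field.
  - transitivity (RInt (fun t => snd p + snd q * t) a b).
    + apply (RInt_ext (V := R_CompleteNormedModule)); intros x _; simpl; ring.
    + rewrite RInt_affine; simpl; field.
Qed.

Lemma rcont_on_const (c : C) (a b : R) : rcont_on (fun _ => c) a b.
Proof. intros t _ e He; exists 1; split; [lra|]; intros; rewrite Cmod_diag; lra. Qed.

Lemma rcont_on_scal (c : C) (f : R -> C) (a b : R) : rcont_on f a b -> rcont_on (fun t => c * f t)%C a b.
Proof.
  intros Hf t Ht; apply (rcont_comp (fun w => c * w)%C f); [|auto].
  apply ccont_mult; [apply ccont_const | apply ccont_id].
Qed.

Lemma rcont_on_plus (f g : R -> C) (a b : R) :
  rcont_on f a b -> rcont_on g a b -> rcont_on (fun t => f t + g t)%C a b.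
Proof.
  intros Hf Hg t Ht e He.
  destruct (Hf t Ht (e / 2) ltac:(lra)) as [d [Hd H1]]; destruct (Hg t Ht (e / 2) ltac:(lra)) as [d' [Hd' H2]].
  exists (Rmin d d'); split; [now apply Rmin_pos|]; intros s Hs.
  pose proof (Rmin_l d d'); pose proof (Rmin_r d d').
  specialize (H1 s ltac:(lra)); specialize (H2 s ltac:(lra)).
  replace (f s + g s - (f t + g t))%C with ((f s - f t) + (g s - g t))%C by ring.
  pose proof (Cmod_triangle (f s - f t) (g s - g t)); lra.
Qed.

Lemma CInt_minus (f g : R -> C) (a b : R) :
  a <= b -> rcont_on f a b -> rcont_on g a b ->
  CInt (fun t => f t - g t)%C a b = (CInt f a b - CInt g a b)%C.
Proof.
  intros Hab Hf Hg.
  transitivity (CInt (fun t => f t + (- (1)) * g t)%C a b).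
  { apply CInt_ext; auto; intros; ring. }
  rewrite CInt_plus, CInt_scal by auto using rcont_on_scal; ring.
Qed.

Lemma CInt_close (f g : R -> C) (a b M : R) :
  a <= b -> rcont_on f a b -> rcont_on g a b ->
  (forall t, a <= t <= b -> Cmod (f t - g t) <= M) ->
  Cmod (CInt f a b - CInt g a b) <= 2 * M * (b - a).
Proof.
  intros Hab Hf Hg H; rewrite <- CInt_minus by auto; apply CInt_bound; auto.
  intros t Ht e He; destruct (rcont_on_plus _ _ _ _ Hf (rcont_on_scal (- (1)) _ _ _ Hg) t Ht e He) as [d [Hd H1]].
  exists d; split; auto; intros s Hs; specialize (H1 s Hs).
  now replace (f s - g s - (f t - g t))%C with (f s + - (1) * g s - (f t + - (1) * g t))%C by ring.
Qed.

(** Differentiation under the integral sign without a limit theorem: the kernel brings its own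
    expansion with remainder [j], and integrating that expansion gives the one that
    [cder_of_expansion] asks for. *)
Lemma param_cder (a b : R) (k : R -> C -> C) (k1 : R -> C) (j : R -> C -> C) (z : C) (r M : R) :
  a <= b -> 0 < r -> rcont_on k1 a b ->
  (forall w, Cmod (w - z) < r -> rcont_on (fun t => k t w) a b /\ rcont_on (fun t => j t w) a b /\
     forall t, a <= t <= b -> Cmod (j t w) <= M /\
       k t w = (k t z + (w - z) * k1 t + (w - z) * (w - z) * j t w)%C) ->
  cder (fun w => CInt (fun t => k t w) a b) z (CInt k1 a b).
Proof.
  intros Hab Hr Hk1 H.
  apply (cder_of_expansion _ _ _ r (2 * M * (b - a))); auto.
  intros w Hw; destruct (H w Hw) as (Hc1 & Hc2 & H3).
  exists (CInt (fun t => j t w) a b); split.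
  - apply CInt_bound; auto; intros t Ht; apply H3, Ht.
  - assert (Hz : rcont_on (fun t => k t z) a b) by (apply H; rewrite Cmod_diag; lra).
    rewrite <- !CInt_scal, <- !CInt_plus by auto using rcont_on_plus, rcont_on_scal.
    apply CInt_ext; auto; intros t Ht; apply H3, Ht.
Qed.

(** Compactness by bisection: the largest of the four bounds serves the parent rectangle. No
    continuity of [g] is assumed, so it can later be cut off to 0 outside a region. *)
Lemma rect_bounded (g : C -> R) (X Y W H : R) :
  0 <= W -> 0 <= H ->
  (forall a b, X <= a <= X + W -> Y <= b <= Y + H ->
     exists d M, 0 < d /\ forall w, Cmod (w - (a, b)) < d -> g w <= M) ->
  exists M, forall a b, X <= a <= X + W -> Y <= b <= Y + H -> g (a, b) <= M.
Proof.
  intros HW HH Hg.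
  apply (bisection (fun x y w h => exists M, forall a b, x <= a <= x + w -> y <= b <= y + h -> g (a, b) <= M)); auto.
  - intros x y w h Hw Hh _ _ _ _ [M1 P1] [M2 P2] [M3 P3] [M4 P4].
    exists (Rmax (Rmax M1 M2) (Rmax M3 M4)); intros a b Ha Hb.
    pose proof (Rmax_l (Rmax M1 M2) (Rmax M3 M4)); pose proof (Rmax_r (Rmax M1 M2) (Rmax M3 M4)).
    pose proof (Rmax_l M1 M2); pose proof (Rmax_r M1 M2); pose proof (Rmax_l M3 M4); pose proof (Rmax_r M3 M4).
    destruct (Rle_dec a (x + w / 2)), (Rle_dec b (y + h / 2)).
    + specialize (P1 a b ltac:(lra) ltac:(lra)); lra.
    + specialize (P3 a b ltac:(lra) ltac:(lra)); lra.
    + specialize (P2 a b ltac:(lra) ltac:(lra)); lra.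
    + specialize (P4 a b ltac:(lra) ltac:(lra)); lra.
  - intros a b Ha Hb; destruct (Hg a b Ha Hb) as (d & M & Hd & HM).
    exists (d / 2); split; [lra|]; intros x y w h Hw Hh _ _ _ _ Hxa Hyb.
    exists M; intros a' b' Ha' Hb'; apply HM.
    pose proof (rect_dist x y w h a b a' b' Hxa Hyb Ha' Hb'); lra.
Qed.

(** * Goursat's theorem *)

Definition VInt (f : C -> C) (x a b : R) : C := CInt (fun t => f (x, t)) a b.
Definition HInt (f : C -> C) (y a b : R) : C := CInt (fun t => f (t, y)) a b.

(** The counterclockwise contour integral; [Ci] is [dz / dt] on the vertical sides. *)
Definition boundary (f : C -> C) (x y w h : R) : C :=
  (HInt f y x (x + w) + Ci * VInt f (x + w) y (y + h)
   - HInt f (y + h) x (x + w) - Ci * VInt f x y (y + h))%C.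

Definition ccont_rect (f : C -> C) (x y w h : R) : Prop :=
  forall a b, x <= a <= x + w -> y <= b <= y + h -> ccont f (a, b).

Lemma rcont_on_vert (f : C -> C) (x y w h a : R) :
  ccont_rect f x y w h -> x <= a <= x + w -> rcont_on (fun t => f (a, t)) y (y + h).
Proof.
  intros Hf Ha t Ht; apply (rcont_comp f (fun t => (a, t))); [apply Hf; auto | apply rcont_vert].
Qed.

Lemma rcont_on_horiz (f : C -> C) (x y w h b : R) :
  ccont_rect f x y w h -> y <= b <= y + h -> rcont_on (fun t => f (t, b)) x (x + w).
Proof.
  intros Hf Ha t Ht; apply (rcont_comp f (fun t => (t, b))); [apply Hf; auto | apply rcont_horiz].
Qed.

(** Each inner edge is traversed twice in opposite directions and cancels. *)
Lemma boundary_split (f : C -> C) (x y w h : R) :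
  0 <= w -> 0 <= h -> ccont_rect f x y w h ->
  boundary f x y w h =
  (boundary f x y (w / 2) (h / 2) + boundary f (x + w / 2) y (w / 2) (h / 2)
   + boundary f x (y + h / 2) (w / 2) (h / 2)
   + boundary f (x + w / 2) (y + h / 2) (w / 2) (h / 2))%C.
Proof.
  intros Hw Hh Hf; unfold boundary.
  replace (x + w / 2 + w / 2) with (x + w) by field.
  replace (y + h / 2 + h / 2) with (y + h) by field.
  assert (EH : forall b, y <= b <= y + h ->
    HInt f b x (x + w) = (HInt f b x (x + w / 2) + HInt f b (x + w / 2) (x + w))%C).
  { intros b Hb; symmetry; apply CInt_Chasles; try lra; eapply rcont_on_horiz; eauto. }
  assert (EV : forall a, x <= a <= x + w ->
    VInt f a y (y + h) = (VInt f a y (y + h / 2) + VInt f a (y + h / 2) (y + h))%C).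
  { intros b Hb; symmetry; apply CInt_Chasles; try lra; eapply rcont_on_vert; eauto. }
  rewrite !EH, !EV by lra; ring.
Qed.

Lemma boundary_plus (f g : C -> C) (x y w h : R) :
  0 <= w -> 0 <= h -> ccont_rect f x y w h -> ccont_rect g x y w h ->
  boundary (fun z => f z + g z)%C x y w h = (boundary f x y w h + boundary g x y w h)%C.
Proof.
  intros Hw Hh Hf Hg; unfold boundary, HInt, VInt.
  rewrite !CInt_plus; try lra; try ring;
  try (eapply (rcont_on_horiz _ x y w h); eauto; lra); eapply (rcont_on_vert _ x y w h); eauto; lra.
Qed.

Lemma boundary_bound (f : C -> C) (x y w h M : R) :
  0 <= w -> 0 <= h -> ccont_rect f x y w h ->
  (forall a b, x <= a <= x + w -> y <= b <= y + h -> Cmod (f (a, b)) <= M) ->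
  Cmod (boundary f x y w h) <= 4 * M * (w + h).
Proof.
  intros Hw Hh Hf HM.
  assert (EH : forall b, y <= b <= y + h -> Cmod (HInt f b x (x + w)) <= 2 * M * w).
  { intros b Hb; replace w with (x + w - x) at 2 by ring; apply CInt_bound; try lra.
    - eapply rcont_on_horiz; eauto.
    - intros; apply HM; auto. }
  assert (EV : forall b, x <= b <= x + w -> Cmod (VInt f b y (y + h)) <= 2 * M * h).
  { intros b Hb; replace h with (y + h - y) at 2 by ring; apply CInt_bound; try lra.
    - eapply rcont_on_vert; eauto.
    - intros; apply HM; auto. }
  unfold boundary.
  set (a1 := HInt f y x (x + w)) in *; set (a2 := VInt f (x + w) y (y + h)) in *.
  pose proof (EH y ltac:(lra)); pose proof (EH (y + h) ltac:(lra)).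
  pose proof (EV x ltac:(lra)); pose proof (EV (x + w) ltac:(lra)).
  assert (Hi : forall z, Cmod (Ci * z) = Cmod z) by (intros; rewrite Cmod_mult, Cmod_Ci; ring).
  eapply Rle_trans; [apply Cmod_triangle|]; rewrite Cmod_opp, Hi.
  eapply Rle_trans; [apply Rplus_le_compat_r, Cmod_triangle|]; rewrite Cmod_opp.
  eapply Rle_trans; [apply Rplus_le_compat_r, Rplus_le_compat_r, Cmod_triangle|]; rewrite Hi.
  unfold a1, a2; lra.
Qed.

Lemma boundary_affine (p q : C) (x y w h : R) :
  0 <= w -> 0 <= h -> boundary (fun z => p + q * z)%C x y w h = 0%C.
Proof.
  intros Hw Hh.
  assert (EH : forall b, HInt (fun z => p + q * z)%C b x (x + w) =
     CInt (fun t => (p + q * (0, b)) + q * RtoC t)%C x (x + w)).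
  { intros b; apply CInt_ext; [lra|]; intros t _.
    destruct p, q; unfold Cplus, Cmult, RtoC; simpl; f_equal; ring. }
  assert (EV : forall b, VInt (fun z => p + q * z)%C b y (y + h) =
     CInt (fun t => (p + q * (b, 0)%R) + (q * Ci) * RtoC t)%C y (y + h)).
  { intros b; apply CInt_ext; [lra|]; intros t _.
    destruct p, q; unfold Cplus, Cmult, RtoC, Ci; simpl; f_equal; ring. }
  unfold boundary; rewrite !EH, !EV, !CInt_affine.
  destruct p, q; unfold Cminus, Copp, Cplus, Cmult, RtoC, Ci; simpl; f_equal; field.
Qed.

Lemma cder_affine (p q z : C) : cder (fun w => p + q * w)%C z q.
Proof.
  eapply cder_eq; [|apply cder_plus; [apply cder_const | apply cder_scal, cder_id]]; ring.
Qed.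

Lemma Goursat (f : C -> C) (X Y W H : R) :
  0 <= W -> 0 <= H ->
  (forall a b, X <= a <= X + W -> Y <= b <= Y + H -> exists l, cder f (a, b) l) ->
  boundary f X Y W H = 0%C.
Proof.
  intros HW HH Hf.
  assert (Hc : ccont_rect f X Y W H).
  { intros a b Ha Hb; destruct (Hf a b Ha Hb) as [l Hl]; eapply cder_ccont; eauto. }
  assert (Hsub : forall x y w h, X <= x -> x + w <= X + W -> Y <= y -> y + h <= Y + H -> ccont_rect f x y w h).
  { intros x y w h H1 H2 H3 H4 a b Ha Hb; apply Hc; lra. }
  assert (Main : forall e, 0 < e -> Cmod (boundary f X Y W H) <= e * (W + H) ^ 2).
  { intros e He.
    apply (bisection (fun x y w h => Cmod (boundary f x y w h) <= e * (w + h) ^ 2)); auto.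
    - intros x y w h Hw Hh H1 H2 H3 H4 P1 P2 P3 P4.
      rewrite boundary_split by auto.
      eapply Rle_trans; [apply Cmod_triangle|].
      eapply Rle_trans; [apply Rplus_le_compat_r, Cmod_triangle|].
      eapply Rle_trans; [apply Rplus_le_compat_r, Rplus_le_compat_r, Cmod_triangle|].
      nra.
    - intros a b Ha Hb; destruct (Hf a b Ha Hb) as [l Hl].
      destruct (Hl (e / 4) ltac:(lra)) as [d [Hd Hd1]].
      exists (d / 2); split; [lra|]; intros x y w h Hw Hh H1 H2 H3 H4 Hxa Hyb.
      set (z0 := (a, b) : C) in *.
      set (p := (f z0 - l * z0)%C).
      assert (Hg : ccont_rect (fun z => f z + ((- p) + (- l) * z))%C x y w h).
      { intros a1 b1 Ha1 Hb1; apply ccont_plus; [apply Hc; lra|].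
        apply (cder_ccont _ _ (- l)%C), cder_affine. }
      replace (boundary f x y w h) with (boundary (fun z => f z + ((- p) + (- l) * z))%C x y w h).
      2:{ rewrite (boundary_plus f (fun z => (- p) + (- l) * z)%C), boundary_affine; try lra; auto.
          - ring.
          - intros a' b' Ha' Hb'; apply (cder_ccont _ _ (- l)%C), cder_affine. }
      eapply Rle_trans; [apply (boundary_bound _ x y w h (e / 4 * (w + h))); try lra; auto|].
      + intros a' b' Ha' Hb'.
        assert (Hdist : Cmod ((a', b') - z0) <= w + h).
        { apply (rect_dist x y w h); auto. }
        replace (f (a', b') + (- p + - l * (a', b')%R))%C with (f (a', b') - f z0 - l * ((a', b')%R - z0))%C
          by (unfold p; ring).
        destruct (classic ((a', b') = z0)) as [E|E].
        * rewrite E; replace (f z0 - f z0 - l * (z0 - z0))%C with (RtoC 0) by ring.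
          rewrite Cmod_0; apply Rmult_le_pos; lra.
        * pose proof (Cmod_minus_gt0 _ _ E).
          specialize (Hd1 (a', b') ltac:(lra)); simpl in Hd1.
          replace (f (a', b') - f z0 - l * ((a', b')%R - z0))%C with
            (((f (a', b') - f z0) / ((a', b')%R - z0) - l) * ((a', b')%R - z0))%C
            by (field; now apply Cminus_neq).
          rewrite Cmod_mult; apply Rmult_le_compat; try apply Cmod_ge_0; auto; lra.
      + right; field. }
  destruct (Req_dec (Cmod (boundary f X Y W H)) 0) as [E|E]; [now apply Cmod_eq_0|].
  pose proof (Cmod_ge_0 (boundary f X Y W H)).
  set (m := Cmod (boundary f X Y W H)) in *.
  assert (Hq : 0 < (W + H) ^ 2 + 1) by nra.
  specialize (Main (m / (2 * ((W + H) ^ 2 + 1))) ltac:(apply Rdiv_lt_0_compat; lra)).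
  exfalso; assert (m / (2 * ((W + H) ^ 2 + 1)) * (W + H) ^ 2 < m); [|lra].
  apply (Rmult_lt_reg_r (2 * ((W + H) ^ 2 + 1))); [lra|].
  replace (m / (2 * ((W + H) ^ 2 + 1)) * (W + H) ^ 2 * (2 * ((W + H) ^ 2 + 1)))
    with (m * (W + H) ^ 2) by (field; lra).
  pose proof (pow2_ge_0 (W + H)); nra.
Qed.

(** In Goursat's theorem the two horizontal sides cancel by periodicity. In the exponential
    coordinate this is the deformation of one circle into a concentric one. *)
Lemma periodic_integral (G : C -> C) (T x1 x2 : R) :
  0 < T -> x1 <= x2 ->
  (forall x y, x1 <= x <= x2 -> exists l, cder G (x, y) l) ->
  (forall x y, x1 <= x <= x2 -> G (x, y + T) = G (x, y)) ->
  VInt G x1 0 T = VInt G x2 0 T.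
Proof.
  intros HT Hx Hd Hp.
  assert (HG : boundary G x1 0 (x2 - x1) T = 0%C).
  { apply Goursat; try lra; intros a b Ha Hb; apply Hd; lra. }
  unfold boundary in HG.
  replace (x1 + (x2 - x1)) with x2 in HG by ring.
  rewrite Rplus_0_l in HG.
  assert (E : HInt G T x1 x2 = HInt G 0 x1 x2).
  { apply CInt_ext; auto; intros t Ht; rewrite <- (Hp t 0), Rplus_0_l; auto. }
  rewrite E in HG.
  assert (E2 : (Ci * (VInt G x2 0 T - VInt G x1 0 T))%C = 0%C) by (rewrite <- HG; ring).
  symmetry; apply Cminus_diag_eq.
  replace (VInt G x2 0 T - VInt G x1 0 T)%C with (- (Ci * (Ci * (VInt G x2 0 T - VInt G x1 0 T))))%C
    by (destruct (VInt G x2 0 T), (VInt G x1 0 T); unfold Ci, Cminus, Copp, Cplus, Cmult; simpl; f_equal; ring).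
  rewrite E2; ring.
Qed.

(** * Cauchy's formula *)

Lemma Cexp_plus (z w : C) : Cexp (z + w) = (Cexp z * Cexp w)%C.
Proof.
  destruct z as [a b], w as [c d]; unfold Cexp, Cplus, Cmult; simpl.
  rewrite exp_plus, cos_plus, sin_plus; f_equal; ring.
Qed.

Lemma Cmod_Cexp (z : C) : Cmod (Cexp z) = exp (fst z).
Proof.
  unfold Cexp, Cmod; simpl fst; simpl snd.
  replace ((exp (fst z) * cos (snd z)) ^ 2 + (exp (fst z) * sin (snd z)) ^ 2)
    with (exp (fst z) ^ 2 * ((sin (snd z)) ^ 2 + (cos (snd z)) ^ 2)) by ring.
  rewrite <- !Rsqr_pow2, sin2_cos2, Rmult_1_r, sqrt_Rsqr; auto.
  left; apply exp_pos.
Qed.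

Lemma Cexp_neq0 (z : C) : Cexp z <> 0%C.
Proof. apply Cmod_gt_0; rewrite Cmod_Cexp; apply exp_pos. Qed.

Lemma Cexp_0 : Cexp 0 = 1%C.
Proof. unfold Cexp; simpl; rewrite exp_0, cos_0, sin_0; unfold RtoC; f_equal; ring. Qed.

Lemma Cexp_periodic (x y : R) : Cexp (x, y + 2 * PI) = Cexp (x, y).
Proof.
  unfold Cexp; simpl; rewrite <- (cos_period y 1), <- (sin_period y 1); simpl.
  now rewrite Rmult_1_r.
Qed.

Lemma derivable_small (f : R -> R) (l : R) : derivable_pt_lim f 0 l ->
  forall e, 0 < e -> exists d, 0 < d /\ forall h, Rabs h < d -> Rabs (f h - f 0 - l * h) <= e * Rabs h.
Proof.
  intros H e He; destruct (H e He) as [d Hd]; exists d; split; [apply cond_pos|].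
  intros h Hh; destruct (Req_dec h 0) as [->|Hn].
  - replace (f 0 - f 0 - l * 0) with 0 by ring; rewrite Rabs_R0; lra.
  - specialize (Hd h Hn Hh); rewrite Rplus_0_l in Hd.
    replace (f h - f 0 - l * h) with (((f h - f 0) / h - l) * h) by (field; auto).
    rewrite Rabs_mult; apply Rmult_le_compat_r; [apply Rabs_pos | lra].
Qed.

Lemma cder_Cexp_0 : cder Cexp 0 1.
Proof.
  intros e He; rewrite Cexp_0.
  set (e' := Rmin (e / 12) 1).
  assert (He' : 0 < e') by (apply Rmin_pos; lra).
  assert (He1 : e' <= e / 12) by apply Rmin_l.
  assert (He2 : e' <= 1) by apply Rmin_r.
  destruct (derivable_small exp 1) with (e := e') as [d1 [Hd1 H1]]; auto.
  { rewrite <- exp_0; apply derivable_pt_lim_exp. }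
  destruct (derivable_small sin 1) with (e := e') as [d2 [Hd2 H2]]; auto.
  { rewrite <- cos_0; apply derivable_pt_lim_sin. }
  destruct (derivable_small cos 0) with (e := e') as [d3 [Hd3 H3]]; auto.
  { replace 0 with (- sin 0) at 2 by (rewrite sin_0; ring); apply derivable_pt_lim_cos. }
  exists (Rmin e' (Rmin d1 (Rmin d2 d3))); split; [apply Rmin_pos; [exact He'|]; repeat apply Rmin_pos; auto|].
  intros w Hw; replace (w - 0)%C with w in * by ring.
  assert (Hw2 : Cmod w < e' /\ Cmod w < d1 /\ Cmod w < d2 /\ Cmod w < d3).
  { destruct Hw as [_ Hw]; repeat split; eapply Rlt_le_trans; try apply Hw.
    - apply Rmin_l.
    - eapply Rle_trans; [apply Rmin_r|]; apply Rmin_l.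
    - eapply Rle_trans; [apply Rmin_r|]; eapply Rle_trans; [apply Rmin_r|]; apply Rmin_l.
    - eapply Rle_trans; [apply Rmin_r|]; eapply Rle_trans; [apply Rmin_r|]; apply Rmin_r. }
  assert (Hw0 : w <> 0%C) by (apply Cmod_gt_0, Hw).
  replace ((Cexp w - 1) / w - 1)%C with ((Cexp w - 1 - w) / w)%C by (field; auto).
  rewrite Cmod_div by auto; destruct Hw as [Hwp _].
  apply (Rmult_lt_reg_r (Cmod w)); auto; unfold Rdiv; rewrite Rmult_assoc, Rinv_l, Rmult_1_r by lra.
  destruct w as [a b].
  pose proof (Rmax_Cmod (a, b)) as Hm; simpl in Hm.
  assert (Ha : Rabs a <= Cmod (a, b)) by (eapply Rle_trans; [apply Rmax_l | apply Hm]).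
  assert (Hb : Rabs b <= Cmod (a, b)) by (eapply Rle_trans; [apply Rmax_r | apply Hm]).
  specialize (H1 a ltac:(lra)); specialize (H2 b ltac:(lra)); specialize (H3 b ltac:(lra)).
  rewrite exp_0 in H1; rewrite sin_0 in H2; rewrite cos_0 in H3.
  set (m := Cmod (a, b)) in *.
  set (E := exp a - 1 - 1 * a) in *; set (S := sin b - 0 - 1 * b) in *; set (K := cos b - 1 - 0 * b) in *.
  (* [E], [S] and [K] are the first-order remainders of [exp], [sin] and [cos] at 0. Written with
     them, each term of the error is a remainder or a product of two small factors. *)
  replace (Cexp (a, b) - 1 - (a, b))%C with (E + (E + 1 + a) * K, (E + a) * (S + b) + S).
  2:{ unfold Cexp, Cminus, Copp, Cplus, RtoC, E, S, K; simpl; f_equal; ring. }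
  eapply Rle_lt_trans; [apply Cmod_le_sum|].
  pose proof (Rabs_triang E ((E + 1 + a) * K)) as T1.
  pose proof (Rabs_triang ((E + a) * (S + b)) S) as T2.
  rewrite Rabs_mult in T1, T2.
  pose proof (Rabs_triang (E + 1) a) as T3; pose proof (Rabs_triang E 1) as T4; rewrite Rabs_R1 in T4.
  pose proof (Rabs_triang E a) as T5; pose proof (Rabs_triang S b) as T6.
  assert (Rabs E <= e' * m) by (eapply Rle_trans; [apply H1|]; apply Rmult_le_compat_l; lra).
  assert (Rabs S <= e' * m) by (eapply Rle_trans; [apply H2|]; apply Rmult_le_compat_l; lra).
  assert (Rabs K <= e' * m) by (eapply Rle_trans; [apply H3|]; apply Rmult_le_compat_l; lra).
  assert (e' * m <= m) by nra.
  assert (Rabs (E + 1 + a) * Rabs K <= 3 * (e' * m)).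
  { apply Rmult_le_compat; try apply Rabs_pos; lra. }
  assert (Rabs (E + a) * Rabs (S + b) <= (2 * m) * (2 * e')).
  { apply Rmult_le_compat; try apply Rabs_pos; try lra. }
  assert (e' * m <= e / 12 * m) by (apply Rmult_le_compat_r; lra).
  assert (0 < e * m) by nra.
  lra.
Qed.

Lemma cder_Cexp (z : C) : cder Cexp z (Cexp z).
Proof.
  assert (H : cder (fun w => Cexp z * Cexp (w - z))%C z (Cexp z * (1 * 1))%C).
  { apply cder_scal, (cder_comp Cexp (fun w => w - z)%C).
    - eapply cder_eq; [|apply cder_minus; [apply cder_id | apply cder_const]]; ring.
    - replace (z - z)%C with (RtoC 0) by ring; apply cder_Cexp_0. }
  apply (cder_eq _ _ (Cexp z * (1 * 1))%C); [ring|].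
  apply (cder_ext_ball (fun w => Cexp z * Cexp (w - z))%C Cexp z _ 1); [lra| |exact H].
  intros w _; rewrite <- Cexp_plus; f_equal; ring.
Qed.

Lemma exp_le (a b : R) : a <= b -> exp a <= exp b.
Proof. intros [H | ->]; [left; now apply exp_increasing | lra]. Qed.

(* [s |-> a + Cexp s] maps vertical lines to circles around [a], so that integrals over circles
   become integrals over one period of a periodic function. *)
Lemma cder_polar (f : C -> C) (a s l : C) :
  cder f (a + Cexp s)%C l -> cder (fun s => f (a + Cexp s)%C) s (l * Cexp s)%C.
Proof.
  intros H; apply (cder_comp f (fun s => a + Cexp s)%C); auto.
  apply (cder_eq _ _ (0 + Cexp s)%C); [ring|].
  apply cder_plus; [apply cder_const | apply cder_Cexp].
Qed.

Lemma polar_norm (a s : C) : Cmod (a + Cexp s - a) = exp (fst s).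
Proof. replace (a + Cexp s - a)%C with (Cexp s) by ring; apply Cmod_Cexp. Qed.

(** Evaluates an integral that does not change along the chosen lines, by moving to a line where the
    integrand is nearly constant: [x] towards minus infinity for shrinking circles, towards plus
    infinity for growing ones. *)
Lemma VInt_limit (G : C -> C) (T x0 : R) (L : C) :
  0 < T ->
  (forall e, 0 < e -> exists x, VInt G x 0 T = VInt G x0 0 T /\ rcont_on (fun t => G (x, t)) 0 T /\
      forall t, 0 <= t <= T -> Cmod (G (x, t) - L) <= e) ->
  VInt G x0 0 T = (RtoC T * L)%C.
Proof.
  intros HT H; apply Cminus_diag_eq, Cmod_eq_0.
  set (m := Cmod _); destruct (Rle_lt_or_eq_dec 0 m (Cmod_ge_0 _)) as [Hm|]; [exfalso|auto].
  destruct (H (m / (4 * T)) ltac:(apply Rdiv_lt_0_compat; lra)) as [x [E [Hc Hx]]].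
  assert (Hb : Cmod (CInt (fun t => G (x, t) + (- L))%C 0 T) <= 2 * (m / (4 * T)) * (T - 0)).
  { apply CInt_bound; [lra| |exact Hx].
    intros t Ht e He; destruct (Hc t Ht e He) as [d [Hd Hd1]]; exists d; split; auto.
    intros s Hs; replace (G (x, s) + - L - (G (x, t) + - L))%C with (G (x, s) - G (x, t))%C by ring; auto. }
  rewrite CInt_plus, CInt_const in Hb; try lra; auto.
  - change (CInt (fun t => G (x, t)) 0 T) with (VInt G x 0 T) in Hb; rewrite E in Hb.
    replace (VInt G x0 0 T + RtoC (T - 0) * - L)%C with (VInt G x0 0 T - RtoC T * L)%C in Hb
      by (rewrite Rminus_0_r; ring).
    fold m in Hb; replace (2 * (m / (4 * T)) * (T - 0)) with (m / 2) in Hb by (field; lra); lra.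
  - intros t _ e He; exists 1; split; [lra|]; intros; rewrite Cmod_diag; lra.
Qed.

Lemma segment_uniform (G : C -> C) (T x0 : R) :
  0 <= T -> (forall t, 0 <= t <= T -> ccont G (x0, t)) ->
  forall e, 0 < e -> exists d, 0 < d /\ forall x t, Rabs (x - x0) < d -> 0 <= t <= T ->
     Cmod (G (x, t) - G (x0, t)) < e.
Proof.
  intros HT HG e He.
  enough (B : exists d, 0 < d /\ forall x t, Rabs (x - x0) < d -> 0 <= t <= 0 + T ->
     Cmod (G (x, t) - G (x0, t)) < e).
  { destruct B as [d [Hd B]]; exists d; split; auto; intros; apply B; auto; lra. }
  (* The segment is treated as a rectangle of width zero, so only the vertical data enter the
     predicate. *)
  apply (bisection (fun _ y _ h => exists d, 0 < d /\ forall x t, Rabs (x - x0) < d -> y <= t <= y + h ->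
     Cmod (G (x, t) - G (x0, t)) < e) 0 0 0 T) ; try lra.
  - intros x y w h Hw Hh H1 H2 H3 H4 _ [d [Hd P1]] _ [d' [Hd' P2]].
    exists (Rmin d d'); split; [now apply Rmin_pos|].
    pose proof (Rmin_l d d'); pose proof (Rmin_r d d').
    intros x1 t Hx Ht; destruct (Rle_dec t (y + h / 2)); [apply P1 | apply P2]; lra.
  - intros a b _ Hb; rewrite Rplus_0_l in Hb.
    destruct (ccont_nbhd _ _ (HG b Hb) (e / 2) ltac:(lra)) as [d [Hd H]].
    exists (d / 2); split; [lra|].
    intros x y w h Hw Hh H1 H2 H3 H4 H5 H6.
    exists (d / 2); split; [lra|]; intros x1 t Hx Ht.
    assert (Hn : forall x1, Rabs (x1 - x0) < d / 2 -> Cmod ((x1, t) - (x0, b)) < d).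
    { intros x2 Hx2; eapply Rle_lt_trans; [apply Cmod_pair_minus|].
      assert (Rabs (t - b) <= h) by (apply Rabs_le; lra); lra. }
    pose proof (H _ (Hn x1 Hx)).
    pose proof (H _ (Hn x0 ltac:(rewrite Rminus_diag, Rabs_R0; lra))) as H8.
    rewrite Cmod_sym in H8.
    pose proof (Cmod_tri (G (x1, t)) (G (x0, b)) (G (x0, t))); lra.
Qed.

Definition hol (f : C -> C) (a : C) (r : R) : Prop :=
  forall z, Cmod (z - a) < r -> exists l, cder f z l.

Definition hol_punct (f : C -> C) (a : C) (r : R) : Prop :=
  forall z, 0 < Cmod (z - a) < r -> exists l, cder f z l.

Lemma ccont_Cexp (z : C) : ccont Cexp z.
Proof. eapply cder_ccont, cder_Cexp. Qed.

Lemma ccont_polar (f : C -> C) (a s : C) : ccont f (a + Cexp s)%C -> ccont (fun s => f (a + Cexp s)%C) s.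
Proof.
  intros H; apply (ccont_comp f (fun s => a + Cexp s)%C); auto.
  apply ccont_plus; [apply ccont_const | apply ccont_Cexp].
Qed.

Lemma ccont_circle (a z s : C) : ccont (fun s => a + Cexp s - z)%C s.
Proof.
  apply ccont_minus; [|apply ccont_const]; apply ccont_plus; [apply ccont_const | apply ccont_Cexp].
Qed.

Lemma rcont_on_vert_line (F : C -> C) (x a b : R) :
  (forall t, a <= t <= b -> ccont F (x, t)) -> rcont_on (fun t => F (x, t)) a b.
Proof. intros H t Ht; apply (rcont_comp F (fun t => (x, t))); [apply H, Ht | apply rcont_vert]. Qed.

Lemma PI2_pos : 0 < 2 * PI.
Proof. pose proof PI_RGT_0; lra. Qed.

Lemma polar_neq (a z s : C) : exp (fst s) <> Cmod (z - a) -> (a + Cexp s)%C <> z.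
Proof. intros H E; apply H; rewrite <- E; now rewrite polar_norm. Qed.

(** As a function of the logarithmic radius the integral is constant on each side of the critical
    radius [Cmod (z - a)], where the circle meets [z]. It vanishes below that radius because it
    tends to 0 on shrinking circles. It cannot jump there, since the quotient is continuous at
    [z]. *)
Lemma cauchy_quotient (f : C -> C) (a z l : C) (R0 r : R) :
  hol f a R0 -> 0 < r < R0 -> Cmod (z - a) < r -> cder f z l ->
  VInt (fun s => dquot f z l (a + Cexp s) * Cexp s)%C (ln r) 0 (2 * PI) = 0%C.
Proof.
  intros Hf Hr Hz Hl.
  set (G := (fun s => dquot f z l (a + Cexp s) * Cexp s)%C).
  assert (Hd : forall w, Cmod (w - a) < R0 -> w <> z -> exists k, cder (dquot f z l) w k).
  { intros w Hw Hn; destruct (Hf w Hw) as [m Hm]; eapply dquot_cder; eauto. }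
  assert (Hc : forall w, Cmod (w - a) < R0 -> ccont (dquot f z l) w).
  { intros w Hw; destruct (classic (w = z)) as [->|Hn]; [now apply dquot_ccont|].
    destruct (Hd w Hw Hn) as [k Hk]; eapply cder_ccont; eauto. }
  assert (F1 : forall s, exp (fst s) < R0 -> ccont G s).
  { intros s Hs; apply ccont_mult; [|apply ccont_Cexp].
    apply ccont_polar, Hc; now rewrite polar_norm. }
  assert (F2 : forall s, exp (fst s) < R0 -> (a + Cexp s)%C <> z -> exists k, cder G s k).
  { intros s Hs Hn; destruct (Hd (a + Cexp s)%C) as [k Hk]; auto; [now rewrite polar_norm|].
    eexists; apply cder_mult; [eapply cder_polar, Hk | apply cder_Cexp]. }
  assert (Hln : exp (ln r) = r) by (apply exp_ln; lra).
  assert (F4 : forall x1 x2, x1 <= x2 -> exp x2 <= r ->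
     (forall x, x1 <= x <= x2 -> exp x <> Cmod (z - a)) -> VInt G x1 0 (2 * PI) = VInt G x2 0 (2 * PI)).
  { intros x1 x2 H12 H2 Hn; apply periodic_integral; auto using PI2_pos.
    - intros x y Hx; apply F2; simpl; [|now apply polar_neq, Hn].
      pose proof (exp_le x x2 ltac:(lra)); lra.
    - intros x y Hx; unfold G; now rewrite Cexp_periodic. }
  (* The factor [Cexp s] has modulus [exp x], while the quotient stays bounded near [a]. *)
  assert (F5 : forall e, 0 < e -> exists X, forall x t, x <= X -> Cmod (G (x, t)) <= e).
  { intros e He; destruct (ccont_nbhd _ _ (Hc a ltac:(rewrite Cmod_diag; lra)) 1 ltac:(lra)) as [d [Hd1 Hd2]].
    set (m := Cmod (dquot f z l a)); assert (Hm : 0 <= m) by apply Cmod_ge_0.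
    set (q := Rmin (d / 2) (e / (m + 1))).
    assert (Hq : 0 < q) by (apply Rmin_pos; [lra | apply Rdiv_lt_0_compat; lra]).
    assert (q <= d / 2) by apply Rmin_l; assert (q <= e / (m + 1)) by apply Rmin_r.
    exists (ln q); intros x t Hx; apply exp_le in Hx; rewrite exp_ln in Hx by auto.
    specialize (Hd2 (a + Cexp (x, t))%C); rewrite polar_norm in Hd2; simpl in Hd2.
    specialize (Hd2 ltac:(lra)); unfold G; rewrite Cmod_mult, Cmod_Cexp; simpl.
    pose proof (Cmod_tri2 (dquot f z l (a + Cexp (x, t))) (dquot f z l a)); fold m in H1.
    pose proof (exp_pos x).
    apply Rle_trans with ((m + 1) * (e / (m + 1))); [|right; field; lra].
    apply Rmult_le_compat; try lra; apply Cmod_ge_0. }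
  assert (F6 : forall x0, exp x0 <= r -> (forall x, x <= x0 -> exp x <> Cmod (z - a)) ->
     VInt G x0 0 (2 * PI) = 0%C).
  { intros x0 Hx0 Hn; replace (RtoC 0) with (RtoC (2 * PI) * 0)%C by ring.
    apply VInt_limit; [apply PI2_pos|]; intros e He; destruct (F5 e He) as [X HX].
    exists (Rmin X x0); pose proof (Rmin_l X x0); pose proof (Rmin_r X x0).
    split; [apply F4; auto; intros x Hx; apply Hn; lra|]; split.
    - apply rcont_on_vert_line; intros t _; apply F1; simpl; pose proof (exp_le _ _ H0); lra.
    - intros t _; replace (G (Rmin X x0, t) - 0)%C with (G (Rmin X x0, t)) by ring; now apply HX. }
  pose proof (Cmod_ge_0 (z - a)).
  destruct (Req_dec (Cmod (z - a)) 0) as [E|E].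
  { apply F6; [lra|]; intros x _; rewrite E; pose proof (exp_pos x); lra. }
  set (xz := ln (Cmod (z - a))).
  assert (Hxz : exp xz = Cmod (z - a)) by (apply exp_ln; lra).
  assert (Hxr : xz < ln r) by (apply ln_increasing; lra).
  assert (Hinc : forall x, x <> xz -> exp x <> Cmod (z - a)).
  { intros x Hx H1; rewrite <- Hxz in H1; apply exp_inv in H1; auto. }
  apply Cmod_eq_0; destruct (Rle_lt_or_eq_dec 0 _ (Cmod_ge_0 (VInt G (ln r) 0 (2 * PI)))) as [Hp|]; [exfalso|auto].
  set (m := Cmod (VInt G (ln r) 0 (2 * PI))) in *.
  pose proof PI2_pos.
  (* With this [e] the integrals on lines just left and just right of the critical one differ by at
     most [m / 2], although one is 0 and the other has modulus [m]. *)
  set (e := m / (8 * (2 * PI))).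
  assert (He : 0 < e) by (apply Rdiv_lt_0_compat; lra).
  destruct (segment_uniform G (2 * PI) xz) with (e := e) as [d [Hd0 Hu]]; try lra.
  { intros t _; apply F1; simpl; lra. }
  set (x1 := xz - d / 2); set (x2 := Rmin (ln r) (xz + d / 2)).
  assert (xz < x2 <= ln r) by (unfold x2; split; [apply Rmin_glb_lt; lra | apply Rmin_l]).
  assert (x2 <= xz + d / 2) by apply Rmin_r.
  assert (Hx2 : exp x2 <= r) by (rewrite <- Hln; apply exp_le; lra).
  assert (Hx1 : exp x1 <= r) by (rewrite <- Hln; apply exp_le; unfold x1; lra).
  assert (E1 : VInt G x1 0 (2 * PI) = 0%C).
  { apply F6; auto; intros x Hx; apply Hinc; unfold x1 in Hx; lra. }
  assert (E2 : VInt G x2 0 (2 * PI) = VInt G (ln r) 0 (2 * PI)).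
  { apply F4; try lra; intros x Hx; apply Hinc; lra. }
  assert (Hcl : Cmod (VInt G x2 0 (2 * PI) - VInt G x1 0 (2 * PI)) <= 2 * (2 * e) * (2 * PI - 0)).
  { apply CInt_close; try lra.
    - apply rcont_on_vert_line; intros t _; apply F1; simpl; lra.
    - apply rcont_on_vert_line; intros t _; apply F1; simpl; lra.
    - intros t Ht.
      pose proof (Hu x2 t ltac:(rewrite Rabs_pos_eq; lra) Ht).
      pose proof (Hu x1 t ltac:(unfold x1; rewrite Rabs_left; lra) Ht) as H4.
      rewrite Cmod_sym in H4.
      pose proof (Cmod_tri (G (x2, t)) (G (xz, t)) (G (x1, t))); lra. }
  rewrite E1, E2 in Hcl.
  replace (VInt G (ln r) 0 (2 * PI) - 0)%C with (VInt G (ln r) 0 (2 * PI)) in Hcl by ring.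
  fold m in Hcl; replace (2 * (2 * e) * (2 * PI - 0)) with (m / 2) in Hcl by (unfold e; field; apply PI_neq0); lra.
Qed.

Lemma circle_dist (a z : C) (r t : R) : 0 < r -> r - Cmod (z - a) <= Cmod (a + Cexp (ln r, t) - z).
Proof.
  intros Hr; pose proof (Cmod_tri (a + Cexp (ln r, t)) z a) as H.
  rewrite polar_norm in H; simpl in H; rewrite exp_ln in H; lra.
Qed.

Lemma circle_neq (a z : C) (r t : R) : 0 < r -> Cmod (z - a) < r -> (a + Cexp (ln r, t) - z)%C <> 0%C.
Proof. intros Hr Hz; apply Cmod_gt_0; pose proof (circle_dist a z r t Hr); lra. Qed.

(** Outside the circle of radius [r] the integrand has no singularity, and it tends to 1 as the
    circle grows. *)
Lemma winding (a z : C) (r : R) : 0 < r -> Cmod (z - a) < r ->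
  VInt (fun s => Cexp s / (a + Cexp s - z))%C (ln r) 0 (2 * PI) = RtoC (2 * PI).
Proof.
  intros Hr Hz; set (G := (fun s => Cexp s / (a + Cexp s - z))%C).
  pose proof PI2_pos as HPI; pose proof (Cmod_ge_0 (z - a)) as Hz0.
  assert (Hn : forall s, r <= exp (fst s) -> exp (fst s) - Cmod (z - a) <= Cmod (a + Cexp s - z)).
  { intros s Hs; pose proof (Cmod_tri (a + Cexp s) z a) as H; rewrite polar_norm in H; lra. }
  assert (Hn0 : forall s, r <= exp (fst s) -> (a + Cexp s - z)%C <> 0%C).
  { intros s Hs; apply Cmod_gt_0; specialize (Hn s Hs); lra. }
  assert (HG : forall s, r <= exp (fst s) -> exists l, cder G s l).
  { intros s Hs; eexists; apply cder_div; [now apply Hn0 | apply cder_Cexp |].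
    eapply (cder_minus (fun s => a + Cexp s)%C); [|apply cder_const].
    apply cder_plus; [apply cder_const | apply cder_Cexp]. }
  assert (Hx : forall x, ln r <= x -> r <= exp x).
  { intros x H; apply exp_le in H; rewrite exp_ln in H; auto. }
  replace (RtoC (2 * PI)) with (RtoC (2 * PI) * 1)%C by ring.
  apply VInt_limit; auto; intros e He.
  set (X := Rmax (ln r) (ln (Cmod (z - a) / e + r))).
  assert (Hq : 0 <= Cmod (z - a) / e) by (apply Rdiv_le_0_compat; lra).
  assert (H1 : ln r <= X) by apply Rmax_l.
  assert (H2 : Cmod (z - a) / e + r <= exp X).
  { rewrite <- (exp_ln (Cmod (z - a) / e + r)) by lra; apply exp_le, Rmax_r. }
  exists X; repeat split.
  - symmetry; apply periodic_integral; auto.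
    + intros x y Hxy; apply HG; simpl; apply Hx; lra.
    + intros x y _; unfold G; now rewrite Cexp_periodic.
  - apply rcont_on_vert_line; intros t _; destruct (HG (X, t)) as [l Hl]; [apply Hx; auto | eapply cder_ccont; eauto].
  - intros t _; pose proof (Hn (X, t) (Hx X H1)) as H3; pose proof (Hn0 (X, t) (Hx X H1)) as H4; simpl in H3.
    unfold G; replace (Cexp (X, t) / (a + Cexp (X, t) - z) - 1)%C with ((z - a) / (a + Cexp (X, t) - z))%C
      by (field; auto).
    rewrite Cmod_div by auto; set (D := Cmod (a + Cexp (X, t) - z)) in *.
    assert (Cmod (z - a) / e < D) by lra.
    apply (Rmult_le_reg_r D); [lra|]; unfold Rdiv; rewrite Rmult_assoc, Rinv_l by lra.
    apply (Rmult_lt_compat_r e) in H; auto; unfold Rdiv in H; rewrite Rmult_assoc, Rinv_l in H; lra.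
Qed.

(** Splitting [f w] as [f z] plus [w - z] times the difference quotient leaves [f z] times the
    integral of [winding]; the other part vanishes by [cauchy_quotient]. The factor [Cexp s] is
    [dw / ds] for [w = a + Cexp s]. *)
Lemma cauchy_formula (f : C -> C) (a z : C) (R0 r : R) :
  hol f a R0 -> 0 < r < R0 -> Cmod (z - a) < r ->
  VInt (fun s => f (a + Cexp s) * Cexp s / (a + Cexp s - z))%C (ln r) 0 (2 * PI) = (RtoC (2 * PI) * f z)%C.
Proof.
  intros Hf Hr Hz; destruct (Hf z ltac:(lra)) as [l Hl].
  pose proof (cauchy_quotient f a z l R0 r Hf Hr Hz Hl) as H0.
  pose proof (winding a z r ltac:(lra) Hz) as HW.
  pose proof PI2_pos as HPI.
  assert (Hg : rcont_on (fun t => Cexp (ln r, t) / (a + Cexp (ln r, t) - z))%C 0 (2 * PI)).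
  { apply (rcont_on_vert_line (fun s => Cexp s / (a + Cexp s - z))%C); intros t _.
    apply ccont_div; [apply circle_neq; lra | apply ccont_Cexp |].
    apply ccont_circle. }
  assert (Hfg : rcont_on (fun t => f (a + Cexp (ln r, t)) * Cexp (ln r, t) / (a + Cexp (ln r, t) - z))%C 0 (2 * PI)).
  { apply (rcont_on_vert_line (fun s => f (a + Cexp s) * Cexp s / (a + Cexp s - z))%C); intros t _.
    apply ccont_div; [apply circle_neq; lra | |].
    - apply ccont_mult; [|apply ccont_Cexp]; apply ccont_polar.
      destruct (Hf (a + Cexp (ln r, t))%C) as [m Hm]; [|eapply cder_ccont; eauto].
      rewrite polar_norm; simpl; rewrite exp_ln; lra.
    - apply ccont_circle. }
  rewrite <- HW, Cmult_comm; unfold VInt; rewrite <- CInt_scal by (auto; lra).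
  apply Cminus_diag_eq; rewrite <- CInt_minus by (auto using rcont_on_scal; lra).
  rewrite <- H0; apply CInt_ext; [lra|]; intros t _.
  pose proof (circle_neq a z r t ltac:(lra) Hz) as Hn.
  rewrite dquot_off by (intros E; apply Hn; rewrite E; ring); field; auto.
Qed.

(** Successive [z]-derivatives of one Cauchy integral. The factor [dw / ds] and the normalisation by
    [2 * PI] are left to the density [Phi], which only has to be continuous on the circle. *)
Definition Cauchy1 (Phi : C -> C) (a : C) (r : R) (z : C) : C :=
  VInt (fun s => Phi (a + Cexp s) * / (a + Cexp s - z))%C (ln r) 0 (2 * PI).
Definition Cauchy2 (Phi : C -> C) (a : C) (r : R) (z : C) : C :=
  VInt (fun s => Phi (a + Cexp s) * (/ (a + Cexp s - z) * / (a + Cexp s - z)))%C (ln r) 0 (2 * PI).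
Definition Cauchy3 (Phi : C -> C) (a : C) (r : R) (z : C) : C :=
  VInt (fun s => Phi (a + Cexp s) * (2 * / (a + Cexp s - z) * / (a + Cexp s - z) * / (a + Cexp s - z)))%C (ln r) 0 (2 * PI).

Lemma circle_bounded (Phi : C -> C) (a : C) (r : R) :
  (forall t, ccont Phi (a + Cexp (ln r, t))%C) ->
  exists M, 0 <= M /\ forall t, 0 <= t <= 2 * PI -> Cmod (Phi (a + Cexp (ln r, t))%C) <= M.
Proof.
  intros H; pose proof PI2_pos.
  destruct (rect_bounded (fun s => Cmod (Phi (a + Cexp s)%C)) (ln r) 0 0 (2 * PI)) as [M HM]; try lra.
  - intros x y Hx _; rewrite Rplus_0_r in Hx; replace x with (ln r) by lra.
    destruct (ccont_nbhd _ _ (ccont_polar _ _ _ (H y)) 1 ltac:(lra)) as [d [Hd Hd1]].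
    exists d, (Cmod (Phi (a + Cexp (ln r, y))%C) + 1); split; auto; intros w Hw.
    specialize (Hd1 w Hw); pose proof (Cmod_tri2 (Phi (a + Cexp w)%C) (Phi (a + Cexp (ln r, y))%C)); lra.
  - assert (HM' : forall t, 0 <= t <= 2 * PI -> Cmod (Phi (a + Cexp (ln r, t))%C) <= M) by (intros; apply HM; lra).
    exists M; split; auto; pose proof (HM' 0 ltac:(lra)); pose proof (Cmod_ge_0 (Phi (a + Cexp (ln r, 0))%C)); lra.
Qed.

Lemma Cmod_inv_le (x : C) (r : R) : 0 < r -> r <= Cmod x -> Cmod (/ x) <= / r.
Proof.
  intros Hr Hx; rewrite Cmod_inv by (apply Cmod_gt_0; lra).
  apply Rinv_le_contravar; auto.
Qed.

Lemma Cmod_mult_le (x y : C) (p q : R) : Cmod x <= p -> Cmod y <= q -> Cmod (x * y) <= p * q.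
Proof. intros; rewrite Cmod_mult; apply Rmult_le_compat; auto using Cmod_ge_0. Qed.

Lemma Cauchy_cder (Phi : C -> C) (a : C) (r : R) (z : C) :
  0 < r -> (forall t, ccont Phi (a + Cexp (ln r, t))%C) -> Cmod (z - a) < r ->
  cder (Cauchy1 Phi a r) z (Cauchy2 Phi a r z) /\ cder (Cauchy2 Phi a r) z (Cauchy3 Phi a r z).
Proof.
  intros Hr Hc Hz; pose proof PI2_pos.
  destruct (circle_bounded Phi a r Hc) as [M [HM0 HM]].
  (* Half the distance from [z] to the circle: for [w] within [p] of [z] all kernels stay bounded by
     powers of [/ p]. *)
  set (p := (r - Cmod (z - a)) / 2).
  assert (Hp : 0 < p) by (unfold p; lra).
  assert (Hip : 0 < / p) by now apply Rinv_0_lt_compat.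
  assert (Hd : forall w t, Cmod (w - z) < p -> p <= Cmod (a + Cexp (ln r, t) - w)).
  { intros w t Hw; pose proof (circle_dist a w r t Hr); pose proof (Cmod_tri w z a); unfold p in *; lra. }
  assert (Hdz : forall t, p <= Cmod (a + Cexp (ln r, t) - z)).
  { intros t; apply Hd; rewrite Cmod_diag; lra. }
  assert (Hn : forall w t, Cmod (w - z) < p -> (a + Cexp (ln r, t) - w)%C <> 0%C).
  { intros w t Hw; apply Cmod_gt_0; specialize (Hd w t Hw); lra. }
  assert (Hnz : forall t, (a + Cexp (ln r, t) - z)%C <> 0%C).
  { intros t; apply Hn; rewrite Cmod_diag; lra. }
  assert (CP : forall t, ccont (fun s => Phi (a + Cexp s)%C) (ln r, t)) by (intros; apply ccont_polar, Hc).
  assert (CI : forall w t, Cmod (w - z) < p -> ccont (fun s => / (a + Cexp s - w))%C (ln r, t)).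
  { intros w t Hw; apply ccont_inv; [now apply Hn|].
    apply ccont_circle. }
  assert (CIz : forall t, ccont (fun s => / (a + Cexp s - z))%C (ln r, t)).
  { intros t; apply CI; rewrite Cmod_diag; lra. }
  assert (Bz : forall t, Cmod (/ (a + Cexp (ln r, t) - z)) <= / p) by (intros; apply Cmod_inv_le; auto).
  assert (Bw : forall w t, Cmod (w - z) < p -> Cmod (/ (a + Cexp (ln r, t) - w)) <= / p) by (intros; apply Cmod_inv_le; auto).
  split.
  - unfold Cauchy1, VInt.
    (* The expansion is the exact identity 1/(y-w) = 1/(y-z) + (w-z)/(y-z)^2 + (w-z)^2/((y-z)^2
       (y-w)) for [y] on the circle. *)
    apply (param_cder 0 (2 * PI) (fun t w => Phi (a + Cexp (ln r, t)) * / (a + Cexp (ln r, t) - w))%C _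
      (fun t w => Phi (a + Cexp (ln r, t)) * (/ (a + Cexp (ln r, t) - z) * / (a + Cexp (ln r, t) - z) * / (a + Cexp (ln r, t) - w)))%C
      z p (M * (/ p * / p * / p))); try lra.
    + apply (rcont_on_vert_line (fun s => Phi (a + Cexp s) * (/ (a + Cexp s - z) * / (a + Cexp s - z)))%C).
      intros t _; repeat apply ccont_mult; auto.
    + intros w Hw; repeat split.
      * apply (rcont_on_vert_line (fun s => Phi (a + Cexp s) * / (a + Cexp s - w))%C).
        intros t _; repeat apply ccont_mult; auto.
      * apply (rcont_on_vert_line (fun s => Phi (a + Cexp s) * (/ (a + Cexp s - z) * / (a + Cexp s - z) * / (a + Cexp s - w)))%C).
        intros t _; repeat apply ccont_mult; auto.
      * repeat apply Cmod_mult_le; auto.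
      * specialize (Hn w t Hw); specialize (Hnz t); field; auto.
  - unfold Cauchy2, Cauchy3, VInt.
    apply (param_cder 0 (2 * PI) (fun t w => Phi (a + Cexp (ln r, t)) * (/ (a + Cexp (ln r, t) - w) * / (a + Cexp (ln r, t) - w)))%C _
      (fun t w => Phi (a + Cexp (ln r, t)) * (/ (a + Cexp (ln r, t) - z) * / (a + Cexp (ln r, t) - z) * / (a + Cexp (ln r, t) - w)
        * (/ (a + Cexp (ln r, t) - w) + 2 * / (a + Cexp (ln r, t) - z))))%C
      z p (M * (/ p * / p * / p * (/ p + 2 * / p)))); try lra.
    + apply (rcont_on_vert_line (fun s => Phi (a + Cexp s) * (2 * / (a + Cexp s - z) * / (a + Cexp s - z) * / (a + Cexp s - z)))%C).
      intros t _; repeat apply ccont_mult; auto using ccont_const.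
    + intros w Hw; repeat split.
      * apply (rcont_on_vert_line (fun s => Phi (a + Cexp s) * (/ (a + Cexp s - w) * / (a + Cexp s - w)))%C).
        intros t _; repeat apply ccont_mult; auto.
      * apply (rcont_on_vert_line (fun s => Phi (a + Cexp s) * (/ (a + Cexp s - z) * / (a + Cexp s - z) * / (a + Cexp s - w)
          * (/ (a + Cexp s - w) + 2 * / (a + Cexp s - z))))%C).
        intros t _; repeat apply ccont_mult; auto; apply ccont_plus; auto; apply ccont_mult; auto using ccont_const.
      * repeat apply Cmod_mult_le; auto.
        eapply Rle_trans; [apply Cmod_triangle|]; apply Rplus_le_compat; auto.
        apply Cmod_mult_le; auto; rewrite Cmod_R, Rabs_pos_eq; lra.
      * specialize (Hn w t Hw); specialize (Hnz t); field; auto.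
Qed.

Lemma hol_ccont (f : C -> C) (a : C) (r : R) (z : C) : hol f a r -> Cmod (z - a) < r -> ccont f z.
Proof. intros H Hz; destruct (H z Hz) as [l Hl]; eapply cder_ccont; eauto. Qed.

Lemma hol_cder (f : C -> C) (a : C) (r : R) (z : C) : hol f a r -> Cmod (z - a) < r -> cder f z (C_derive f z).
Proof. intros H Hz; destruct (H z Hz) as [l Hl]; now rewrite (C_derive_cder _ _ _ Hl). Qed.

Lemma hol_sub (f : C -> C) (a b : C) (r s : R) : hol f a r -> Cmod (b - a) + s <= r -> hol f b s.
Proof. intros H Hs z Hz; apply H; pose proof (Cmod_tri z b a); lra. Qed.

Lemma circle_ccont (f : C -> C) (a : C) (R0 r t : R) :
  hol f a R0 -> 0 < r < R0 -> ccont f (a + Cexp (ln r, t))%C.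
Proof. intros Hf Hr; apply (hol_ccont f a R0); auto; rewrite polar_norm; simpl; rewrite exp_ln; lra. Qed.

Lemma cauchy_kernel (f : C -> C) (a : C) (R0 r : R) :
  hol f a R0 -> 0 < r < R0 -> forall z, Cmod (z - a) < r ->
  f z = Cauchy1 (fun w => f w * (w - a) / RtoC (2 * PI))%C a r z.
Proof.
  intros Hf Hr z Hz; pose proof PI2_pos.
  assert (HPI : RtoC (2 * PI) <> 0%C) by (intros E; apply RtoC_inj in E; lra).
  assert (E : f z = (/ RtoC (2 * PI) * (RtoC (2 * PI) * f z))%C) by (field; auto).
  rewrite E at 1; rewrite <- (cauchy_formula f a z R0 r) by auto.
  unfold Cauchy1, VInt; rewrite <- CInt_scal; try lra.
  - apply CInt_ext; [lra|]; intros t _; pose proof (circle_neq a z r t ltac:(lra) Hz).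
    replace (a + Cexp (ln r, t) - a)%C with (Cexp (ln r, t)) by ring; field; auto.
  - apply (rcont_on_vert_line (fun s => f (a + Cexp s) * Cexp s / (a + Cexp s - z))%C); intros t _.
    apply ccont_div; [apply circle_neq; lra | |].
    + apply ccont_mult; [|apply ccont_Cexp]; apply ccont_polar; eapply circle_ccont; eauto.
    + apply ccont_circle.
Qed.

Lemma cauchy_density_ccont (f : C -> C) (a : C) (R0 r t : R) :
  hol f a R0 -> 0 < r < R0 -> ccont (fun w => f w * (w - a) / RtoC (2 * PI))%C (a + Cexp (ln r, t))%C.
Proof.
  intros Hf Hr; pose proof PI2_pos; apply ccont_div; [intros E; apply RtoC_inj in E; lra | | apply ccont_const].
  apply ccont_mult; [eapply circle_ccont; eauto|]; apply ccont_minus; [apply ccont_id | apply ccont_const].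
Qed.

Lemma cauchy_kernel_derive (f : C -> C) (a : C) (R0 r : R) :
  hol f a R0 -> 0 < r < R0 -> forall z, Cmod (z - a) < r ->
  C_derive f z = Cauchy2 (fun w => f w * (w - a) / RtoC (2 * PI))%C a r z.
Proof.
  intros Hf Hr z Hz; apply C_derive_cder.
  apply (cder_ext_ball (Cauchy1 (fun w => f w * (w - a) / RtoC (2 * PI))%C a r) _ _ _ (r - Cmod (z - a))); [lra| |].
  - intros w Hw; symmetry; apply (cauchy_kernel f a R0 r); auto; pose proof (Cmod_tri w z a); lra.
  - apply (proj1 (Cauchy_cder _ a r z ltac:(lra) ltac:(intros t; eapply cauchy_density_ccont; eauto) Hz)).
Qed.

(** Around each point the derivative is a [Cauchy2] integral on a small circle, and those are
    differentiable. *)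
Lemma hol_derive (f : C -> C) (a : C) (r : R) : hol f a r -> hol (C_derive f) a r.
Proof.
  intros Hf z Hz; set (p := (r - Cmod (z - a)) / 2).
  assert (Hp : 0 < p) by (unfold p; lra).
  assert (Hf' : hol f z (2 * p)) by (apply (hol_sub f a z r); auto; unfold p; lra).
  eexists; apply (cder_ext_ball (Cauchy2 (fun w => f w * (w - z) / RtoC (2 * PI))%C z p) _ _ _ p); auto.
  - intros w Hw; symmetry; apply (cauchy_kernel_derive f z (2 * p) p); auto; lra.
  - refine (proj2 (Cauchy_cder _ z p z Hp _ _)); [|rewrite Cmod_diag; lra]; intros t.
    apply (cauchy_density_ccont f z (2 * p)); auto; lra.
Qed.

(** A weak maximum principle: the distance to the circle is at least [r / 2], which with the factor
    2 of [CInt_bound] gives 4. The constant is harmless because it is applied against geometric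
    decay or large radii. *)
Lemma cauchy_disc_bound (f : C -> C) (a z : C) (R0 r M : R) :
  hol f a R0 -> 0 < r < R0 -> (forall w, Cmod (w - a) = r -> Cmod (f w) <= M) ->
  Cmod (z - a) <= r / 2 -> Cmod (f z) <= 4 * M.
Proof.
  intros Hf Hr HM Hz; pose proof PI2_pos as HPI.
  assert (H0 : Cmod (RtoC (2 * PI) * f z) <= 2 * (2 * M) * (2 * PI - 0)).
  { rewrite <- (cauchy_formula f a z R0 r) by (auto; lra).
    apply CInt_bound; [lra| |].
    - apply (rcont_on_vert_line (fun s => f (a + Cexp s) * Cexp s / (a + Cexp s - z))%C); intros t _.
      apply ccont_div; [apply circle_neq; lra | |].
      + apply ccont_mult; [|apply ccont_Cexp]; apply ccont_polar; eapply circle_ccont; eauto.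
      + apply ccont_circle.
    - intros t _; pose proof (circle_dist a z r t ltac:(lra)).
      replace (2 * M) with (M * r * / (r / 2)) by (field; lra).
      repeat apply Cmod_mult_le.
      + apply HM; rewrite polar_norm; simpl; apply exp_ln; lra.
      + rewrite Cmod_Cexp; simpl; rewrite exp_ln; lra.
      + apply Cmod_inv_le; lra. }
  rewrite Cmod_mult, Cmod_R, Rabs_pos_eq in H0 by lra; nra.
Qed.

Lemma cauchy_estimate (f : C -> C) (a : C) (R0 r M : R) :
  hol f a R0 -> 0 < r < R0 -> (forall w, Cmod (w - a) = r -> Cmod (f w) <= M) ->
  Cmod (C_derive f a) <= 2 * M / r.
Proof.
  intros Hf Hr HM; pose proof PI2_pos as HPI.
  assert (Hd : Cmod (a - a) < r) by (rewrite Cmod_diag; lra).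
  rewrite (cauchy_kernel_derive f a R0 r) by auto.
  replace (2 * M / r) with (2 * (M * r * / (2 * PI) * (/ r * / r)) * (2 * PI - 0)) by (field; lra).
  assert (Hg : forall t, Cmod (a + Cexp (ln r, t) - a) = r).
  { intros t; rewrite polar_norm; simpl; apply exp_ln; lra. }
  apply CInt_bound; [lra| |].
  - apply (rcont_on_vert_line (fun s => f (a + Cexp s) * (a + Cexp s - a) / RtoC (2 * PI)
      * (/ (a + Cexp s - a) * / (a + Cexp s - a)))%C); intros t _.
    assert (CI : ccont (fun s => / (a + Cexp s - a))%C (ln r, t)).
    { apply ccont_inv; [apply circle_neq; lra|].
      apply ccont_circle. }
    repeat apply ccont_mult; auto.
    + apply ccont_polar; eapply circle_ccont; eauto.
    + apply ccont_circle.
    + apply ccont_const.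
  - intros t _; repeat apply Cmod_mult_le.
    + apply HM, Hg.
    + rewrite Hg; lra.
    + apply Cmod_inv_le; [lra|]; rewrite Cmod_R, Rabs_pos_eq; lra.
    + apply Cmod_inv_le; [lra|]; rewrite Hg; lra.
    + apply Cmod_inv_le; [lra|]; rewrite Hg; lra.
Qed.

(** * Isolated singularities *)

Lemma hol_const (c a : C) (r : R) : hol (fun _ => c) a r.
Proof. intros z _; eexists; apply cder_const. Qed.

Lemma hol_id (a : C) (r : R) : hol (fun z => z) a r.
Proof. intros z _; eexists; apply cder_id. Qed.

Lemma hol_plus (f g : C -> C) (a : C) (r : R) : hol f a r -> hol g a r -> hol (fun z => f z + g z)%C a r.
Proof. intros Hf Hg z Hz; destruct (Hf z Hz), (Hg z Hz); eexists; apply cder_plus; eauto. Qed.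

Lemma hol_minus (f g : C -> C) (a : C) (r : R) : hol f a r -> hol g a r -> hol (fun z => f z - g z)%C a r.
Proof. intros Hf Hg z Hz; destruct (Hf z Hz), (Hg z Hz); eexists; apply cder_minus; eauto. Qed.

Lemma hol_mult (f g : C -> C) (a : C) (r : R) : hol f a r -> hol g a r -> hol (fun z => f z * g z)%C a r.
Proof. intros Hf Hg z Hz; destruct (Hf z Hz), (Hg z Hz); eexists; apply cder_mult; eauto. Qed.

Lemma hol_pow (c a : C) (n : nat) (r : R) : hol (fun z => (z - c) ^ n)%C a r.
Proof. intros z _; eexists; apply cder_pow. Qed.

Lemma hol_inv (f : C -> C) (a : C) (r : R) :
  (forall z, Cmod (z - a) < r -> f z <> 0%C) -> hol f a r -> hol (fun z => / f z)%C a r.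
Proof. intros H Hf z Hz; destruct (Hf z Hz); eexists; apply cder_inv; eauto. Qed.

Lemma hol_mono (f : C -> C) (a : C) (r s : R) : s <= r -> hol f a r -> hol f a s.
Proof. intros H Hf z Hz; apply Hf; lra. Qed.

(** Away from [a] this is the quotient rule. Near [a], the identity (1/(y-w) - 1/(y-a)) / (w-a) =
    1/((y-w)(y-a)) cancels the factor [y - a] of Cauchy's formula, so the quotient is a Cauchy
    integral with density [f / (2 * PI)]. *)
Lemma hol_dquot (f : C -> C) (a : C) (R0 : R) :
  0 < R0 -> hol f a R0 -> hol (dquot f a (C_derive f a)) a R0.
Proof.
  intros HR Hf z Hz; destruct (classic (z = a)) as [->|Hn].
  2:{ destruct (Hf z Hz) as [m Hm]; eapply dquot_cder; eauto. }
  set (r := R0 / 2); assert (Hr : 0 < r < R0) by (unfold r; lra).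
  pose proof PI2_pos as HPI.
  assert (HPI0 : RtoC (2 * PI) <> 0%C) by (intros E; apply RtoC_inj in E; lra).
  set (Phi := fun w => (f w / RtoC (2 * PI))%C).
  assert (Hc : forall t, ccont Phi (a + Cexp (ln r, t))%C).
  { intros t; apply ccont_div; auto using ccont_const; eapply circle_ccont; eauto. }
  assert (Haa : Cmod (a - a) < r) by (rewrite Cmod_diag; lra).
  assert (Hc2 := fun t => cauchy_density_ccont f a R0 r t Hf Hr).
  set (Phi2 := fun w => (f w * (w - a) / RtoC (2 * PI))%C) in *.
  assert (HI : forall w t, Cmod (w - a) < r -> ccont (fun s => / (a + Cexp s - w))%C (ln r, t)).
  { intros w t Hw; apply ccont_inv; [apply circle_neq; lra|].
    apply ccont_circle. }
  exists (Cauchy2 Phi a r a).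
  apply (cder_ext_ball (Cauchy1 Phi a r) _ _ _ r); [lra| |apply (proj1 (Cauchy_cder _ a r a ltac:(lra) Hc Haa))].
  intros w Hw; destruct (classic (w = a)) as [->|Hn].
  - rewrite dquot_diag, (cauchy_kernel_derive f a R0 r) by auto.
    apply CInt_ext; [lra|]; intros t _.
    pose proof (circle_neq a a r t ltac:(lra) Haa); unfold Phi; field; auto.
  - rewrite dquot_off, (cauchy_kernel f a R0 r Hf Hr w), (cauchy_kernel f a R0 r Hf Hr a) by auto.
    fold Phi2; unfold Cauchy1, VInt.
    rewrite <- CInt_minus; [|lra| |];
    try (apply (rcont_on_vert_line (fun s => Phi2 (a + Cexp s) * / (a + Cexp s - a))%C); intros t _;
      apply ccont_mult; [apply ccont_polar; auto | auto]);
    try (apply (rcont_on_vert_line (fun s => Phi2 (a + Cexp s) * / (a + Cexp s - w))%C); intros t _;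
      apply ccont_mult; [apply ccont_polar; auto | auto]).
    unfold Cdiv; rewrite Cmult_comm, <- CInt_scal; [|lra|].
    + apply CInt_ext; [lra|]; intros t _.
      pose proof (circle_neq a a r t ltac:(lra) Haa); pose proof (circle_neq a w r t ltac:(lra) Hw).
      pose proof (Cminus_neq _ _ Hn); unfold Phi, Phi2; field; auto.
    + apply (rcont_on_vert_line (fun s => Phi2 (a + Cexp s) * / (a + Cexp s - w) - Phi2 (a + Cexp s) * / (a + Cexp s - a))%C).
      intros t _; apply ccont_minus; apply ccont_mult; auto; apply ccont_polar; auto.
Qed.

(** The function [(z - a) ^ 2 * f z] vanishes at [a] together with its derivative, whatever the
    value [f a]; dividing twice by [z - a] gives the extension. *)
Lemma riemann_removable (f : C -> C) (a : C) (r M : R) :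
  0 < r -> hol_punct f a r -> (forall z, 0 < Cmod (z - a) < r -> Cmod (f z) <= M) ->
  exists g, hol g a r /\ forall z, 0 < Cmod (z - a) < r -> g z = f z.
Proof.
  intros Hr Hf HM.
  set (h := fun z => ((z - a) * (z - a) * f z)%C).
  assert (Hh0 : cder h a 0%C).
  { apply (tends_ext (fun z => (z - a) * f z)%C).
    - generalize (near_neq a); apply near_imp; intros w Hw; unfold h; field; now apply Cminus_neq.
    - intros e He; pose proof (Rabs_pos M).
      exists (Rmin r (e / (Rabs M + 1))); split; [apply Rmin_pos; auto; apply Rdiv_lt_0_compat; lra|].
      intros w [H1 H2]; pose proof (Rmin_l r (e / (Rabs M + 1))); pose proof (Rmin_r r (e / (Rabs M + 1))).
      replace ((w - a) * f w - 0)%C with ((w - a) * f w)%C by ring.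
      rewrite Cmod_mult; pose proof (HM w ltac:(lra)); pose proof (Rle_abs M).
      apply Rle_lt_trans with (Cmod (w - a) * Rabs M).
      { apply Rmult_le_compat_l; lra. }
      apply Rlt_le_trans with (e / (Rabs M + 1) * (Rabs M + 1)); [|right; field; lra].
      apply Rle_lt_trans with (e / (Rabs M + 1) * Rabs M); [apply Rmult_le_compat_r; lra|].
      assert (0 < e / (Rabs M + 1)) by (apply Rdiv_lt_0_compat; lra); lra. }
  assert (Hh : hol h a r).
  { intros z Hz; destruct (classic (z = a)) as [->|Hn]; [eauto|].
    destruct (Hf z) as [l Hl]; [split; auto; now apply Cmod_minus_gt0|].
    eexists; apply cder_mult; [|exact Hl]; apply cder_mult; apply cder_sub_const. }
  pose proof (hol_dquot h a r Hr Hh) as H1; rewrite (C_derive_cder _ _ _ Hh0) in H1.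
  set (g1 := dquot h a 0%C) in *.
  assert (Hg1 : forall z, z <> a -> g1 z = ((z - a) * f z)%C).
  { intros z Hz; unfold g1; rewrite dquot_off by auto; unfold h; field; now apply Cminus_neq. }
  exists (dquot g1 a (C_derive g1 a)); split; [now apply hol_dquot|].
  intros z [Hz _]; assert (Hn : z <> a) by (intros ->; rewrite Cmod_diag in Hz; lra).
  rewrite dquot_off, Hg1 by auto.
  replace (g1 a) with (RtoC 0) by (unfold g1; now rewrite dquot_diag).
  field; now apply Cminus_neq.
Qed.

(** The local bounds are required at every point of the plane, not only at points of [Q]; this
    stands in for closedness of [Q]. *)
Lemma region_bounded (u : C -> C) (Q : C -> Prop) (B : R) :
  (forall z, Q z -> Cmod z <= B) ->
  (forall p, exists d M, 0 < d /\ forall w, Cmod (w - p) < d -> Q w -> Cmod (u w) <= M) ->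
  exists M, forall z, Q z -> Cmod (u z) <= M.
Proof.
  intros HB Hl; destruct (classic (exists z, Q z)) as [[z0 Hz0]|Hn].
  2:{ exists 0; intros z Hz; destruct Hn; eauto. }
  assert (HB0 : 0 <= B) by (eapply Rle_trans; [apply Cmod_ge_0 | apply (HB z0 Hz0)]).
  set (g := fun z => if excluded_middle_informative (Q z) then Cmod (u z) else 0).
  destruct (rect_bounded g (- B) (- B) (2 * B) (2 * B)) as [M HM]; try lra.
  - intros a b _ _; destruct (Hl (a, b)) as (d & M & Hd & H).
    exists d, (Rmax M 0); split; auto; intros w Hw; unfold g; destruct excluded_middle_informative.
    + eapply Rle_trans; [apply H; auto | apply Rmax_l].
    + apply Rmax_r.
  - exists M; intros [a b] Hz; pose proof (HB _ Hz) as H1.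
    pose proof (Rmax_Cmod (a, b)) as H2; simpl in H2.
    pose proof (Rmax_l (Rabs a) (Rabs b)); pose proof (Rmax_r (Rabs a) (Rabs b)).
    assert (Ha : Rabs a <= B) by lra; assert (Hb : Rabs b <= B) by lra.
    apply Rabs_le_between in Ha; apply Rabs_le_between in Hb.
    specialize (HM a b ltac:(lra) ltac:(lra)); unfold g in HM.
    now destruct excluded_middle_informative.
Qed.

Lemma disc_bounded (f : C -> C) (a : C) (R0 r : R) :
  hol f a R0 -> r < R0 -> exists M, forall z, Cmod (z - a) <= r -> Cmod (f z) <= M.
Proof.
  intros Hf Hr; apply (region_bounded f (fun z => Cmod (z - a) <= r) (Cmod a + Rabs r)).
  - intros z Hz; pose proof (Cmod_tri2 z a); pose proof (Rle_abs r); lra.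
  - intros p; destruct (Rlt_le_dec r (Cmod (p - a))) as [H|H].
    + exists (Cmod (p - a) - r), 0; split; [lra|]; intros w Hw Hq.
      pose proof (Cmod_tri p w a); rewrite Cmod_sym in Hw; lra.
    + destruct (ccont_nbhd _ _ (hol_ccont f a R0 p Hf ltac:(lra)) 1 ltac:(lra)) as [d [Hd H1]].
      exists d, (Cmod (f p) + 1); split; auto; intros w Hw _; specialize (H1 w Hw).
      pose proof (Cmod_tri2 (f w) (f p)); lra.
Qed.

Lemma Cpow_neq0 (x : C) (n : nat) : x <> 0%C -> (x ^ n)%C <> 0%C.
Proof. intros H; apply Cmod_gt_0; rewrite Cmod_pow; apply pow_lt, Cmod_gt_0, H. Qed.

(** If division by [z - a] never stops, then [f = (z - a) ^ m * g] for every [m]. A bound [M] for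
    [f] on radius [r / 2] then bounds [f] by [4 * M / 2 ^ m] on radius [r / 4], hence [f] vanishes
    there. *)
Lemma hol_factor (f : C -> C) (a : C) (r : R) : 0 < r -> hol f a r ->
  (forall z, Cmod (z - a) < r / 4 -> f z = 0%C) \/
  exists (m : nat) (g : C -> C), hol g a r /\ g a <> 0%C /\
    forall z, Cmod (z - a) < r -> f z = ((z - a) ^ m * g z)%C.
Proof.
  intros Hr Hf.
  destruct (classic (exists (m : nat) (g : C -> C), hol g a r /\ g a <> 0%C /\
    forall z, Cmod (z - a) < r -> f z = ((z - a) ^ m * g z)%C)) as [H|Hno]; [now right | left].
  assert (Hall : forall m : nat, exists g, hol g a r /\ forall z, Cmod (z - a) < r -> f z = ((z - a) ^ m * g z)%C).
  { induction m as [|m [g [Hg Hfg]]].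
    - exists f; split; auto; intros; simpl; ring.
    - assert (Hga : g a = 0%C) by (apply NNPP; intros Hn; apply Hno; exists m, g; auto).
      exists (dquot g a (C_derive g a)); split; [now apply hol_dquot|].
      intros z Hz; rewrite Hfg by auto.
      rewrite (dquot_eq g a (C_derive g a) z) at 1; rewrite Hga; simpl; ring. }
  destruct (disc_bounded f a r (r / 2) Hf ltac:(lra)) as [M HM].
  intros z Hz; apply Cmod_eq_0.
  destruct (Rle_lt_or_eq_dec 0 _ (Cmod_ge_0 (f z))) as [Hp|]; [exfalso|auto].
  destruct (pow2_small (4 * M) (Cmod (f z)) Hp) as [m Hm].
  destruct (Hall m) as [g [Hg Hfg]].
  assert (Hb : Cmod (g z) <= 4 * (M / (r / 2) ^ m)).
  { apply (cauchy_disc_bound g a z r (r / 2)); auto; try lra.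
    intros w Hw; specialize (HM w ltac:(lra)); rewrite Hfg, Cmod_mult, Cmod_pow, Hw in HM by lra.
    assert (0 < (r / 2) ^ m) by (apply pow_lt; lra).
    apply (Rmult_le_reg_r ((r / 2) ^ m)); auto; unfold Rdiv at 2; rewrite Rmult_assoc, Rinv_l; lra. }
  rewrite Hfg, Cmod_mult, Cmod_pow in Hm by lra.
  assert (H1 : Cmod (z - a) ^ m <= (r / 4) ^ m) by (apply pow_incr; split; [apply Cmod_ge_0 | lra]).
  assert (H2 : Cmod (z - a) ^ m * Cmod (g z) <= (r / 4) ^ m * (4 * (M / (r / 2) ^ m))).
  { apply Rmult_le_compat; auto; [apply pow_le|]; apply Cmod_ge_0. }
  assert (E : (r / 4) ^ m * (4 * (M / (r / 2) ^ m)) = 4 * M / 2 ^ m).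
  { replace ((r / 4) ^ m) with ((r / 2) ^ m / 2 ^ m).
    - field; split; apply pow_nonzero; lra.
    - unfold Rdiv; rewrite <- pow_inv, <- Rpow_mult_distr; f_equal; lra. }
  rewrite E in H2.
  assert (4 * M / 2 ^ m <= Rabs (4 * M) / 2 ^ m); [|lra].
  apply Rmult_le_compat_r; [left; apply Rinv_0_lt_compat, pow_lt; lra | apply Rle_abs].
Qed.

Lemma ccont_neq0_ball (f : C -> C) (a : C) : ccont f a -> f a <> 0%C ->
  exists d, 0 < d /\ forall z, Cmod (z - a) < d -> f z <> 0%C.
Proof.
  intros Hf Ha; pose proof (proj1 (Cmod_gt_0 _) Ha) as H0.
  destruct (ccont_nbhd f a Hf (Cmod (f a)) H0) as [d [Hd H]]; exists d; split; auto.
  intros z Hz E; specialize (H z Hz); rewrite E in H.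
  replace (0 - f a)%C with (- f a)%C in H by ring; rewrite Cmod_opp in H; lra.
Qed.

(** The reciprocal [/ u] is bounded near [p], so it extends holomorphically, with value 0 at [p].
    Factoring this zero and inverting gives the pole. *)
Lemma pole_form (u : C -> C) (p : C) (R0 : R) :
  0 < R0 -> hol_punct u p R0 -> (forall M, near p (fun z => M < Cmod (u z))) ->
  exists (n : nat) (r : R) (G : C -> C), (1 <= n)%nat /\ 0 < r /\ hol G p r /\ G p <> 0%C /\
    forall z, 0 < Cmod (z - p) < r -> u z = (G z / (z - p) ^ n)%C.
Proof.
  intros HR Hu Hinf; destruct (Hinf 1) as [d [Hd H1]].
  set (r1 := Rmin d R0); assert (Hr1 : 0 < r1) by now apply Rmin_pos.
  assert (Hrd : r1 <= d) by apply Rmin_l; assert (HrR : r1 <= R0) by apply Rmin_r.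
  assert (Hu0 : forall z, 0 < Cmod (z - p) < r1 -> u z <> 0%C).
  { intros z Hz; apply Cmod_gt_0; specialize (H1 z ltac:(lra)); lra. }
  destruct (riemann_removable (fun z => / u z)%C p r1 1) as [h [Hh Hhu]]; auto.
  { intros z Hz; destruct (Hu z ltac:(lra)) as [l Hl]; eexists; apply cder_inv; eauto. }
  { intros z Hz; specialize (H1 z ltac:(lra)); rewrite <- Rinv_1; apply Cmod_inv_le; lra. }
  assert (Hhp : h p = 0%C).
  { apply (tends_unique h p); [apply (hol_ccont h p r1); auto; rewrite Cmod_diag; lra|].
    intros e He; generalize (near_and _ _ _ (near_ball p r1 Hr1) (Hinf (/ e))); apply near_imp.
    intros w [Hw1 Hw2]; rewrite Hhu by auto.
    assert (0 < / e) by now apply Rinv_0_lt_compat.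
    replace (/ u w - 0)%C with (/ u w)%C by ring; rewrite Cmod_inv by auto.
    rewrite <- (Rinv_inv e); apply Rinv_lt_contravar; auto; nra. }
  destruct (hol_factor h p r1 Hr1 Hh) as [Hz | (m & g & Hg & Hgp & Hhg)].
  { destruct (near_point p (r1 / 4) ltac:(lra)) as [w Hw].
    exfalso; apply (Hu0 w ltac:(lra)).
    assert (E : (/ u w)%C = 0%C) by (rewrite <- Hhu by lra; apply Hz; lra).
    replace (u w) with (/ / u w)%C by (field; apply Hu0; lra).
    apply NNPP; intros _; assert (Hi : (u w * / u w)%C = 1%C) by (apply Cinv_r, Hu0; lra).
    rewrite E in Hi; replace (u w * 0)%C with (RtoC 0) in Hi by ring; apply RtoC_inj in Hi; lra. }
  destruct (ccont_neq0_ball g p) as [d2 [Hd2 Hg2]]; auto.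
  { apply (hol_ccont g p r1); auto; rewrite Cmod_diag; lra. }
  exists m, (Rmin r1 d2), (fun z => / g z)%C.
  pose proof (Rmin_l r1 d2); pose proof (Rmin_r r1 d2).
  repeat split.
  - destruct m; [|lia]; exfalso; apply Hgp; rewrite <- Hhp, Hhg by (rewrite Cmod_diag; lra); simpl; ring.
  - now apply Rmin_pos.
  - apply hol_inv; [intros z Hz; apply Hg2; lra | apply (hol_mono _ _ r1); auto].
  - intros E; assert (Hi : (g p * / g p)%C = 1%C) by now apply Cinv_r.
    rewrite E in Hi; replace (g p * 0)%C with (RtoC 0) in Hi by ring; apply RtoC_inj in Hi; lra.
  - intros z Hz; assert (Hzp : (z - p)%C <> 0%C) by (apply Cmod_gt_0; lra).
    assert (Hgz : g z <> 0%C) by (apply Hg2; lra).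
    pose proof (Hu0 z ltac:(lra)); pose proof (Cpow_neq0 _ m Hzp).
    assert (E : (/ u z)%C = ((z - p) ^ m * g z)%C) by (rewrite <- Hhu by lra; apply Hhg; lra).
    replace (u z) with (/ / u z)%C by (field; auto); rewrite E; field; auto.
Qed.

(** * Meromorphic germs and the identity theorem *)

Definition mero_at (u : C -> C) (p : C) : Prop :=
  exists (n : nat) (r : R) (G : C -> C), 0 < r /\ hol G p r /\
    forall z, 0 < Cmod (z - p) < r -> u z = (G z / (z - p) ^ n)%C.

Lemma hol_mero_at (u : C -> C) (p : C) (r : R) : 0 < r -> hol u p r -> mero_at u p.
Proof. intros Hr Hu; exists 0%nat, r, u; repeat split; auto; intros; simpl; field. Qed.

(** [mero_at] lets the numerator vanish at [p], so the orders can simply be added and no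
    cancellation has to be tracked. *)
Lemma mero_at_minus (u v : C -> C) (p : C) :
  mero_at u p -> mero_at v p -> mero_at (fun z => u z - v z)%C p.
Proof.
  intros (n & r & G & Hr & HG & HuG) (m & s & F & Hs & HF & HvF).
  pose proof (Rmin_l r s); pose proof (Rmin_r r s).
  exists (n + m)%nat, (Rmin r s), (fun z => G z * (z - p) ^ m - F z * (z - p) ^ n)%C.
  split; [now apply Rmin_pos|]; split.
  - apply hol_minus; apply hol_mult; try apply hol_pow;
      [apply (hol_mono G p r) | apply (hol_mono F p s)]; auto.
  - intros z Hz; cbv beta; rewrite HuG, HvF by lra; rewrite Cpow_add_r.
    assert (Hzp : (z - p)%C <> 0%C) by (apply Cmod_gt_0; lra).
    field; split; now apply Cpow_neq0.
Qed.

Lemma mero_at_dichotomy (u : C -> C) (p : C) : mero_at u p ->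
  near p (fun z => u z = 0%C) \/ near p (fun z => u z <> 0%C).
Proof.
  intros (n & r & G & Hr & HG & HuG).
  destruct (hol_factor G p r Hr HG) as [Hz | (m & g & Hg & Hgp & HGg)].
  - left; exists (r / 4); split; [lra|]; intros w Hw; rewrite HuG, Hz by lra; unfold Cdiv; ring.
  - right; destruct (ccont_neq0_ball g p) as [d [Hd Hgd]]; auto.
    { apply (hol_ccont g p r); auto; rewrite Cmod_diag; lra. }
    exists (Rmin r d); split; [now apply Rmin_pos|]; intros w Hw.
    pose proof (Rmin_l r d); pose proof (Rmin_r r d).
    assert (Hwp : (w - p)%C <> 0%C) by (apply Cmod_gt_0; lra).
    rewrite HuG, HGg by lra; apply Cmult_neq_0; [apply Cmult_neq_0; [now apply Cpow_neq0 | apply Hgd; lra]|].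
    apply Cmod_gt_0; rewrite Cmod_inv by now apply Cpow_neq0.
    apply Rinv_0_lt_compat, Cmod_gt_0; now apply Cpow_neq0.
Qed.

Lemma near_near (p : C) (P : C -> Prop) : near p P ->
  exists d, 0 < d /\ forall q, 0 < Cmod (q - p) < d -> near q P.
Proof.
  intros [d [Hd H]]; exists d; split; auto; intros q Hq.
  exists (Rmin (Cmod (q - p)) (d - Cmod (q - p))); split; [apply Rmin_pos; lra|].
  intros w [Hw1 Hw2]; pose proof (Rmin_l (Cmod (q - p)) (d - Cmod (q - p)));
  pose proof (Rmin_r (Cmod (q - p)) (d - Cmod (q - p))).
  apply H; pose proof (Cmod_tri w q p); pose proof (Cmod_tri q w p); rewrite (Cmod_sym q w) in *; lra.
Qed.

(** By the local dichotomy, the set of points near which [u] vanishes is open with open complement.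
    Connectedness of a large square comes from bisection, applied to the claim that membership at
    one point of a rectangle spreads to all of it. *)
Lemma identity_theorem (u : C -> C) (p q : C) :
  (forall z, mero_at u z) -> near p (fun z => u z = 0%C) -> near q (fun z => u z = 0%C).
Proof.
  intros Hu.
  set (Z := fun p => near p (fun z => u z = 0%C)).
  assert (Hloc : forall p, exists d, 0 < d /\ ((forall q, Cmod (q - p) < d -> Z q) \/ (forall q, Cmod (q - p) < d -> ~ Z q))).
  { intros a; destruct (mero_at_dichotomy u a (Hu a)) as [H|H];
    destruct (near_near _ _ H) as [d [Hd Hq]]; exists d; split; auto.
    - left; intros b Hb; destruct (classic (b = a)) as [->|Hn]; [exact H|].
      apply Hq; split; auto; now apply Cmod_minus_gt0.
    - right; intros b Hb HZ.
      assert (Hb' : near b (fun z => u z <> 0%C)).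
      { destruct (classic (b = a)) as [->|Hn]; [exact H|].
        apply Hq; split; auto; now apply Cmod_minus_gt0. }
      destruct (near_exists _ _ (near_and _ _ _ HZ Hb')) as [w [H1 H2]]; auto. }
  set (B := Cmod p + Cmod q).
  pose proof (Cmod_ge_0 p); pose proof (Cmod_ge_0 q).
  assert (Main : forall a b a' b', - B <= a <= - B + 2 * B -> - B <= b <= - B + 2 * B ->
     - B <= a' <= - B + 2 * B -> - B <= b' <= - B + 2 * B -> Z (a, b) -> Z (a', b')).
  { apply (bisection (fun x y w h => forall a b a' b', x <= a <= x + w -> y <= b <= y + h ->
     x <= a' <= x + w -> y <= b' <= y + h -> Z (a, b) -> Z (a', b'))); try (unfold B; lra).
    - intros x y w h Hw Hh _ _ _ _ P1 P2 P3 P4 a b a' b' Ha Hb Ha' Hb' HZ.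
      (* The centre belongs to all four quarters and passes the property from one to the others. *)
      assert (Hc : Z (x + w / 2, y + h / 2)).
      { destruct (Rle_dec a (x + w / 2)), (Rle_dec b (y + h / 2)).
        + apply (P1 a b); auto; lra.
        + apply (P3 a b); auto; lra.
        + apply (P2 a b); auto; lra.
        + apply (P4 a b); auto; lra. }
      destruct (Rle_dec a' (x + w / 2)), (Rle_dec b' (y + h / 2)).
      + apply (P1 (x + w / 2) (y + h / 2)); auto; lra.
      + apply (P3 (x + w / 2) (y + h / 2)); auto; lra.
      + apply (P2 (x + w / 2) (y + h / 2)); auto; lra.
      + apply (P4 (x + w / 2) (y + h / 2)); auto; lra.
    - intros a b _ _; destruct (Hloc (a, b)) as [d [Hd HZ]]; exists (d / 2); split; [lra|].
      intros x y w h Hw Hh _ _ _ _ Hxa Hyb a1 b1 a2 b2 H1 H2 H3 H4.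
      assert (Hin : forall a' b', x <= a' <= x + w -> y <= b' <= y + h -> Cmod ((a', b') - (a, b)) < d).
      { intros a' b' H5 H6.
        pose proof (rect_dist x y w h a b a' b' Hxa Hyb H5 H6); lra. }
      destruct HZ as [HZ|HZ]; [intros _; now apply HZ, Hin|].
      intros HZ1; destruct (HZ (a1, b1)); auto. }
  assert (Hb : forall z : C, Cmod z <= B -> - B <= fst z <= - B + 2 * B /\ - B <= snd z <= - B + 2 * B).
  { intros z Hz; pose proof (Rmax_Cmod z); pose proof (Rmax_l (Rabs (fst z)) (Rabs (snd z)));
    pose proof (Rmax_r (Rabs (fst z)) (Rabs (snd z))).
    assert (H4 : Rabs (fst z) <= B) by lra; assert (H5 : Rabs (snd z) <= B) by lra.
    apply Rabs_le_between in H4; apply Rabs_le_between in H5; lra. }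
  destruct p as [a b], q as [a' b'].
  destruct (Hb (a, b)) as [H1 H2]; [unfold B; lra|]; destruct (Hb (a', b')) as [H3 H4]; [unfold B; lra|].
  apply (Main a b a' b'); auto.
Qed.

(** * Entire functions and polynomial growth *)

Definition entire (f : C -> C) : Prop := forall z, exists l, cder f z l.

Lemma entire_hol (f : C -> C) (a : C) (r : R) : entire f -> hol f a r.
Proof. intros H z _; apply H. Qed.

Lemma entire_dquot (f : C -> C) (a : C) : entire f -> entire (dquot f a (C_derive f a)).
Proof.
  intros H z; apply (hol_dquot f a (Cmod (z - a) + 1)); [|now apply entire_hol|lra].
  pose proof (Cmod_ge_0 (z - a)); lra.
Qed.

Lemma Liouville (f : C -> C) (M : R) : entire f -> (forall z, Cmod (f z) <= M) -> forall z a, f z = f a.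
Proof.
  intros Hf HM z a.
  assert (HM0 : 0 <= M) by (eapply Rle_trans; [apply Cmod_ge_0 | apply (HM a)]).
  rewrite (dquot_eq f a (C_derive f a) z); set (g := dquot f a (C_derive f a)).
  assert (E : g z = 0%C); [|rewrite E; ring].
  apply Cmod_eq_0; destruct (Rle_lt_or_eq_dec 0 _ (Cmod_ge_0 (g z))) as [Hp|]; [exfalso|auto].
  pose proof (Cmod_ge_0 (z - a)).
  (* The first summand puts [z] in the half disc. The second makes the bound [8 * M / r] for the
     difference quotient smaller than [Cmod (g z)]. *)
  set (r := 2 * Cmod (z - a) + 16 * (M + 1) / Cmod (g z)).
  assert (Hq : 0 < 16 * (M + 1) / Cmod (g z)) by (apply Rdiv_lt_0_compat; lra).
  assert (Hb : Cmod (g z) <= 4 * (2 * M / r)).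
  { apply (cauchy_disc_bound g a z (r + 1) r); try (unfold r; lra).
    - apply entire_hol, entire_dquot, Hf.
    - intros w Hw; assert (Hn : (w - a)%C <> 0%C) by (apply Cmod_gt_0; unfold r in Hw; lra).
      unfold g; rewrite dquot_off by (intros ->; apply Hn; ring).
      rewrite Cmod_div, Hw by auto; apply Rmult_le_compat_r.
      + left; apply Rinv_0_lt_compat; unfold r; lra.
      + pose proof (HM w); pose proof (HM a); pose proof (Cmod_triangle (f w) (- f a)); rewrite Cmod_opp in *.
        unfold Cminus; lra. }
  assert (Hr : 0 < r) by (unfold r; lra).
  apply (Rmult_le_compat_r r) in Hb; [|lra].
  replace (4 * (2 * M / r) * r) with (8 * M) in Hb by (field; lra).
  assert (Hx : Cmod (g z) * (16 * (M + 1) / Cmod (g z)) = 16 * (M + 1)) by (field; lra).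
  unfold r in Hb; nra.
Qed.

Definition poly_growth (f : C -> C) (m : nat) : Prop :=
  exists K, forall z, Cmod (f z) <= K * (1 + Cmod z) ^ m.

Lemma poly_growth_dquot (f : C -> C) (a : C) (m : nat) : entire f ->
  poly_growth f (S m) -> poly_growth (dquot f a (C_derive f a)) m.
Proof.
  intros Hf [K HK]; set (g := dquot f a (C_derive f a)).
  destruct (disc_bounded g a 2 1) as [M HM]; [apply entire_hol, entire_dquot, Hf | lra |].
  assert (HK0 : 0 <= K).
  { pose proof (HK 0%C) as H; rewrite Cmod_0, Rplus_0_r, pow1 in H; pose proof (Cmod_ge_0 (f 0%C)); lra. }
  assert (HM0 : 0 <= M).
  { eapply Rle_trans; [apply Cmod_ge_0 | apply (HM a)]; rewrite Cmod_diag; lra. }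
  pose proof (Cmod_ge_0 a); pose proof (Cmod_ge_0 (f a)).
  set (L := (K + Cmod (f a)) * (2 + Cmod a)).
  assert (HL : 0 <= L) by (apply Rmult_le_pos; lra).
  exists (M + L); intros z; pose proof (Cmod_ge_0 z).
  assert (Hpw : 1 <= (1 + Cmod z) ^ m) by (apply pow_R1_Rle; lra).
  destruct (Rle_dec (Cmod (z - a)) 1) as [Hz|Hz].
  - specialize (HM z Hz); nra.
  - assert (Hn : (z - a)%C <> 0%C) by (apply Cmod_gt_0; lra).
    unfold g; rewrite dquot_off by (intros ->; apply Hn; ring).
    rewrite Cmod_div by auto.
    apply (Rmult_le_reg_r (Cmod (z - a))); [lra|].
    unfold Rdiv; rewrite Rmult_assoc, Rinv_l, Rmult_1_r by lra.
    pose proof (Cmod_triangle (f z) (- f a)) as Ht; rewrite Cmod_opp in Ht.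
    specialize (HK z); simpl in HK.
    assert (H5 : 1 + Cmod z <= (2 + Cmod a) * Cmod (z - a)).
    { pose proof (Cmod_tri2 z a); nra. }
    assert (H6 : 1 <= (1 + Cmod z) * (1 + Cmod z) ^ m) by nra.
    assert (H7 : Cmod (f z - f a) <= (K + Cmod (f a)) * ((1 + Cmod z) * (1 + Cmod z) ^ m)).
    { unfold Cminus; nra. }
    eapply Rle_trans; [apply H7|].
    apply Rle_trans with (L * (1 + Cmod z) ^ m * Cmod (z - a)).
    + unfold L; replace ((K + Cmod (f a)) * (2 + Cmod a) * (1 + Cmod z) ^ m * Cmod (z - a))
        with ((K + Cmod (f a)) * (((2 + Cmod a) * Cmod (z - a)) * (1 + Cmod z) ^ m)) by ring.
      apply Rmult_le_compat_l; [lra|]; apply Rmult_le_compat_r; lra.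
    + apply Rmult_le_compat_r; [lra|]; nra.
Qed.

Lemma poly_growth_quadratic (f : C -> C) : entire f -> poly_growth f 2 ->
  exists p0 p1 p2, forall z, f z = (p0 + p1 * z + p2 * z * z)%C.
Proof.
  intros Hf Hg.
  set (f1 := dquot f 0 (C_derive f 0)); set (f2 := dquot f1 0 (C_derive f1 0)).
  assert (Hf1 : entire f1) by now apply entire_dquot.
  assert (Hf2 : entire f2) by now apply entire_dquot.
  assert (Hg2 : poly_growth f2 0) by (now repeat apply poly_growth_dquot).
  destruct Hg2 as [K HK].
  exists (f 0%C), (f1 0%C), (f2 0%C); intros z.
  assert (E2 : f2 z = f2 0%C).
  { apply (Liouville f2 K Hf2); intros w; specialize (HK w); simpl in HK; lra. }
  pose proof (dquot_eq f (RtoC 0) (C_derive f 0) z) as E; fold f1 in E.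
  pose proof (dquot_eq f1 (RtoC 0) (C_derive f1 0) z) as E1; fold f2 in E1.
  rewrite E, E1, E2; ring.
Qed.

(** Dividing out one zero lowers the growth exponent by one and leaves the shifted sequence of
    zeros; at exponent 0 Liouville's theorem ends the induction. *)
Lemma poly_growth_zeros (f : C -> C) (m : nat) (a : nat -> C) : entire f -> poly_growth f m ->
  (forall i j, a i = a j -> i = j) -> (forall i, f (a i) = 0%C) -> forall z, f z = 0%C.
Proof.
  revert f a; induction m; intros f a Hf Hg Hinj Ha z.
  - destruct Hg as [K HK]; rewrite <- (Ha 0%nat); apply (Liouville f K); auto.
    intros w; specialize (HK w); simpl in HK; lra.
  - rewrite (dquot_eq f (a 0%nat) (C_derive f (a 0%nat)) z), Ha.
    rewrite (IHm (dquot f (a 0%nat) (C_derive f (a 0%nat))) (fun i => a (S i))); [ring | | | |].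
    + now apply entire_dquot.
    + now apply poly_growth_dquot.
    + intros i j E; apply Hinj in E; lia.
    + intros i; rewrite dquot_off, !Ha; [unfold Cdiv; ring|].
      intros E; apply Hinj in E; lia.
Qed.

(** All singularities are filled at once by choosing a value at each point of [S]. The choices do
    not interfere, as each point has a punctured disc free of [S]. *)
Lemma removable_set (f : C -> C) (S : C -> Prop) :
  (forall p, S p -> exists (r M : R), 0 < r /\ hol_punct f p r /\
     forall z, 0 < Cmod (z - p) < r -> ~ S z /\ Cmod (f z) <= M) ->
  exists g, (forall p, S p -> exists l, cder g p l) /\ (forall z, ~ S z -> g z = f z).
Proof.
  intros Hb.
  assert (Hloc : forall p, S p -> exists v : C, exists r, 0 < r /\ exists g, hol g p r /\ g p = v /\
     forall z, 0 < Cmod (z - p) < r -> ~ S z /\ g z = f z).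
  { intros p Hp; destruct (Hb p Hp) as (r & M & Hr & Hf & HM).
    destruct (riemann_removable f p r M) as [g [Hg1 Hg2]]; auto; [intros z Hz; apply HM, Hz|].
    exists (g p), r; split; auto; exists g; repeat split; auto; apply HM; auto. }
  set (v := fun p => match excluded_middle_informative (S p) with
                     | left Hp => proj1_sig (constructive_indefinite_description _ (Hloc p Hp))
                     | right _ => f p end).
  assert (Hoff : forall z, ~ S z -> v z = f z).
  { intros z Hz; unfold v; now destruct excluded_middle_informative. }
  exists v; split; auto; intros p Hp.
  assert (Hvp : exists r, 0 < r /\ exists g, hol g p r /\ g p = v p /\
     forall z, 0 < Cmod (z - p) < r -> ~ S z /\ g z = f z).
  { unfold v; destruct excluded_middle_informative as [Hp'|]; [|now destruct n].
    apply (proj2_sig (constructive_indefinite_description _ (Hloc p Hp'))). }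
  destruct Hvp as (r & Hr & g & Hg & Hgp & H).
  destruct (Hg p ltac:(rewrite Cmod_diag; lra)) as [l Hl]; exists l.
  apply (cder_ext g); auto; exists r; split; auto; intros w Hw.
  destruct (H w Hw) as [H1 H2]; rewrite Hoff; auto.
Qed.

(** * Local analysis of the equation at a pole *)

Lemma cder_pow_neq0 (a z : C) (n : nat) : (z - a)%C <> 0%C ->
  cder (fun w => (w - a) ^ n)%C z (RtoC (INR n) * (z - a) ^ n / (z - a))%C.
Proof.
  intros H; apply (cder_eq _ _ (RtoC (INR n) * (z - a) ^ pred n)%C); [|apply cder_pow].
  destruct n; simpl; field; auto.
Qed.

(** Numerator of the derivative of [F * (z - p) ^ m / (z - p) ^ j] over [(z - p) ^ S j]. Keeping [m]
    and [j] apart keeps the exponents natural; the leading coefficient is just multiplied by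
    [m - j]. *)
Definition laurent_step (F : C -> C) (p : C) (m j : nat) (z : C) : C :=
  (RtoC (INR m - INR j) * F z + (z - p) * C_derive F z)%C.

Lemma laurent_step_center (F : C -> C) (p : C) (m j : nat) :
  laurent_step F p m j p = (RtoC (INR m - INR j) * F p)%C.
Proof. unfold laurent_step; ring. Qed.

Lemma hol_laurent_step (F : C -> C) (p : C) (r : R) (m j : nat) :
  hol F p r -> hol (laurent_step F p m j) p r.
Proof.
  intros H; apply hol_plus; [apply hol_mult; auto; apply hol_const|].
  apply hol_mult; [apply hol_minus; [apply hol_id | apply hol_const] | now apply hol_derive].
Qed.

Lemma laurent_derive (f F : C -> C) (p : C) (r : R) (m j : nat) :
  hol F p r -> (forall z, 0 < Cmod (z - p) < r -> f z = (F z * (z - p) ^ m / (z - p) ^ j)%C) ->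
  forall z, 0 < Cmod (z - p) < r ->
    cder f z (laurent_step F p m j z * (z - p) ^ m / (z - p) ^ (S j))%C /\
    C_derive f z = (laurent_step F p m j z * (z - p) ^ m / (z - p) ^ (S j))%C.
Proof.
  intros HF Hf z Hz.
  enough (H : cder f z (laurent_step F p m j z * (z - p) ^ m / (z - p) ^ (S j))%C)
    by (split; auto; now apply C_derive_cder).
  assert (Hx : (z - p)%C <> 0%C) by (apply Cmod_gt_0; lra).
  pose proof (Cpow_neq0 _ m Hx); pose proof (Cpow_neq0 _ j Hx).
  destruct (punctured_disc_open p z r Hz) as [d [Hd Hin]].
  apply (cder_ext_ball (fun z => F z * (z - p) ^ m / (z - p) ^ j)%C _ _ _ d); auto.
  - intros w Hw; symmetry; auto.
  - eapply cder_eq; [|apply cder_div; [auto | apply cder_mult | ]].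
    2: apply (hol_cder F p r); auto; lra.
    2: now apply cder_pow_neq0.
    2: now apply cder_pow_neq0.
    unfold laurent_step; simpl; rewrite RtoC_minus; field; auto.
Qed.

Lemma laurent_hol_punct (f F : C -> C) (p : C) (r : R) (m j : nat) :
  hol F p r -> (forall z, 0 < Cmod (z - p) < r -> f z = (F z * (z - p) ^ m / (z - p) ^ j)%C) ->
  hol_punct f p r.
Proof. intros HF Hf z Hz; eexists; apply (laurent_derive f F p r m j HF Hf z Hz). Qed.

Lemma hol_zero_center (E : C -> C) (p : C) (r : R) : 0 < r -> hol E p r ->
  (forall z, 0 < Cmod (z - p) < r -> E z = 0%C) -> E p = 0%C.
Proof.
  intros Hr HE H; apply (tends_unique E p).
  - apply (hol_ccont E p r); auto; rewrite Cmod_diag; lra.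
  - apply (tends_ext (fun _ => 0%C)); [|apply tends_const].
    exists r; split; auto; intros; symmetry; auto.
Qed.

Lemma C_derive_minus_punct (u v w : C -> C) (p : C) (r : R) :
  hol_punct u p r -> hol_punct v p r ->
  (forall z, 0 < Cmod (z - p) < r -> w z = (u z - v z)%C) ->
  forall z, 0 < Cmod (z - p) < r -> C_derive w z = (C_derive u z - C_derive v z)%C.
Proof.
  intros Hu Hv Hw z Hz; destruct (Hu z Hz) as [l Hl], (Hv z Hz) as [m Hm].
  rewrite (C_derive_cder _ _ _ Hl), (C_derive_cder _ _ _ Hm); apply C_derive_cder.
  destruct (punctured_disc_open p z r Hz) as [d [Hd Hin]].
  apply (cder_ext_ball (fun z => u z - v z)%C _ _ _ d); auto.
  - intros y Hy; symmetry; auto.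
  - now apply cder_minus.
Qed.

Definition ode_at (A B al be ga de : R) (u : C -> C) (z : C) : Prop :=
  (RtoC A * D1 u z * D1 u z + RtoC B * u z * D2 u z =
   D3 u z + RtoC al * D2 u z + RtoC be * D1 u z + RtoC ga * u z + RtoC de)%C.

Ltac hol_tac := repeat match goal with
  | H : hol ?f ?p ?r |- hol ?f ?p ?r => exact H
  | |- hol (laurent_step _ _ _ _) _ _ => apply hol_laurent_step
  | |- hol (fun z => ?F z) ?p ?r => change (hol F p r)
  | |- hol (fun z => Cplus (@?f z) (@?g z)) _ _ => apply (hol_plus f g)
  | |- hol (fun z => Cminus (@?f z) (@?g z)) _ _ => apply (hol_minus f g)
  | |- hol (fun z => Cmult (@?f z) (@?g z)) _ _ => apply (hol_mult f g)
  | |- hol (fun z => Cpow (Cminus z _) _) _ _ => apply hol_pow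
  | |- hol (fun _ => ?c) _ _ => apply (hol_const c)
  end.

(** For a pole of order [n = k + 1] the equation is multiplied by [(z - p) ^ (2 * k + 4)] and
    evaluated at [p]. The left side leaves (A n^2 + B n (n + 1)) times the square of [F0 p]; the
    third derivative contributes only if [k = 0], and the other terms never do. *)
Lemma simple_pole (A B al be ga de : R) (u : C -> C) (p : C) (R0 : R) :
  A + B <> 0 -> A + 2 * B <> 0 -> (forall n : Z, (n <> 0)%Z -> B / (A + B) <> IZR n) ->
  0 < R0 -> hol_punct u p R0 -> (forall M, near p (fun z => M < Cmod (u z))) ->
  (forall z, 0 < Cmod (z - p) < R0 -> ode_at A B al be ga de u z) ->
  exists (r : R) (G : C -> C), 0 < r /\ hol G p r /\ G p = RtoC (- 6 / (A + 2 * B)) /\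
    forall z, 0 < Cmod (z - p) < r -> u z = (G z / (z - p))%C.
Proof.
  intros HAB HA2B Hii HR Hu Hinf Hode.
  destruct (pole_form u p R0 HR Hu Hinf) as (n & r0 & F0 & Hn & Hr0 & HF0' & HFp & HuF').
  set (r := Rmin r0 R0); assert (Hr : 0 < r) by now apply Rmin_pos.
  assert (Hrr : r <= r0) by apply Rmin_l; assert (HrR : r <= R0) by apply Rmin_r.
  assert (HF0 : hol F0 p r) by (apply (hol_mono _ _ r0); auto).
  assert (Hu0 : forall z, 0 < Cmod (z - p) < r -> u z = (F0 z * (z - p) ^ 0 / (z - p) ^ n)%C).
  { intros z Hz; rewrite HuF' by lra; simpl; unfold Cdiv; ring. }
  set (F1 := laurent_step F0 p 0 n); assert (HF1 : hol F1 p r) by (unfold F1; hol_tac).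
  assert (Hu1 : forall z, 0 < Cmod (z - p) < r -> D1 u z = (F1 z * (z - p) ^ 0 / (z - p) ^ S n)%C).
  { intros z Hz; apply (laurent_derive u F0 p r); auto. }
  set (F2 := laurent_step F1 p 0 (S n)); assert (HF2 : hol F2 p r) by (unfold F2; hol_tac).
  assert (Hu2 : forall z, 0 < Cmod (z - p) < r -> D2 u z = (F2 z * (z - p) ^ 0 / (z - p) ^ S (S n))%C).
  { intros z Hz; apply (laurent_derive (D1 u) F1 p r); auto. }
  set (F3 := laurent_step F2 p 0 (S (S n))); assert (HF3 : hol F3 p r) by (unfold F3; hol_tac).
  assert (Hu3 : forall z, 0 < Cmod (z - p) < r -> D3 u z = (F3 z * (z - p) ^ 0 / (z - p) ^ S (S (S n)))%C).
  { intros z Hz; apply (laurent_derive (D2 u) F2 p r); auto. }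
  destruct n as [|k]; [lia|].
  set (E := fun z => (RtoC A * F1 z * F1 z + RtoC B * F0 z * F2 z - (F3 z * (z - p) ^ k
     + RtoC al * F2 z * (z - p) ^ 1 * (z - p) ^ k + RtoC be * F1 z * (z - p) ^ 2 * (z - p) ^ k
     + RtoC ga * F0 z * (z - p) ^ 3 * (z - p) ^ k + RtoC de * (z - p) ^ 4 * (z - p) ^ k * (z - p) ^ k))%C).
  assert (HE : E p = 0%C).
  { apply (hol_zero_center E p r Hr); [unfold E; hol_tac|].
    intros z Hz; assert (Hx : (z - p)%C <> 0%C) by (apply Cmod_gt_0; lra).
    pose proof (Cpow_neq0 _ k Hx) as HY.
    specialize (Hode z ltac:(lra)); unfold ode_at in Hode.
    rewrite Hu0, Hu1, Hu2, Hu3 in Hode by auto; simpl in Hode.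
    unfold E; simpl; set (x := (z - p)%C) in *; set (Y := (x ^ k)%C) in *.
    match type of Hode with ?l = ?rr => transitivity (x * x * x * x * Y * Y * (l - rr))%C end;
      [field; auto | rewrite Hode; ring]. }
  assert (E1 : F1 p = (RtoC (- (INR k + 1)) * F0 p)%C).
  { unfold F1; rewrite laurent_step_center, S_INR; simpl INR; f_equal; f_equal; ring. }
  assert (E2 : F2 p = (RtoC ((INR k + 1) * (INR k + 2)) * F0 p)%C).
  { unfold F2; rewrite laurent_step_center, E1, !S_INR; simpl INR.
    rewrite Cmult_assoc, <- RtoC_mult; f_equal; f_equal; ring. }
  assert (E3 : F3 p = (RtoC (- ((INR k + 1) * (INR k + 2) * (INR k + 3))) * F0 p)%C).
  { unfold F3; rewrite laurent_step_center, E2, !S_INR; simpl INR.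
    rewrite Cmult_assoc, <- RtoC_mult; f_equal; f_equal; ring. }
  unfold E in HE; rewrite E1, E2, E3 in HE.
  destruct k as [|k].
  - exists r, F0; repeat split; auto.
    + apply Cminus_diag_eq.
      (* For order one the balance reads (A + 2 B) x^2 + 6 x = 0 with [x = F0 p] nonzero, which
         fixes the residue. *)
      assert (H2B : RtoC (A + 2 * B) <> 0%C) by (intros H; apply RtoC_inj in H; auto).
      assert (HX : (F0 p * (RtoC (A + 2 * B) * F0 p + 6))%C = 0%C).
      { rewrite <- HE; simpl; rewrite ?RtoC_plus, ?RtoC_mult, ?RtoC_opp, ?RtoC_plus, ?RtoC_mult, ?RtoC_plus; ring. }
      assert (HX2 : (RtoC (A + 2 * B) * F0 p + 6)%C = 0%C).
      { apply NNPP; intros Hq; apply (Cmult_neq_0 _ _ HFp Hq HX). }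
      rewrite RtoC_div by auto.
      replace (F0 p - RtoC (- 6) / RtoC (A + 2 * B))%C with ((RtoC (A + 2 * B) * F0 p + 6) / RtoC (A + 2 * B))%C
        by (replace (RtoC (- 6)) with (- RtoC 6)%C by (rewrite <- RtoC_opp; f_equal; ring); field; auto).
      rewrite HX2; unfold Cdiv; ring.
    + intros z Hz; rewrite Hu0 by auto; simpl; field; apply Cmod_gt_0; lra.
  - exfalso.
    (* Here the pole order is [c + 1], and the balance forces [B / (A + B)] to be its negative. *)
    set (c := INR (S k)) in *.
    assert (Hc : 0 <= c) by apply pos_INR.
    assert (HX : (RtoC (A * (c + 1) * (c + 1) + B * ((c + 1) * (c + 2))) * (F0 p * F0 p))%C = 0%C).
    { rewrite <- HE; rewrite ?RtoC_plus, ?RtoC_mult, ?RtoC_opp, ?RtoC_mult, ?RtoC_plus; simpl; ring. }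
    assert (HX2 : A * (c + 1) * (c + 1) + B * ((c + 1) * (c + 2)) = 0).
    { apply NNPP; intros Hq; apply (Cmult_neq_0 (RtoC (A * (c + 1) * (c + 1) + B * ((c + 1) * (c + 2)))) (F0 p * F0 p)%C); auto.
      - intros H; apply RtoC_inj in H; auto.
      - now apply Cmult_neq_0. }
    assert (HX3 : (A + B) * (c + 1) = - B).
    { assert ((c + 1) * ((A + B) * (c + 1) + B) = 0) by (rewrite <- HX2; ring).
      apply Rmult_integral in H; destruct H; lra. }
    apply (Hii (- Z.of_nat (S (S k)))%Z); [lia|].
    rewrite opp_IZR, <- INR_IZR_INZ, S_INR; fold c.
    apply (Rmult_eq_reg_r (A + B)); auto; unfold Rdiv; rewrite Rmult_assoc, Rinv_l by auto; lra.
Qed.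

(** The quadratic has discriminant (5 A + 4 B)^2 - 24 B (A + 2 B) = 25 A^2 + 16 A B - 32 B^2, which
    its real root makes a square [t ^ 2]; [s] is the sign of [t]. Adding 1 to the root turns 5 A + 4
    B into 7 A + 8 B in the numerator. *)
Lemma fuchs_index_of_root (A B : R) (k : nat) : A + 2 * B <> 0 ->
  (A + 2 * B) * INR k ^ 2 - (5 * A + 4 * B) * INR k + 6 * B = 0 ->
  exists s, (s = 1 \/ s = -1) /\ fuchs_index A B s = RtoC (INR (S k)).
Proof.
  intros H2 Hq; set (m := INR k) in *.
  set (t := 2 * (A + 2 * B) * m - (5 * A + 4 * B)).
  assert (Hd : 25 * A ^ 2 + 16 * A * B - 32 * B ^ 2 = t ^ 2).
  { unfold t; transitivity ((5 * A + 4 * B) ^ 2 - 4 * (A + 2 * B) * (6 * B)); [ring|].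
    replace (6 * B) with (- ((A + 2 * B) * m ^ 2 - (5 * A + 4 * B) * m)) by lra; ring. }
  assert (Hs : forall s, s * Rabs t = t -> fuchs_index A B s = RtoC (INR (S k))).
  { intros s Hst; unfold fuchs_index, csqrt_R; rewrite Hd.
    destruct Rle_dec as [_|n]; [|destruct n; apply pow2_ge_0].
    rewrite <- Rsqr_pow2, sqrt_Rsqr_abs, <- RtoC_mult, Hst, <- RtoC_plus, <- RtoC_div by lra.
    f_equal; rewrite S_INR; fold m; unfold t; field; lra. }
  destruct (Rle_dec 0 t).
  - exists 1; split; auto; apply Hs; rewrite Rabs_pos_eq; lra.
  - exists (-1); split; auto; apply Hs; rewrite Rabs_left; lra.
Qed.

Lemma hol_punct_derive (u : C -> C) (p : C) (r : R) : hol_punct u p r -> hol_punct (C_derive u) p r.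
Proof.
  intros Hu z Hz; destruct (punctured_disc_open p z r Hz) as [d [Hd Hin]].
  apply (hol_derive u z d); [|rewrite Cmod_diag; lra].
  intros w Hw; apply Hu; auto.
Qed.

(* If the difference of two solutions with the same principal part had order [m] at the pole,
   then [m + 1] would be a Fuchs index. *)
Lemma laurent_unique (A B al be ga de : R) (u v G H : C -> C) (p : C) (r : R) :
  A + 2 * B <> 0 ->
  (forall (s : R), (s = 1 \/ s = -1) -> forall n : nat, fuchs_index A B s <> RtoC (INR n)) ->
  0 < r -> hol G p r -> hol H p r ->
  G p = RtoC (- 6 / (A + 2 * B)) -> H p = RtoC (- 6 / (A + 2 * B)) ->
  (forall z, 0 < Cmod (z - p) < r -> u z = (G z / (z - p))%C) ->
  (forall z, 0 < Cmod (z - p) < r -> v z = (H z / (z - p))%C) ->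
  (forall z, 0 < Cmod (z - p) < r -> ode_at A B al be ga de u z) ->
  (forall z, 0 < Cmod (z - p) < r -> ode_at A B al be ga de v z) ->
  near p (fun z => u z = v z).
Proof.
  intros H2 Hiii Hr HG HH HGp HHp HuG HvH Hou Hov.
  set (rho := - 6 / (A + 2 * B)) in *.
  assert (Hu0 : forall z, 0 < Cmod (z - p) < r -> u z = (G z * (z - p) ^ 0 / (z - p) ^ 1)%C).
  { intros z Hz; rewrite HuG by auto; simpl; field; apply Cmod_gt_0; lra. }
  assert (Hv0 : forall z, 0 < Cmod (z - p) < r -> v z = (H z * (z - p) ^ 0 / (z - p) ^ 1)%C).
  { intros z Hz; rewrite HvH by auto; simpl; field; apply Cmod_gt_0; lra. }
  set (a := dquot G p (C_derive G p)); set (b := dquot H p (C_derive H p)).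
  assert (Ha : hol a p r) by (now apply hol_dquot); assert (Hb : hol b p r) by (now apply hol_dquot).
  assert (Huv : forall z, 0 < Cmod (z - p) < r -> (u z - v z)%C = (a z - b z)%C).
  { intros z Hz; rewrite HuG, HvH by auto.
    rewrite (dquot_eq G p (C_derive G p) z), (dquot_eq H p (C_derive H p) z), HGp, HHp.
    fold a b; field; apply Cmod_gt_0; lra. }
  destruct (hol_factor (fun z => a z - b z)%C p r Hr) as [Hz | (m & W0 & HW0 & HWp & HWf)].
  { now apply hol_minus. }
  { exists (r / 4); split; [lra|]; intros z Hz'; apply Cminus_diag_eq; rewrite Huv by lra; apply Hz; lra. }
  exfalso.
  set (w := fun z => (u z - v z)%C).
  assert (Hw0 : forall z, 0 < Cmod (z - p) < r -> w z = (W0 z * (z - p) ^ m / (z - p) ^ 0)%C).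
  { intros z Hz; unfold w; rewrite Huv, HWf by lra; simpl; field. }
  assert (Pu : hol_punct u p r) by exact (laurent_hol_punct u G p r _ _ HG Hu0).
  assert (Pv : hol_punct v p r) by exact (laurent_hol_punct v H p r _ _ HH Hv0).
  set (G1 := laurent_step G p 0 1); assert (HG1 : hol G1 p r) by (unfold G1; hol_tac).
  assert (Hu1 : forall z, 0 < Cmod (z - p) < r -> D1 u z = (G1 z * (z - p) ^ 0 / (z - p) ^ 2)%C).
  { intros z Hz; apply (laurent_derive u G p r); auto. }
  set (H1 := laurent_step H p 0 1); assert (HH1 : hol H1 p r) by (unfold H1; hol_tac).
  assert (Hv1 : forall z, 0 < Cmod (z - p) < r -> D1 v z = (H1 z * (z - p) ^ 0 / (z - p) ^ 2)%C).
  { intros z Hz; apply (laurent_derive v H p r); auto. }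
  set (H2' := laurent_step H1 p 0 2); assert (HH2 : hol H2' p r) by (unfold H2'; hol_tac).
  assert (Hv2 : forall z, 0 < Cmod (z - p) < r -> D2 v z = (H2' z * (z - p) ^ 0 / (z - p) ^ 3)%C).
  { intros z Hz; apply (laurent_derive (D1 v) H1 p r); auto. }
  set (W1 := laurent_step W0 p m 0); assert (HW1 : hol W1 p r) by (unfold W1; hol_tac).
  assert (Hw1 : forall z, 0 < Cmod (z - p) < r -> D1 w z = (W1 z * (z - p) ^ m / (z - p) ^ 1)%C).
  { intros z Hz; apply (laurent_derive w W0 p r); auto. }
  set (W2 := laurent_step W1 p m 1); assert (HW2 : hol W2 p r) by (unfold W2; hol_tac).
  assert (Hw2 : forall z, 0 < Cmod (z - p) < r -> D2 w z = (W2 z * (z - p) ^ m / (z - p) ^ 2)%C).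
  { intros z Hz; apply (laurent_derive (D1 w) W1 p r); auto. }
  set (W3 := laurent_step W2 p m 2); assert (HW3 : hol W3 p r) by (unfold W3; hol_tac).
  assert (Hw3 : forall z, 0 < Cmod (z - p) < r -> D3 w z = (W3 z * (z - p) ^ m / (z - p) ^ 3)%C).
  { intros z Hz; apply (laurent_derive (D2 w) W2 p r); auto. }
  assert (D1w : forall z, 0 < Cmod (z - p) < r -> D1 w z = (D1 u z - D1 v z)%C).
  { apply C_derive_minus_punct; auto. }
  assert (D2w : forall z, 0 < Cmod (z - p) < r -> D2 w z = (D2 u z - D2 v z)%C).
  { apply (C_derive_minus_punct (D1 u) (D1 v) (D1 w)); auto; now apply hol_punct_derive. }
  assert (D3w : forall z, 0 < Cmod (z - p) < r -> D3 w z = (D3 u z - D3 v z)%C).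
  { apply (C_derive_minus_punct (D2 u) (D2 v) (D2 w)); auto; now repeat apply hol_punct_derive. }
  (* The difference of the two equations is linear in [w = u - v]: u'^2 - v'^2 = (u' + v') w' and u
     u'' - v v'' = u w'' + w v''. Multiplied by [(z - p) ^ 3 / (z - p) ^ m], it becomes
     holomorphic. *)
  set (E := fun z => (RtoC A * (G1 z + H1 z) * W1 z + RtoC B * (G z * W2 z + W0 z * H2' z)
     - (W3 z + RtoC al * (z - p) ^ 1 * W2 z + RtoC be * (z - p) ^ 2 * W1 z + RtoC ga * (z - p) ^ 3 * W0 z))%C).
  assert (HE : E p = 0%C).
  { apply (hol_zero_center E p r Hr); [unfold E; hol_tac|].
    intros z Hz; assert (Hx : (z - p)%C <> 0%C) by (apply Cmod_gt_0; lra).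
    pose proof (Cpow_neq0 _ m Hx) as HY.
    specialize (Hou z Hz); specialize (Hov z Hz); unfold ode_at in Hou, Hov.
    assert (HD : (RtoC A * (D1 u z + D1 v z) * D1 w z + RtoC B * (u z * D2 w z + w z * D2 v z)
       - (D3 w z + RtoC al * D2 w z + RtoC be * D1 w z + RtoC ga * w z) = 0)%C).
    { rewrite D1w, D2w, D3w by auto; unfold w.
      match type of Hou with ?l1 = ?r1 => match type of Hov with ?l2 = ?r2 =>
        transitivity ((l1 - r1) - (l2 - r2))%C end end; [ring | rewrite Hou, Hov; ring]. }
    rewrite Hu0, Hu1, Hv1, Hv2, Hw0, Hw1, Hw2, Hw3 in HD by auto; simpl in HD.
    unfold E; simpl; set (x := (z - p)%C) in *; set (Y := (x ^ m)%C) in *.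
    match type of HD with ?l = _ => transitivity (x * x * x / Y * l)%C end;
      [field; auto | rewrite HD; ring]. }
  set (c := INR m).
  assert (EG1 : G1 p = RtoC (- rho)).
  { unfold G1; rewrite laurent_step_center, HGp, <- RtoC_mult; f_equal; simpl; ring. }
  assert (EH1 : H1 p = RtoC (- rho)).
  { unfold H1; rewrite laurent_step_center, HHp, <- RtoC_mult; f_equal; simpl; ring. }
  assert (EH2 : H2' p = RtoC (2 * rho)).
  { unfold H2'; rewrite laurent_step_center, EH1, <- RtoC_mult; f_equal; simpl; ring. }
  assert (EW1 : W1 p = (RtoC c * W0 p)%C).
  { unfold W1; rewrite laurent_step_center; f_equal; f_equal; simpl; fold c; ring. }
  assert (EW2 : W2 p = (RtoC ((c - 1) * c) * W0 p)%C).
  { unfold W2; rewrite laurent_step_center, EW1, Cmult_assoc, <- RtoC_mult; f_equal; f_equal; simpl; fold c; ring. }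
  assert (EW3 : W3 p = (RtoC ((c - 2) * ((c - 1) * c)) * W0 p)%C).
  { unfold W3; rewrite laurent_step_center, EW2, Cmult_assoc, <- RtoC_mult; f_equal; f_equal; simpl; fold c; ring. }
  assert (HX : (RtoC (A * (- rho + - rho) * c + B * (rho * ((c - 1) * c) + 2 * rho) - (c - 2) * ((c - 1) * c)) * W0 p)%C = 0%C).
  { rewrite <- HE; unfold E; rewrite EG1, EH1, EH2, EW1, EW2, EW3, HGp.
    rewrite ?RtoC_minus, ?RtoC_plus, ?RtoC_mult, ?RtoC_minus, ?RtoC_plus, ?RtoC_mult, ?RtoC_minus; simpl; ring. }
  assert (HX2 : A * (- rho + - rho) * c + B * (rho * ((c - 1) * c) + 2 * rho) - (c - 2) * ((c - 1) * c) = 0).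
  { apply NNPP; intros Hq; refine (Cmult_neq_0 _ _ _ HWp HX); intros Heq; apply RtoC_inj in Heq; auto. }
  destruct (fuchs_index_of_root A B m H2) as [s [Hs Hf]].
  - fold c; assert (Hc : 0 <= c) by apply pos_INR.
    assert (Hrho : rho * (A + 2 * B) = - 6) by (unfold rho; field; auto).
    (* The cubic indicial polynomial splits off [c + 2], which is nonzero because the order [c] is
       nonnegative. *)
    assert (HP : (c + 2) * ((A + 2 * B) * c ^ 2 - (5 * A + 4 * B) * c + 6 * B) = 0).
    { transitivity (- ((A * (- rho + - rho) * c + B * (rho * ((c - 1) * c) + 2 * rho) - (c - 2) * ((c - 1) * c)) * (A + 2 * B))).
      - transitivity (- ((rho * (A + 2 * B)) * (A * (- 2) * c + B * ((c - 1) * c + 2)) - (c - 2) * ((c - 1) * c) * (A + 2 * B))).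
        + rewrite Hrho; ring.
        + ring.
      - rewrite HX2; ring. }
    apply Rmult_integral in HP; destruct HP; lra.
  - apply (Hiii s Hs (S m) Hf).
Qed.

(** * Growth of solutions away from poles *)

(** The bound holds on the whole half disc, so the estimate can be iterated for higher derivatives
    on successively halved discs. *)
Lemma cauchy_estimate_disc (f : C -> C) (a : C) (r M : R) : 0 < r -> hol f a r ->
  (forall w, Cmod (w - a) < r -> Cmod (f w) <= M) ->
  forall w, Cmod (w - a) < r / 2 -> Cmod (C_derive f w) <= 8 * M / r.
Proof.
  intros Hr Hf HM w Hw; replace (8 * M / r) with (2 * M / (r / 4)) by (field; lra).
  apply (cauchy_estimate f w (r / 2)); [apply (hol_sub f a w r); auto; lra | lra |].
  intros y Hy; apply HM; pose proof (Cmod_tri y w a); lra.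
Qed.

Lemma C_derive_ext_disc (f g : C -> C) (a : C) (r : R) : hol g a r ->
  (forall w, Cmod (w - a) < r -> f w = g w) ->
  forall w, Cmod (w - a) < r -> C_derive f w = C_derive g w.
Proof.
  intros Hg E w Hw; apply C_derive_cder.
  apply (cder_ext_ball g f w _ (r - Cmod (w - a))); [lra| |eapply hol_cder; eauto].
  intros y Hy; symmetry; apply E; pose proof (Cmod_tri y w a); lra.
Qed.

(** Differentiation conjugated by [exp (k w)]: the derivative of [P * exp (k w)] is
    [twist k P * exp (k w)]. *)
Definition twist (k : C) (P : C -> C) (w : C) : C := (C_derive P w + k * P w)%C.

Lemma hol_twist (k : C) (P : C -> C) (a : C) (r : R) : hol P a r -> hol (twist k P) a r.
Proof.
  intros HP; apply hol_plus; [now apply hol_derive | apply hol_mult; auto; apply hol_const].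
Qed.

Lemma derive_twist (k : C) (P : C -> C) (a : C) (r : R) : hol P a r ->
  forall w, Cmod (w - a) < r -> C_derive (twist k P) w = twist k (C_derive P) w.
Proof.
  intros HP w Hw; apply C_derive_cder; apply cder_plus.
  - apply (hol_cder _ a r); auto; now apply hol_derive.
  - apply cder_scal, (hol_cder _ a r); auto.
Qed.

Lemma cder_exp_affine (k a w : C) : cder (fun w => Cexp (k * (w - a)))%C w (k * Cexp (k * (w - a)))%C.
Proof.
  eapply cder_eq; [|apply (cder_comp Cexp (fun w => k * (w - a))%C)]; [|apply cder_scal, cder_sub_const | apply cder_Cexp].
  simpl; ring.
Qed.

Lemma derive_exp_twist (f P : C -> C) (U k a : C) (r : R) : hol P a r ->
  (forall w, Cmod (w - a) < r -> f w = (U * P w * Cexp (k * (w - a)))%C) ->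
  forall w, Cmod (w - a) < r -> C_derive f w = (U * twist k P w * Cexp (k * (w - a)))%C.
Proof.
  intros HP E w Hw; apply C_derive_cder.
  apply (cder_ext_ball (fun w => U * P w * Cexp (k * (w - a)))%C _ _ _ (r - Cmod (w - a))); [lra| |].
  - intros y Hy; symmetry; apply E; pose proof (Cmod_tri y w a); lra.
  - eapply cder_eq; [|apply cder_mult; [apply cder_scal, (hol_cder P a r) | apply cder_exp_affine]]; auto.
    unfold twist; simpl; ring.
Qed.

Lemma exp_twist_derivatives (u F : C -> C) (U k z : C) (h : R) : 0 < h -> hol F z h -> F z = 1%C ->
  (forall w, Cmod (w - z) < h -> u w = (U * F w * Cexp (k * (w - z)))%C) ->
  let c1 := C_derive F z in let c2 := C_derive (C_derive F) z in
  let c3 := C_derive (C_derive (C_derive F)) z in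
  D1 u z = (U * (c1 + k))%C /\ D2 u z = (U * (c2 + 2 * k * c1 + k * k))%C /\
  D3 u z = (U * (c3 + 3 * k * c2 + 3 * k * k * c1 + k * k * k))%C.
Proof.
  intros Hh HF HF1 Hu c1 c2 c3.
  assert (Hz : Cmod (z - z) < h) by (rewrite Cmod_diag; lra).
  assert (HF' : hol (C_derive F) z h) by (now apply hol_derive).
  assert (HF2 : hol (C_derive (C_derive F)) z h) by (now apply hol_derive).
  assert (HT1 : hol (twist k F) z h) by (now apply hol_twist).
  assert (HT2 : hol (twist k (twist k F)) z h) by (now apply hol_twist).
  pose proof (derive_exp_twist u F U k z h HF Hu) as E1.
  pose proof (derive_exp_twist _ _ U k z h HT1 E1) as E2.
  pose proof (derive_exp_twist _ _ U k z h HT2 E2) as E3.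
  assert (T1 : twist k F z = (c1 + k)%C) by (unfold twist; rewrite HF1; fold c1; ring).
  assert (T1' : C_derive (twist k F) z = (c2 + k * c1)%C).
  { rewrite (derive_twist k F z h) by auto; reflexivity. }
  assert (T1'' : C_derive (C_derive (twist k F)) z = (c3 + k * c2)%C).
  { rewrite (C_derive_ext_disc _ (twist k (C_derive F)) z h); auto.
    - rewrite (derive_twist k (C_derive F) z h) by auto; reflexivity.
    - now apply hol_twist.
    - apply derive_twist; auto. }
  assert (T2 : twist k (twist k F) z = (c2 + 2 * k * c1 + k * k)%C).
  { unfold twist at 1; rewrite T1', T1; ring. }
  assert (T2' : C_derive (twist k (twist k F)) z = (c3 + 2 * k * c2 + k * k * c1)%C).
  { rewrite (derive_twist k (twist k F) z h) by auto; unfold twist at 1; rewrite T1'', T1'; ring. }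
  assert (X : Cexp (k * (z - z)) = 1%C) by (replace (k * (z - z))%C with (RtoC 0) by ring; apply Cexp_0).
  unfold D1, D2, D3; rewrite E1, E2, E3, X by auto.
  assert (T3 : twist k (twist k (twist k F)) z =
    (C_derive (twist k (twist k F)) z + k * twist k (twist k F) z)%C) by reflexivity.
  rewrite T3, T2', T2, T1; repeat split; ring.
Qed.

(* Where [u] behaves like [exp (k w)] on a disc of radius [h] with [|k| h] large, the terms of
   degree two dominate the equation unless [u] is small. *)
Lemma exponential_regime_bound (A B al be ga de Q : R) : A + B <> 0 -> 0 <= Q ->
  exists n : nat, (8 <= n)%nat /\ exists K0, 0 <= K0 /\
  forall (u : C -> C) (z e : C) (d : R), 0 < d -> Cmod e = 1 -> hol u z (d / INR n) ->
    ode_at A B al be ga de u z -> 1 <= Cmod (u z) ->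
    (forall s, Cmod s < d / INR n ->
       Cmod (u (z + s)%C) <= Q * Cmod (u z) * exp (INR n ^ 2 / d * Re (e * s))) ->
    Cmod (u z) <= K0 * (/ d + 1 + d + d ^ 2).
Proof.
  intros HAB HQ.
  assert (HAB' : 0 < Rabs (A + B)) by now apply Rabs_pos_lt.
  pose proof (Rabs_pos A) as HA0; pose proof (Rabs_pos B) as HB0.
  (* Threshold for the relative error: it makes [(Rabs A + Rabs B) * (3 * t)] at most half of
     [Rabs (A + B)], so the leading coefficient cannot be cancelled. *)
  set (t := Rabs (A + B) / (6 * (Rabs A + Rabs B + 1))).
  assert (Ht : 0 < t) by (apply Rdiv_lt_0_compat; lra).
  (* 4096 = 8 * 16 * 32 is the product of the constants in three Cauchy estimates on discs of radius
     [h], [h / 2] and [h / 4]. This [n] makes the error [4096 * Q / n] at most 1 and at most [t]. *)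
  destruct (INR_unbounded (8 + 4096 * Q + 4096 * Q / t)) as [n Hn].
  assert (HQt : 0 <= 4096 * Q / t) by (apply Rdiv_le_0_compat; lra).
  exists n; split; [apply INR_le; simpl; lra|].
  set (nn := INR n) in *; assert (Hnn : 8 < nn) by lra.
  set (eta := 4096 * Q / nn).
  assert (He0 : 0 <= eta) by (apply Rdiv_le_0_compat; lra).
  assert (He1 : eta <= 1).
  { unfold eta; apply (Rmult_le_reg_r nn); [lra|]; unfold Rdiv; rewrite Rmult_assoc, Rinv_l; lra. }
  assert (Het : eta <= t).
  { unfold eta; apply (Rmult_le_reg_r nn); [lra|]; unfold Rdiv; rewrite Rmult_assoc, Rinv_l, Rmult_1_r by lra.
    assert (4096 * Q / t * t = 4096 * Q) by (field; lra); nra. }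
  set (L := 8 * nn ^ 2 + 4 * Rabs al + 2 * Rabs be / nn ^ 2 + (Rabs ga + Rabs de) / nn ^ 4).
  assert (Hn2 : 0 < nn ^ 2) by (apply pow_lt; lra).
  assert (Hn4 : 0 < nn ^ 4) by (apply pow_lt; lra).
  pose proof (Rabs_pos al); pose proof (Rabs_pos be); pose proof (Rabs_pos ga); pose proof (Rabs_pos de).
  assert (HL1 : 0 <= 2 * Rabs be / nn ^ 2) by (apply Rdiv_le_0_compat; lra).
  assert (HL2 : 0 <= (Rabs ga + Rabs de) / nn ^ 4) by (apply Rdiv_le_0_compat; lra).
  assert (HL : 0 <= L) by (unfold L; nra).
  exists (2 * L / Rabs (A + B)); split; [apply Rdiv_le_0_compat; lra|].
  intros u z e d Hd He Hu Hode HU Hbnd.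
  set (h := d / nn) in *; assert (Hh : 0 < h) by (apply Rdiv_lt_0_compat; lra).
  set (K := nn ^ 2 / d) in *; assert (HK : 0 < K) by (apply Rdiv_lt_0_compat; lra).
  set (k := (RtoC K * e)%C); set (U := u z) in *.
  assert (Hk : Cmod k = K) by (unfold k; rewrite Cmod_mult, Cmod_R, He, Rabs_pos_eq; lra).
  assert (HU0 : U <> 0%C) by (apply Cmod_gt_0; lra).
  (* Dividing out the model exponential leaves a function with value 1 at [z], bounded by [Q] on the
     disc. Since [K * h = n], its derivatives are small compared with powers of [K]. *)
  set (F := fun w => (/ U * u w * Cexp ((- k) * (w - z)))%C).
  assert (HF : hol F z h).
  { apply hol_mult; [apply hol_mult; auto; apply hol_const|].
    intros w _; eexists; apply cder_exp_affine. }
  assert (HFz : F z = 1%C).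
  { unfold F; fold U; replace (- k * (z - z))%C with (RtoC 0) by ring; rewrite Cexp_0; field; auto. }
  assert (HuF : forall w, Cmod (w - z) < h -> u w = (U * F w * Cexp (k * (w - z)))%C).
  { intros w _; unfold F; transitivity (u w * (Cexp (- k * (w - z)) * Cexp (k * (w - z))))%C; [|field; auto].
    rewrite <- Cexp_plus; replace (- k * (w - z) + k * (w - z))%C with (RtoC 0) by ring; rewrite Cexp_0; ring. }
  assert (HFb : forall w, Cmod (w - z) < h -> Cmod (F w) <= Q).
  { intros w Hw; unfold F; rewrite !Cmod_mult, Cmod_inv, Cmod_Cexp by auto.
    specialize (Hbnd (w - z)%C Hw); replace (z + (w - z))%C with w in Hbnd by ring.
    assert (Er : fst (- k * (w - z))%C = - (K * Re (e * (w - z)))) by (unfold k, Re; destruct e, w, z; simpl; ring).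
    rewrite Er, exp_Ropp; set (X := exp (K * Re (e * (w - z)))) in *.
    assert (HX : 0 < X) by apply exp_pos.
    apply (Rmult_le_reg_r (Cmod U * X)); [apply Rmult_lt_0_compat; lra|].
    replace (/ Cmod U * Cmod (u w) * / X * (Cmod U * X)) with (Cmod (u w)) by (field; lra); lra. }
  destruct (exp_twist_derivatives u F U k z h Hh HF HFz HuF) as (E1 & E2 & E3).
  set (c1 := C_derive F z) in *; set (c2 := C_derive (C_derive F) z) in *;
  set (c3 := C_derive (C_derive (C_derive F)) z) in *.
  pose proof (cauchy_estimate_disc F z h Q Hh HF HFb) as B1.
  pose proof (cauchy_estimate_disc (C_derive F) z (h / 2) _ ltac:(lra)
    (hol_mono (C_derive F) z h (h / 2) ltac:(lra) (hol_derive _ _ _ HF)) B1) as B2.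
  pose proof (cauchy_estimate_disc (C_derive (C_derive F)) z (h / 2 / 2) _ ltac:(lra)
    (hol_mono (C_derive (C_derive F)) z h (h / 2 / 2) ltac:(lra) (hol_derive _ _ _ (hol_derive _ _ _ HF))) B2) as B3.
  specialize (B1 z ltac:(rewrite Cmod_diag; lra)); specialize (B2 z ltac:(rewrite Cmod_diag; lra));
  specialize (B3 z ltac:(rewrite Cmod_diag; lra)).
  fold c1 in B1; fold c2 in B2; fold c3 in B3.
  assert (Hih : / h = K / nn) by (unfold h, K; field; lra).
  assert (Hin : 0 <= / nn <= 1).
  { split; [left; apply Rinv_0_lt_compat; lra|]; rewrite <- Rinv_1; apply Rinv_le_contravar; lra. }
  assert (B1' : Cmod c1 <= eta * K).
  { eapply Rle_trans; [apply B1|]; replace (8 * Q / h) with (8 * Q * (K / nn)) by (rewrite <- Hih; reflexivity).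
    replace (eta * K) with (4096 * Q * (K / nn)) by (unfold eta; field; lra).
    apply Rmult_le_compat_r; [apply Rdiv_le_0_compat; lra | lra]. }
  assert (B2' : Cmod c2 <= eta * K ^ 2).
  { eapply Rle_trans; [apply B2|].
    replace (8 * (8 * Q / h) / (h / 2)) with (128 * Q * (/ h * / h)) by (field; lra); rewrite Hih.
    replace (128 * Q * (K / nn * (K / nn))) with ((128 * Q * K ^ 2 * / nn) * / nn) by (field; lra).
    replace (eta * K ^ 2) with ((4096 * Q * K ^ 2 * / nn) * 1) by (unfold eta; field; lra).
    assert (0 <= Q * K ^ 2) by (apply Rmult_le_pos; [lra | apply pow2_ge_0]).
    apply Rmult_le_compat; try lra; [apply Rmult_le_pos; lra|]; apply Rmult_le_compat_r; lra. }
  assert (B3' : Cmod c3 <= eta * K ^ 3).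
  { eapply Rle_trans; [apply B3|].
    replace (8 * (8 * (8 * Q / h) / (h / 2)) / (h / 2 / 2)) with (4096 * Q * (/ h * / h * / h)) by (field; lra); rewrite Hih.
    replace (4096 * Q * (K / nn * (K / nn) * (K / nn))) with ((4096 * Q * K ^ 3 * / nn) * (/ nn * / nn)) by (field; lra).
    replace (eta * K ^ 3) with ((4096 * Q * K ^ 3 * / nn) * 1) by (unfold eta; field; lra).
    assert (0 <= K ^ 3) by (apply pow_le; lra).
    apply Rmult_le_compat_l; [|nra]; apply Rmult_le_pos; [|lra]; apply Rmult_le_pos; [lra|auto]. }
  unfold ode_at in Hode; rewrite E1, E2, E3 in Hode; fold U in Hode.
  set (X2 := (RtoC A * (c1 * (c1 + 2 * k)) + RtoC B * (c2 + 2 * k * c1))%C).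
  set (Y := (c3 + 3 * k * c2 + 3 * k * k * c1 + k * k * k + RtoC al * (c2 + 2 * k * c1 + k * k)
     + RtoC be * (c1 + k) + RtoC ga)%C).
  (* The main term (A + B) k^2 U^2 is isolated on the left; [X2] collects everything that contains a
     derivative of [F]. *)
  assert (EQ : (U * U * (RtoC (A + B) * (k * k) + X2))%C = (U * Y + RtoC de)%C).
  { unfold X2, Y; rewrite RtoC_plus.
    match type of Hode with ?l = ?r => transitivity l; [ring | rewrite Hode; ring] end. }
  assert (N2 : Cmod (RtoC 2) = 2) by (rewrite Cmod_R, Rabs_pos_eq; lra).
  assert (N3 : Cmod (RtoC 3) = 3) by (rewrite Cmod_R, Rabs_pos_eq; lra).
  assert (Hc2k : Cmod (c2 + 2 * k * c1) <= 3 * eta * K ^ 2).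
  { eapply Rle_trans; [apply Cmod_triangle|]; rewrite !Cmod_mult, N2, Hk; nra. }
  assert (BX : Cmod X2 <= Rabs (A + B) / 2 * K ^ 2).
  { unfold X2; eapply Rle_trans; [apply Cmod_triangle|]; rewrite !(Cmod_mult (RtoC _)), !Cmod_R.
    assert (Hc1 : Cmod (c1 * (c1 + 2 * k)) <= 3 * eta * K ^ 2).
    { rewrite Cmod_mult; pose proof (Cmod_triangle c1 (2 * k)) as T; rewrite Cmod_mult, N2, Hk in T.
      pose proof (Cmod_ge_0 c1); pose proof (Cmod_ge_0 (c1 + 2 * k)).
      apply Rle_trans with ((eta * K) * (3 * K)); [|nra].
      apply Rmult_le_compat; auto; nra. }
    assert (HS : (Rabs A + Rabs B) * (3 * eta * K ^ 2) <= Rabs (A + B) / 2 * K ^ 2).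
    { assert (HK2 : 0 <= K ^ 2) by apply pow2_ge_0.
      assert (Ht2 : (Rabs A + Rabs B) * (3 * t) <= Rabs (A + B) / 2).
      { assert (Ex : t * (6 * (Rabs A + Rabs B + 1)) = Rabs (A + B)) by (unfold t; field; lra); nra. }
      apply Rle_trans with ((Rabs A + Rabs B) * (3 * t) * K ^ 2); [|apply Rmult_le_compat_r; auto].
      replace ((Rabs A + Rabs B) * (3 * eta * K ^ 2)) with ((Rabs A + Rabs B) * (3 * eta) * K ^ 2) by ring.
      apply Rmult_le_compat_r; auto; apply Rmult_le_compat_l; lra. }
    eapply Rle_trans; [apply Rplus_le_compat; apply Rmult_le_compat_l; eauto|]; lra. }
  assert (BY : Cmod Y <= 8 * K ^ 3 + 4 * Rabs al * K ^ 2 + 2 * Rabs be * K + Rabs ga).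
  { unfold Y.
    eapply Rle_trans; [apply Cmod_triangle|]; rewrite Cmod_R; apply Rplus_le_compat; [|lra].
    eapply Rle_trans; [apply Cmod_triangle|]; rewrite Cmod_mult, Cmod_R; apply Rplus_le_compat.
    2:{ pose proof (Cmod_triangle c1 k) as T; rewrite Hk in T.
        replace (2 * Rabs be * K) with (Rabs be * (2 * K)) by ring; apply Rmult_le_compat_l; nra. }
    eapply Rle_trans; [apply Cmod_triangle|]; rewrite Cmod_mult, Cmod_R; apply Rplus_le_compat.
    2:{ pose proof (Cmod_triangle (c2 + 2 * k * c1) (k * k)) as T; rewrite (Cmod_mult k k), Hk in T.
        replace (4 * Rabs al * K ^ 2) with (Rabs al * (4 * K ^ 2)) by ring; apply Rmult_le_compat_l; nra. }
    eapply Rle_trans; [apply Cmod_triangle|]; eapply Rle_trans; [apply Rplus_le_compat_r, Cmod_triangle|].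
    eapply Rle_trans; [apply Rplus_le_compat_r, Rplus_le_compat_r, Cmod_triangle|].
    rewrite !Cmod_mult, N3, Hk.
    assert (K * Cmod c2 <= K * (eta * K ^ 2)) by (apply Rmult_le_compat_l; lra).
    assert (K * K * Cmod c1 <= K * K * (eta * K)) by (apply Rmult_le_compat_l; nra).
    assert (0 <= K ^ 3) by (apply pow_le; lra).
    assert (eta * K ^ 3 <= K ^ 3) by nra.
    nra. }
  assert (BL : Rabs (A + B) / 2 * K ^ 2 <= Cmod (RtoC (A + B) * (k * k) + X2)).
  { assert (T : Cmod (RtoC (A + B) * (k * k)) <= Cmod (RtoC (A + B) * (k * k) + X2) + Cmod X2).
    { replace (RtoC (A + B) * (k * k))%C with ((RtoC (A + B) * (k * k) + X2) + - X2)%C at 1 by ring.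
      eapply Rle_trans; [apply Cmod_triangle|]; rewrite Cmod_opp; lra. }
    rewrite !Cmod_mult, Cmod_R, Hk in T; nra. }
  apply (f_equal Cmod) in EQ; rewrite !Cmod_mult in EQ.
  set (V := Cmod U) in *.
  pose proof (Cmod_triangle (U * Y) (RtoC de)) as T; rewrite Cmod_mult, Cmod_R in T; fold V in T.
  rewrite <- EQ in T.
  set (Z := 8 * K ^ 3 + 4 * Rabs al * K ^ 2 + 2 * Rabs be * K + Rabs ga) in *.
  (* Here [1 <= V] absorbs the constant term [de], so that one factor [V] can be cancelled. *)
  assert (T2 : V * V * (Rabs (A + B) / 2 * K ^ 2) <= V * (Z + Rabs de)).
  { apply Rle_trans with (V * V * Cmod (RtoC (A + B) * (k * k) + X2)).
    - apply Rmult_le_compat_l; nra.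
    - eapply Rle_trans; [apply T|].
      assert (V * Cmod Y <= V * Z) by (apply Rmult_le_compat_l; lra).
      assert (Rabs de <= V * Rabs de) by nra; lra. }
  assert (T3 : V * (Rabs (A + B) / 2 * K ^ 2) <= Z + Rabs de).
  { apply (Rmult_le_reg_l V); [lra|]; rewrite <- Rmult_assoc; exact T2. }
  assert (HK2 : 0 < K ^ 2) by (apply pow_lt; lra).
  assert (T4 : V <= 2 / Rabs (A + B) * (8 * K + 4 * Rabs al + 2 * Rabs be / K + (Rabs ga + Rabs de) / K ^ 2)).
  { apply (Rmult_le_reg_r (Rabs (A + B) / 2 * K ^ 2)); [apply Rmult_lt_0_compat; lra|].
    eapply Rle_trans; [apply T3|]; right; unfold Z; field; lra. }
  eapply Rle_trans; [apply T4|].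
  replace (2 * L / Rabs (A + B) * (/ d + 1 + d + d ^ 2)) with (2 / Rabs (A + B) * (L * (/ d + 1 + d + d ^ 2)))
    by (field; lra).
  apply Rmult_le_compat_l; [apply Rdiv_le_0_compat; lra|].
  assert (Hid : 0 < / d) by now apply Rinv_0_lt_compat.
  replace (8 * K) with (8 * nn ^ 2 * / d) by (unfold K; field; lra).
  replace (2 * Rabs be / K) with (2 * Rabs be / nn ^ 2 * d) by (unfold K; field; lra).
  replace ((Rabs ga + Rabs de) / K ^ 2) with ((Rabs ga + Rabs de) / nn ^ 4 * d ^ 2) by (unfold K; field; lra).
  assert (Hd2 : 0 < d ^ 2) by (apply pow_lt; lra).
  set (l1 := 2 * Rabs be / nn ^ 2) in *; set (l2 := (Rabs ga + Rabs de) / nn ^ 4) in *.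
  set (l3 := 8 * nn ^ 2) in *; set (l4 := 4 * Rabs al) in *.
  assert (0 <= l3) by (unfold l3; lra); assert (0 <= l4) by (unfold l4; lra).
  unfold L.
  assert (l3 * / d <= (l3 + l4 + l1 + l2) * / d) by (apply Rmult_le_compat_r; lra).
  assert (l1 * d <= (l3 + l4 + l1 + l2) * d) by (apply Rmult_le_compat_r; lra).
  assert (l2 * d ^ 2 <= (l3 + l4 + l1 + l2) * d ^ 2) by (apply Rmult_le_compat_r; lra).
  lra.
Qed.

(** Any point whose value exceeds half the supremum will do. An attained maximum would need
    closedness and continuity, and the factor 2 only enters the constant [Q] of the exponential
    regime. *)
Lemma almost_max (g : C -> R) (Q : C -> Prop) (M : R) (z1 : C) :
  Q z1 -> 0 < g z1 -> (forall z, Q z -> g z <= M) ->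
  exists z0, Q z0 /\ 0 < g z0 /\ forall z, Q z -> g z <= 2 * g z0.
Proof.
  intros H1 Hg HM.
  destruct (completeness (fun y => exists z, Q z /\ y = g z)) as [s [Hs1 Hs2]].
  - exists M; intros y [z [Hz ->]]; auto.
  - exists (g z1), z1; auto.
  - assert (Hs : g z1 <= s) by (apply Hs1; eauto).
    destruct (classic (exists z, Q z /\ s / 2 < g z)) as [[z0 [Hz0 Hz]]|Hn].
    + exists z0; repeat split; auto; [lra|]; intros z Hz'.
      assert (g z <= s) by (apply Hs1; eauto); lra.
    + assert (s <= s / 2); [|lra]; apply Hs2; intros y [z [Hz ->]].
      apply Rnot_lt_le; intros Hlt; apply Hn; eauto.
Qed.

(** Reduces to one factor, where (1 - q)(1 + q + 2 q^2) = 1 + q^2 (1 - 2 q) is at least 1. *)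
Lemma inv_pow_le_exp (q : R) (N : nat) : - (1 / 2) <= q <= 1 / 2 ->
  1 <= (1 - q) ^ N * exp (INR N * (q + 2 * q ^ 2)).
Proof.
  intros Hq.
  assert (H1 : 1 <= (1 - q) * exp (q + 2 * q ^ 2)).
  { assert (0 <= q ^ 2 * (1 - 2 * q)) by (apply Rmult_le_pos; [apply pow2_ge_0 | lra]).
    apply Rle_trans with ((1 - q) * (1 + (q + 2 * q ^ 2))); [nra|].
    apply Rmult_le_compat_l; [lra | apply exp_ineq1_le]. }
  induction N; [simpl; rewrite Rmult_0_l, exp_0; lra|].
  rewrite S_INR, Rmult_plus_distr_r, Rmult_1_l, exp_plus; simpl pow at 1.
  replace ((1 - q) * (1 - q) ^ N * (exp (INR N * (q + 2 * q ^ 2)) * exp (q + 2 * q ^ 2)))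
    with (((1 - q) ^ N * exp (INR N * (q + 2 * q ^ 2))) * ((1 - q) * exp (q + 2 * q ^ 2))) by ring.
  apply Rle_trans with (1 * 1); [lra|]; apply Rmult_le_compat; lra.
Qed.

(* Instantiated by [Cmod] and by [Re (e * z)] with [Cmod e = 1]. *)
Definition gauge (lam : C -> R) : Prop :=
  (forall z s, Rabs (lam (z + s)%C - lam z) <= Cmod s) /\
  (forall z, 0 < lam z -> exists e, Cmod e = 1 /\ forall s, Cmod s <= lam z ->
     lam (z + s)%C <= lam z + Re (e * s)%C + Cmod s ^ 2 / (2 * lam z)).

(* The weight [(X - lam z) ^ n ^ 2] forces [u] into the exponential regime near a point where
   the weighted modulus is almost maximal, unless that point has small [lam]. *)
Lemma growth_dichotomy (A B al be ga de : R) : A + B <> 0 ->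
  exists (N : nat) (K1 : R), 0 <= K1 /\
  forall (lam : C -> R) (u : C -> C) (r0 : R), gauge lam -> 0 < r0 ->
  (forall z, r0 <= lam z -> (exists l, cder u z l) /\ ode_at A B al be ga de u z) ->
  (forall X, exists M, forall z, r0 <= lam z <= X -> Cmod (u z) <= M) ->
  forall X, 1 <= X -> 8 * r0 <= X ->
  (forall z, r0 <= lam z <= X / 2 -> Cmod (u z) <= K1 * X ^ 2) \/
  (exists z0, r0 <= lam z0 <= X / 4 /\ forall z, r0 <= lam z <= X / 2 -> Cmod (u z) <= 2 ^ S N * Cmod (u z0)).
Proof.
  intros HAB; pose proof (exp_pos (7 / 2)) as He7.
  (* The factor 2 comes from [almost_max]. The exponent 7/2 is 2 from the quadratic error of the
     logarithm of the weight plus 3/2 from the curvature of the gauge. *)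
  destruct (exponential_regime_bound A B al be ga de (2 * exp (7 / 2)) HAB ltac:(lra)) as (n & Hn & K0 & HK0 & Hreg).
  set (N := (n * n)%nat).
  assert (Hn8 : 8 <= INR n) by (apply (le_INR 8) in Hn; simpl in Hn; lra).
  assert (HNn : INR N = INR n ^ 2) by (unfold N; rewrite mult_INR; ring).
  assert (H2N : 0 < 2 ^ N) by (apply pow_lt; lra).
  exists N, (8 * K0 * 2 ^ N + 2 ^ S N); split; [simpl; nra|].
  intros lam u r0 [L1 L2] Hr0 Hu Hbd X HX1 HX8.
  set (Q := fun z => r0 <= lam z <= X).
  set (W := fun z => Cmod (u z) * (X - lam z) ^ N).
  assert (HX2 : 1 <= X ^ 2) by nra.
  assert (HK1 : 0 <= 8 * K0 * 2 ^ N) by nra.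
  assert (HSN : 0 < 2 ^ S N) by (apply pow_lt; lra).
  (* If the weighted modulus vanishes throughout, so does [u] wherever [lam] lies below [X], and the
     first alternative is trivial. *)
  destruct (classic (exists z1, Q z1 /\ 0 < W z1)) as [[z1 [Hz1 HW1]]|Hno].
  2:{ left; intros z Hz; destruct (Rle_lt_dec (Cmod (u z)) 0) as [H|H]; [nra|].
      exfalso; apply Hno; exists z; split; [unfold Q; lra|].
      apply Rmult_lt_0_compat; auto; apply pow_lt; lra. }
  assert (HWb : exists M, forall z, Q z -> W z <= M).
  { destruct (Hbd X) as [M HM]; exists (M * X ^ N); intros z Hz; unfold Q in Hz.
    apply Rmult_le_compat; [apply Cmod_ge_0 | apply pow_le; lra | auto | apply pow_incr; lra]. }
  destruct HWb as [M HM].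
  destruct (almost_max W Q M z1 Hz1 HW1 HM) as (z0 & Hz0 & HWz0 & Hmax).
  unfold Q in Hz0; set (d := X - lam z0) in *.
  assert (Hd0 : 0 <= d) by (unfold d; lra).
  assert (Hhalf : forall z, r0 <= lam z <= X / 2 -> Cmod (u z) * (X / 2) ^ N <= 2 * (Cmod (u z0) * d ^ N)).
  { intros z Hz; eapply Rle_trans; [|apply (Hmax z); unfold Q; lra].
    apply Rmult_le_compat_l; [apply Cmod_ge_0|]; apply pow_incr; lra. }
  assert (HX2N : 0 < (X / 2) ^ N) by (apply pow_lt; lra).
  assert (HXN : X ^ N = 2 ^ N * (X / 2) ^ N) by (rewrite <- Rpow_mult_distr; f_equal; lra).
  assert (HdX : d ^ N <= X ^ N) by (apply pow_incr; unfold d; lra).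
  pose proof (Cmod_ge_0 (u z0)) as Hu0.
  assert (Hhalf2 : forall z, r0 <= lam z <= X / 2 -> Cmod (u z) <= 2 ^ S N * Cmod (u z0)).
  { intros z Hz; apply (Rmult_le_reg_r ((X / 2) ^ N)); auto.
    eapply Rle_trans; [now apply Hhalf|].
    replace (2 ^ S N * Cmod (u z0) * (X / 2) ^ N) with (2 * (Cmod (u z0) * X ^ N)) by (rewrite HXN; simpl; ring).
    apply Rmult_le_compat_l; [lra|]; apply Rmult_le_compat_l; auto. }
  destruct (Rle_lt_dec (lam z0) (X / 4)) as [Hsm|Hbig].
  { right; exists z0; split; [lra | auto]. }
  left; intros z Hz; destruct (Rlt_le_dec (Cmod (u z0)) 1) as [Hu1|Hu1].
  { specialize (Hhalf2 z Hz); nra. }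
  assert (Hd : 0 < d).
  { destruct Hd0 as [|E]; auto; exfalso; unfold W in HWz0; fold d in HWz0; rewrite <- E in HWz0.
    rewrite pow_i in HWz0 by (unfold N; nia); lra. }
  (* Together with [d < 3 * X / 4] and [X / 4 < lam z0] this keeps the disc of radius [d / n] inside
     [r0 <= lam <= X]; here [8 * r0 <= X] is used. It also gives [d < 3 * lam z0]. *)
  assert (Hdn : d / INR n <= d / 8).
  { apply Rmult_le_compat_l; [lra|]; apply Rinv_le_contravar; lra. }
  assert (Hdn0 : 0 < d / INR n) by (apply Rdiv_lt_0_compat; lra).
  assert (HdX' : d < 3 * X / 4) by (unfold d; lra).
  destruct (L2 z0 ltac:(lra)) as (e & He & Hle).
  assert (Hreg0 : Cmod (u z0) <= K0 * (/ d + 1 + d + d ^ 2)).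
  { apply (Hreg u z0 e d); auto.
    - intros w Hw; apply Hu.
      pose proof (L1 z0 (w - z0)%C) as H; replace (z0 + (w - z0))%C with w in H by ring.
      apply Rabs_le_between in H; lra.
    - apply Hu; lra.
    - intros s Hs; set (x := lam (z0 + s)%C - lam z0).
      pose proof (L1 z0 s) as Hx; fold x in Hx; apply Rabs_le_between in Hx.
      specialize (Hle s ltac:(lra)).
      assert (HWs : W (z0 + s)%C <= 2 * W z0) by (apply Hmax; unfold Q, d in *; unfold x in Hx; lra).
      unfold W in HWs; fold d in HWs.
      replace (X - lam (z0 + s)%C) with (d * (1 - x / d)) in HWs by (unfold x, d; field; unfold d in Hd; lra).
      rewrite Rpow_mult_distr in HWs.
      assert (HdN : 0 < d ^ N) by (apply pow_lt; lra).
      assert (HWs2 : Cmod (u (z0 + s)%C) * (1 - x / d) ^ N <= 2 * Cmod (u z0)).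
      { apply (Rmult_le_reg_l (d ^ N)); auto; lra. }
      assert (Hin : / INR n <= 1 / 8).
      { unfold Rdiv; rewrite Rmult_1_l; apply Rinv_le_contravar; lra. }
      assert (Hin0 : 0 < / INR n) by (apply Rinv_0_lt_compat; lra).
      assert (Hq : - / INR n <= x / d <= / INR n).
      { assert (Hnd : / INR n * d = d / INR n) by (unfold Rdiv; ring).
        split; apply (Rmult_le_reg_r d); auto; unfold Rdiv at 1; rewrite ?Rmult_assoc, ?Rinv_l by lra; nra. }
      pose proof (inv_pow_le_exp (x / d) N ltac:(lra)) as Hexp.
      assert (Hex : INR N * (x / d + 2 * (x / d) ^ 2) <= INR n ^ 2 / d * Re (e * s)%C + 7 / 2).
      { rewrite HNn.
        assert (Hq2 : INR n ^ 2 * (x / d) ^ 2 <= 1).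
        { replace (INR n ^ 2 * (x / d) ^ 2) with ((INR n * (x / d)) ^ 2) by ring.
          assert (Hi : INR n * / INR n = 1) by (apply Rinv_r; lra).
          assert (-1 <= INR n * (x / d) <= 1) by nra; nra. }
        assert (Hs2 : INR n ^ 2 * Cmod s ^ 2 <= d ^ 2).
        { rewrite <- Rpow_mult_distr; apply pow_incr; split; [apply Rmult_le_pos; [lra | apply Cmod_ge_0]|].
          apply Rle_trans with (INR n * (d / INR n)); [apply Rmult_le_compat_l; lra | right; field; lra]. }
        assert (Hx2 : x <= Re (e * s)%C + Cmod s ^ 2 / (2 * lam z0)) by (unfold x; lra).
        assert (HnD : 0 <= INR n ^ 2 / d) by (apply Rdiv_le_0_compat; [apply pow2_ge_0 | auto]).
        assert (Hx3 : INR n ^ 2 / d * x <= INR n ^ 2 / d * (Re (e * s)%C + Cmod s ^ 2 / (2 * lam z0))).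
        { apply Rmult_le_compat_l; auto. }
        assert (Hx4 : INR n ^ 2 / d * (Cmod s ^ 2 / (2 * lam z0)) <= 3 / 2).
        { replace (INR n ^ 2 / d * (Cmod s ^ 2 / (2 * lam z0))) with ((INR n ^ 2 * Cmod s ^ 2) / (2 * d * lam z0))
            by (field; lra).
          apply (Rmult_le_reg_r (2 * d * lam z0)); [nra|].
          unfold Rdiv at 1; rewrite Rmult_assoc, Rinv_l by nra; nra. }
        replace (INR n ^ 2 * (x / d + 2 * (x / d) ^ 2)) with (INR n ^ 2 / d * x + 2 * (INR n ^ 2 * (x / d) ^ 2))
          by (field; lra).
        lra. }
      apply exp_le in Hex; rewrite exp_plus in Hex.
      set (E1 := exp (INR N * (x / d + 2 * (x / d) ^ 2))) in *.
      set (E2 := exp (INR n ^ 2 / d * Re (e * s)%C)) in *.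
      assert (HE1 : 0 < E1) by apply exp_pos; assert (HE2 : 0 < E2) by apply exp_pos.
      pose proof (Cmod_ge_0 (u (z0 + s)%C)) as Hus.
      apply Rle_trans with (Cmod (u (z0 + s)%C) * ((1 - x / d) ^ N * E1)).
      + rewrite <- (Rmult_1_r (Cmod (u (z0 + s)%C))) at 1; apply Rmult_le_compat_l; auto.
      + rewrite <- Rmult_assoc; apply Rle_trans with (2 * Cmod (u z0) * E1); [apply Rmult_le_compat_r; lra|].
        replace (2 * exp (7 / 2) * Cmod (u z0) * E2) with (2 * Cmod (u z0) * (E2 * exp (7 / 2))) by ring.
        apply Rmult_le_compat_l; lra. }
  specialize (Hhalf z Hz).
  assert (Hd2 : Cmod (u z0) * d ^ N <= 4 * K0 * X ^ 2 * X ^ N).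
  { assert (HdN : 0 < d ^ N) by (apply pow_lt; lra).
    apply Rle_trans with (K0 * (/ d + 1 + d + d ^ 2) * d ^ N); [apply Rmult_le_compat_r; lra|].
    replace (K0 * (/ d + 1 + d + d ^ 2) * d ^ N) with (K0 * (/ d * d ^ N + d ^ N + d * d ^ N + d ^ 2 * d ^ N)) by ring.
    replace (4 * K0 * X ^ 2 * X ^ N) with (K0 * (4 * (X ^ 2 * X ^ N))) by ring.
    apply Rmult_le_compat_l; auto.
    assert (HXN0 : 0 < X ^ N) by (apply pow_lt; lra).
    (* The weight has exponent at least 1, so it absorbs [/ d] however close [z0] is to the level
       [X]. *)
    assert (Ha : / d * d ^ N <= X ^ N).
    { unfold N; destruct (n * n)%nat as [|N'] eqn:EN; [nia|]; simpl.
      rewrite <- Rmult_assoc, Rinv_l, Rmult_1_l by lra.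
      apply Rle_trans with (X ^ N'); [apply pow_incr; unfold d; lra|].
      assert (0 < X ^ N') by (apply pow_lt; lra); nra. }
    assert (HdX2 : d <= X) by lra.
    assert (Hb : d * d ^ N <= X ^ 2 * X ^ N) by (apply Rmult_le_compat; try lra; nra).
    assert (Hc : d ^ 2 * d ^ N <= X ^ 2 * X ^ N) by (apply Rmult_le_compat; try lra; nra).
    assert (Hd1 : X ^ N <= X ^ 2 * X ^ N) by nra.
    lra. }
  apply (Rmult_le_reg_r ((X / 2) ^ N)); auto.
  eapply Rle_trans; [apply Hhalf|].
  apply Rle_trans with (8 * K0 * 2 ^ N * X ^ 2 * (X / 2) ^ N).
  - replace (8 * K0 * 2 ^ N * X ^ 2 * (X / 2) ^ N) with (2 * (4 * K0 * X ^ 2 * X ^ N)) by (rewrite HXN; ring); lra.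
  - apply Rmult_le_compat_r; [lra|]; apply Rmult_le_compat_r; [lra|]; lra.
Qed.

Lemma dyadic_above (x : R) : 0 <= x -> exists j : nat, x <= 2 ^ j <= 2 * (1 + x).
Proof.
  intros Hx.
  assert (H : forall k : nat, x <= 2 ^ k -> exists j : nat, x <= 2 ^ j <= 2 * (1 + x)).
  { induction k; intros Hk; [exists 0%nat; simpl in *; lra|].
    destruct (Rle_dec x (2 ^ k)); auto; exists (S k); simpl in *; lra. }
  destruct (INR_unbounded x) as [k Hk]; apply (H k).
  assert (INR k <= 2 ^ k); [|lra].
  clear; induction k; [simpl; lra|]; rewrite S_INR; simpl.
  assert (1 <= 2 ^ k) by (apply pow_R1_Rle; lra); lra.
Qed.

(** Induction over dyadic levels: passing to the next level either costs a factor [2 ^ S N] or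
    yields a quadratic bound outright. Both are covered by the factor [2 ^ m] per level, which
    amounts to growth of exponent [m]. *)
Lemma growth (A B al be ga de : R) (lam : C -> R) (u : C -> C) (r0 : R) : A + B <> 0 ->
  gauge lam -> 0 < r0 ->
  (forall z, r0 <= lam z -> (exists l, cder u z l) /\ ode_at A B al be ga de u z) ->
  (forall X, exists M, forall z, r0 <= lam z <= X -> Cmod (u z) <= M) ->
  exists (m : nat) (K : R), 0 <= K /\ forall z, r0 <= lam z -> Cmod (u z) <= K * (1 + lam z) ^ m.
Proof.
  intros HAB Hg Hr0 Hu Hbd.
  destruct (growth_dichotomy A B al be ga de HAB) as (N & K1 & HK1 & Hdich).
  set (rho := 1 + 8 * r0).
  destruct (Hbd rho) as [M HM].
  set (m := (N + 3)%nat); set (K := Rabs M + 16 * K1 * rho ^ 2).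
  assert (Hrho : 1 <= rho) by (unfold rho; lra).
  assert (HK : 0 <= K) by (unfold K; pose proof (Rabs_pos M); nra).
  assert (H2m : 2 ^ m = 8 * 2 ^ N) by (unfold m; rewrite pow_add; simpl; ring).
  assert (H2N : 1 <= 2 ^ N) by (apply pow_R1_Rle; lra).
  assert (Main : forall (j : nat) z, r0 <= lam z <= 2 ^ j * rho -> Cmod (u z) <= K * (2 ^ m) ^ j).
  { induction j; intros z Hz.
    - simpl in *; rewrite Rmult_1_l in Hz; specialize (HM z Hz); unfold K; pose proof (Rle_abs M).
      pose proof (pow2_ge_0 rho); nra.
    - assert (Hj : 1 <= 2 ^ j) by (apply pow_R1_Rle; lra).
      assert (Hmj : 0 < (2 ^ m) ^ j) by (apply pow_lt; lra).
      (* This [X] makes [X / 2] the new level and [X / 4] the level of the induction hypothesis. *)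
      destruct (Hdich lam u r0 Hg Hr0 Hu Hbd (2 * (2 ^ S j * rho))) as [Ha | (z0 & Hz0 & Hb)].
      + simpl; nra.
      + simpl; unfold rho; nra.
      + eapply Rle_trans; [apply Ha; lra|].
        assert (Hjm : (2 ^ j) ^ 2 <= (2 ^ m) ^ j).
        { rewrite <- !pow_mult; apply Rle_pow; [lra|]; unfold m; nia. }
        replace (K1 * (2 * (2 ^ S j * rho)) ^ 2) with (16 * K1 * rho ^ 2 * (2 ^ j) ^ 2) by (simpl; ring).
        assert (0 <= K1 * rho ^ 2) by (apply Rmult_le_pos; [auto | apply pow2_ge_0]).
        apply Rle_trans with (K * (2 ^ m) ^ j).
        * apply Rmult_le_compat; auto; [nra | apply pow2_ge_0|]; unfold K; pose proof (Rabs_pos M); lra.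
        * apply Rmult_le_compat_l; auto; simpl; nra.
      + eapply Rle_trans; [apply Hb; lra|].
        assert (Hz0' : Cmod (u z0) <= K * (2 ^ m) ^ j) by (apply IHj; simpl in Hz0; lra).
        apply Rle_trans with (2 ^ S N * (K * (2 ^ m) ^ j)); [apply Rmult_le_compat_l; auto; simpl; lra|].
        assert (0 <= K * (2 ^ m) ^ j) by nra.
        replace (K * (2 ^ m) ^ S j) with (2 ^ m * (K * (2 ^ m) ^ j)) by (simpl; ring).
        apply Rmult_le_compat_r; auto; rewrite H2m; simpl; lra. }
  exists m, (K * 2 ^ m); split; [apply Rmult_le_pos; lra|]; intros z Hz.
  destruct (dyadic_above (lam z) ltac:(lra)) as [j Hj].
  assert (Hj0 : 0 < 2 ^ j) by (apply pow_lt; lra).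
  eapply Rle_trans; [apply (Main j); nra|].
  rewrite Rmult_assoc, <- Rpow_mult_distr; apply Rmult_le_compat_l; auto.
  rewrite <- pow_mult, Nat.mul_comm, pow_mult; apply pow_incr; lra.
Qed.

Lemma gauge_Cmod : gauge Cmod.
Proof.
  split.
  - intros z s; apply Rabs_le; pose proof (Cmod_triangle z s).
    pose proof (Cmod_triangle (z + s) (- s)) as H2; rewrite Cmod_opp in H2.
    replace (z + s + - s)%C with z in H2 by ring; lra.
  - intros z Hz; exists (Cconj z / RtoC (Cmod z))%C.
    assert (Hz0 : RtoC (Cmod z) <> 0%C) by (intros E; apply RtoC_inj in E; lra).
    split.
    + rewrite Cmod_div, Cmod_conj, Cmod_R, Rabs_pos_eq by (auto; lra); field; lra.
    + intros s Hs; set (r := Cmod z) in *.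
      set (x := Re (Cconj z / RtoC r * s)%C).
      assert (Hx : r * x = fst z * fst s + snd z * snd s).
      { unfold x; replace (Cconj z / RtoC r * s)%C with (RtoC (/ r) * (Cconj z * s))%C
          by (rewrite RtoC_inv by lra; field; auto).
        destruct z, s; simpl; field; lra. }
      assert (Hzs : Cmod (z + s) ^ 2 = r ^ 2 + 2 * (r * x) + Cmod s ^ 2).
      { rewrite Hx; unfold r; rewrite !Cmod2_alt; destruct z, s; simpl; ring. }
      assert (Hxs : x <= Cmod s /\ - Cmod s <= x).
      { apply and_comm, Rabs_le_between; unfold x; eapply Rle_trans; [apply re_le_Cmod|].
        rewrite Cmod_mult, Cmod_div, Cmod_conj, Cmod_R, Rabs_pos_eq by (auto; lra); fold r.
        right; field; lra. }
      pose proof (Cmod_ge_0 s).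
      set (y := Cmod s ^ 2 / (2 * r)).
      assert (Hy : 2 * r * y = Cmod s ^ 2) by (unfold y; field; lra).
      assert (Hy0 : 0 <= y) by (apply Rdiv_le_0_compat; [apply pow2_ge_0 | lra]).
      (* Since [2 * r * y] is the square of [Cmod s], (r + x + y)^2 exceeds the square of
         [Cmod (z + s)] by (x + y)^2. Comparing the unsquared quantities needs [0 <= r + x + y],
         which follows from [Cmod s <= r]. *)
      apply Rnot_lt_le; intros Hlt.
      assert (0 <= r + x + y) by lra.
      assert ((r + x + y) ^ 2 < Cmod (z + s) ^ 2) by nra.
      pose proof (pow2_ge_0 (x + y)); nra.
Qed.

Lemma gauge_Re (e : C) : Cmod e = 1 -> gauge (fun z => Re (e * z)%C).
Proof.
  intros He; split.
  - intros z s; replace (Re (e * (z + s))%C - Re (e * z)%C) with (Re (e * s)%C) by (destruct e, z, s; simpl; ring).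
    eapply Rle_trans; [apply re_le_Cmod|]; rewrite Cmod_mult, He; lra.
  - intros z Hz; exists e; split; auto; intros s _.
    replace (Re (e * (z + s))%C) with (Re (e * z)%C + Re (e * s)%C) by (destruct e, z, s; simpl; ring).
    assert (0 <= Cmod s ^ 2 / (2 * Re (e * z)%C)) by (apply Rdiv_le_0_compat; [apply pow2_ge_0 | lra]); lra.
Qed.

(** * Minima over locally finite sets *)

Lemma locally_finite_list (T : C -> Prop) (B : R) :
  (forall z, near z (fun w => ~ T w)) -> (forall z, T z -> Cmod z <= B) ->
  exists l : list C, forall z, T z -> In z l.
Proof.
  intros Hiso HB; pose proof (Rabs_pos B) as HB0.
  destruct (bisection (fun x y w h => exists l : list C, forall a b, x <= a <= x + w -> y <= b <= y + h ->
     T (a, b) -> In (a, b) l) (- Rabs B) (- Rabs B) (2 * Rabs B) (2 * Rabs B)) as [l Hl]; try lra.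
  - intros x y w h Hw Hh _ _ _ _ [l1 P1] [l2 P2] [l3 P3] [l4 P4].
    exists (l1 ++ l2 ++ l3 ++ l4)%list; intros a b Ha Hb HT; rewrite !in_app_iff.
    destruct (Rle_dec a (x + w / 2)), (Rle_dec b (y + h / 2)).
    + left; apply P1; auto; lra.
    + right; right; left; apply P3; auto; lra.
    + right; left; apply P2; auto; lra.
    + right; right; right; apply P4; auto; lra.
  - intros a b _ _; destruct (Hiso (a, b)) as [d [Hd H]]; exists (d / 2); split; [lra|].
    intros x y w h Hw Hh _ _ _ _ Hxa Hyb; exists ((a, b) :: nil); intros a' b' Ha' Hb' HT.
    destruct (classic ((a', b') = (a, b) :> C)) as [->|Hn]; [now left | exfalso].
    apply (H (a', b')); auto; split; [now apply Cmod_minus_gt0|].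
    pose proof (rect_dist x y w h a b a' b' Hxa Hyb Ha' Hb'); lra.
  - exists l; intros [a b] HT; pose proof (HB _ HT); pose proof (Rle_abs B).
    pose proof (Rmax_Cmod (a, b)) as H2; simpl in H2.
    pose proof (Rmax_l (Rabs a) (Rabs b)); pose proof (Rmax_r (Rabs a) (Rabs b)).
    assert (Ha : Rabs a <= Rabs B) by lra; assert (Hb : Rabs b <= Rabs B) by lra.
    apply Rabs_le_between in Ha; apply Rabs_le_between in Hb; apply Hl; auto; lra.
Qed.

Lemma list_min (T : C -> Prop) (phi : C -> R) (l : list C) :
  (exists z, In z l /\ T z) -> exists z0, T z0 /\ forall z, In z l -> T z -> phi z0 <= phi z.
Proof.
  induction l as [|a l IH]; intros [z [Hin HT]]; [destruct Hin|].
  destruct (classic (exists z, In z l /\ T z)) as [He|Hne].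
  - destruct (IH He) as [z0 [Hz0 Hmin]].
    destruct (classic (T a /\ phi a < phi z0)) as [[Ha Hlt]|Hn].
    + exists a; split; auto; intros w [->|Hw] HTw; [lra | specialize (Hmin w Hw HTw); lra].
    + exists z0; split; auto; intros w [->|Hw] HTw; auto.
      apply Rnot_lt_le; intros Hlt; apply Hn; auto.
  - exists z; split; auto; intros w Hw HTw.
    assert (Hx : forall y, In y (a :: l) -> T y -> y = a).
    { intros y [->|Hy] HTy; auto; exfalso; apply Hne; eauto. }
    rewrite (Hx z Hin HT), (Hx w Hw HTw); lra.
Qed.

Lemma locally_finite_min (T : C -> Prop) (phi : C -> R) (B : R) :
  (forall z, near z (fun w => ~ T w)) -> (forall z, T z -> Cmod z <= B) -> (exists z, T z) ->
  exists z0, T z0 /\ forall z, T z -> phi z0 <= phi z.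
Proof.
  intros Hiso HB [z1 Hz1]; destruct (locally_finite_list T B Hiso HB) as [l Hl].
  destruct (list_min T phi l) as [z0 [Hz0 Hmin]]; eauto.
Qed.

Lemma C_derive_at_inv (f : C -> C) (s : C) : s <> 0%C -> (exists l, cder f (/ s)%C l) ->
  C_derive f (/ s)%C = (- (s * s) * C_derive (fun s => f (/ s)%C) s)%C /\
  exists l, cder (fun s => f (/ s)%C) s l.
Proof.
  intros Hs [l Hl]; rewrite (C_derive_cder _ _ _ Hl).
  assert (H : cder (fun s => f (/ s)%C) s (l * (- (1) / (s * s)))%C).
  { apply (cder_comp f (fun s => / s)%C); auto; apply (cder_inv (fun s => s)); auto; apply cder_id. }
  split; [|eauto]; rewrite (C_derive_cder _ _ _ H); field; auto.
Qed.

(** Each derivative lowers the growth order [c = k + 3] by one, so the quadratic terms have order 2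
    c - 2, above the order c of the linear ones precisely because c > 2. Their coefficient A c^2 + B
    c (c - 1) must vanish, that is B / (A + B) = c. *)
Lemma ode_order_at_infinity (A B al be ga de : R) (u : C -> C) (g : C -> C) (k : nat) (r : R) :
  A + B <> 0 -> (forall n : Z, (n <> 0)%Z -> B / (A + B) <> IZR n) ->
  0 < r -> hol g 0 r -> g 0%C <> 0%C ->
  (forall s, 0 < Cmod s < r -> exists t, 0 < t /\ hol u (/ s)%C t) ->
  (forall s, 0 < Cmod s < r -> ode_at A B al be ga de u (/ s)%C) ->
  (forall s, 0 < Cmod s < r -> u (/ s)%C = (g s / s ^ (k + 3))%C) -> False.
Proof.
  intros HAB Hii Hr Hg Hg0 Hu Hode Hug.
  assert (E0 : forall s : C, (s - 0)%C = s) by (intros; ring).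
  assert (Hs0 : forall s, 0 < Cmod s < r -> s <> 0%C) by (intros s Hs; apply Cmod_gt_0; lra).
  assert (HD1 : forall s, 0 < Cmod s < r -> exists t, 0 < t /\ hol (D1 u) (/ s)%C t).
  { intros s Hs; destruct (Hu s Hs) as [t [Ht H]]; exists t; split; auto; now apply hol_derive. }
  assert (HD2 : forall s, 0 < Cmod s < r -> exists t, 0 < t /\ hol (D2 u) (/ s)%C t).
  { intros s Hs; destruct (HD1 s Hs) as [t [Ht H]]; exists t; split; auto; now apply hol_derive. }
  assert (Hat : forall f, (forall s, 0 < Cmod s < r -> exists t, 0 < t /\ hol f (/ s)%C t) ->
     forall s, 0 < Cmod s < r -> C_derive f (/ s)%C = (- (s * s) * C_derive (fun s => f (/ s)%C) s)%C).
  { intros f Hf s Hs; apply C_derive_at_inv; auto; destruct (Hf s Hs) as [t [Ht H]]; apply H.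
    rewrite Cmod_diag; lra. }
  set (n := (k + 3)%nat).
  assert (H0 : forall s, 0 < Cmod (s - 0) < r -> u (/ s)%C = (g s * (s - 0) ^ 0 / (s - 0) ^ n)%C).
  { intros s Hs; rewrite E0 in *; rewrite Hug by auto; simpl; unfold Cdiv, n; ring. }
  set (G1 := laurent_step g 0 0 n); assert (HG1 : hol G1 0 r) by (unfold G1; hol_tac).
  set (F1 := fun s => (- (1) * G1 s)%C); assert (HF1 : hol F1 0 r) by (unfold F1; hol_tac).
  assert (H1 : forall s, 0 < Cmod (s - 0) < r -> D1 u (/ s)%C = (F1 s * (s - 0) ^ 1 / (s - 0) ^ n)%C).
  { intros s Hs; destruct (laurent_derive (fun s => u (/ s)%C) g 0 r 0 n Hg H0 s Hs) as [_ E].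
    rewrite E0 in *; unfold D1; rewrite (Hat u Hu s Hs), E; unfold F1; fold G1; simpl; rewrite ?E0.
    pose proof (Hs0 s Hs); field; split; auto; now apply Cpow_neq0. }
  set (G2 := laurent_step F1 0 1 n); assert (HG2 : hol G2 0 r) by (unfold G2; hol_tac).
  set (F2 := fun s => (- (1) * G2 s)%C); assert (HF2 : hol F2 0 r) by (unfold F2; hol_tac).
  assert (H2 : forall s, 0 < Cmod (s - 0) < r -> D2 u (/ s)%C = (F2 s * (s - 0) ^ 2 / (s - 0) ^ n)%C).
  { intros s Hs; destruct (laurent_derive (fun s => D1 u (/ s)%C) F1 0 r 1 n HF1 H1 s Hs) as [_ E].
    rewrite E0 in *; change (D2 u) with (C_derive (D1 u)); rewrite (Hat (D1 u) HD1 s Hs), E; unfold F2; fold G2; simpl; rewrite ?E0.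
    pose proof (Hs0 s Hs); field; split; auto; now apply Cpow_neq0. }
  set (G3 := laurent_step F2 0 2 n); assert (HG3 : hol G3 0 r) by (unfold G3; hol_tac).
  set (F3 := fun s => (- (1) * G3 s)%C); assert (HF3 : hol F3 0 r) by (unfold F3; hol_tac).
  assert (H3 : forall s, 0 < Cmod (s - 0) < r -> D3 u (/ s)%C = (F3 s * (s - 0) ^ 3 / (s - 0) ^ n)%C).
  { intros s Hs; destruct (laurent_derive (fun s => D2 u (/ s)%C) F2 0 r 2 n HF2 H2 s Hs) as [_ E].
    rewrite E0 in *; change (D3 u) with (C_derive (D2 u)); rewrite (Hat (D2 u) HD2 s Hs), E; unfold F3; fold G3; simpl; rewrite ?E0.
    pose proof (Hs0 s Hs); field; split; auto; now apply Cpow_neq0. }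
  set (E := fun s => (RtoC A * F1 s * F1 s + RtoC B * g s * F2 s - ((s - 0) ^ 1 * (s - 0) ^ k * (F3 s * (s - 0) ^ 3
     + RtoC al * F2 s * (s - 0) ^ 2 + RtoC be * F1 s * (s - 0) ^ 1 + RtoC ga * g s)
     + RtoC de * (s - 0) ^ 4 * (s - 0) ^ k * (s - 0) ^ k))%C).
  assert (HE : E 0%C = 0%C).
  { apply (hol_zero_center E 0 r Hr); [unfold E; hol_tac|].
    intros s Hs; assert (Hx : (s - 0)%C <> 0%C) by (apply Cmod_gt_0; lra).
    pose proof (Cpow_neq0 _ k Hx) as HY.
    assert (Hs' : 0 < Cmod s < r) by (rewrite E0 in Hs; auto).
    specialize (Hode s Hs'); unfold ode_at in Hode; rewrite H0, H1, H2, H3 in Hode by auto.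
    unfold n in Hode; rewrite Nat.add_comm in Hode; simpl in Hode.
    unfold E; simpl; set (x := (s - 0)%C) in *; set (Y := (x ^ k)%C) in *.
    match type of Hode with ?l = ?rr => transitivity (x * x * x * x * Y * Y * (l - rr))%C end;
      [field; auto | rewrite Hode; ring]. }
  set (c := INR n).
  assert (Hc : 3 <= c) by (unfold c, n; rewrite plus_INR; simpl; pose proof (pos_INR k); lra).
  assert (E1 : F1 0%C = (RtoC c * g 0%C)%C).
  { unfold F1, G1; rewrite laurent_step_center; fold c; simpl; rewrite RtoC_minus; ring. }
  assert (E2 : F2 0%C = (RtoC (c * (c - 1)) * g 0%C)%C).
  { unfold F2, G2; rewrite laurent_step_center, E1; fold c; simpl; rewrite RtoC_mult, !RtoC_minus; ring. }
  assert (HX : (RtoC (A * c * c + B * (c * (c - 1))) * (g 0%C * g 0%C))%C = 0%C).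
  { transitivity (E 0%C); [unfold E | exact HE]; rewrite E1, E2, RtoC_plus, !RtoC_mult; set (Y := ((0 - 0) ^ k)%C); simpl; ring. }
  assert (HX2 : A * c * c + B * (c * (c - 1)) = 0).
  { apply NNPP; intros Hq; refine (Cmult_neq_0 _ _ _ (Cmult_neq_0 _ _ Hg0 Hg0) HX); intros Heq; apply RtoC_inj in Heq; auto. }
  assert (HX3 : (A + B) * c = B).
  { assert (Hm : c * ((A + B) * c - B) = 0) by (rewrite <- HX2; ring).
    apply Rmult_integral in Hm; destruct Hm; lra. }
  apply (Hii (Z.of_nat n)); [unfold n; lia|].
  rewrite <- INR_IZR_INZ; fold c; rewrite <- HX3 at 1; field; auto.
Qed.

(** [s ^ m * u (/ s)] is bounded near 0, so infinity is at worst a pole, and a pole of order three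
    or more is excluded by [ode_order_at_infinity]. *)
Lemma quadratic_at_infinity (A B al be ga de : R) (u : C -> C) (r0 K : R) (m : nat) :
  A + B <> 0 -> (forall n : Z, (n <> 0)%Z -> B / (A + B) <> IZR n) -> 0 < r0 ->
  (forall z, r0 <= Cmod z -> exists l, cder u z l) ->
  (forall z, r0 <= Cmod z -> ode_at A B al be ga de u z) ->
  (forall z, r0 <= Cmod z -> Cmod (u z) <= K * (1 + Cmod z) ^ m) ->
  exists r1 K1, forall z, r1 <= Cmod z -> Cmod (u z) <= K1 * (1 + Cmod z) ^ 2.
Proof.
  intros HAB Hii Hr0 Hu Hode HK.
  set (r := Rmin (/ r0) 1).
  assert (Hir0 : 0 < / r0) by now apply Rinv_0_lt_compat.
  assert (Hr : 0 < r) by (apply Rmin_pos; lra).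
  assert (Hr1 : r <= / r0) by apply Rmin_l; assert (Hr2 : r <= 1) by apply Rmin_r.
  assert (Hs0 : forall s, 0 < Cmod s < r -> s <> 0%C) by (intros s Hs; apply Cmod_gt_0; lra).
  assert (Hinv : forall s, 0 < Cmod s < r -> r0 < Cmod (/ s)).
  { intros s Hs; rewrite Cmod_inv by auto; rewrite <- (Rinv_inv r0); apply Rinv_lt_contravar; [nra | lra]. }
  assert (E0 : forall s : C, (s - 0)%C = s) by (intros; ring).
  destruct (riemann_removable (fun s => s ^ m * u (/ s))%C 0 r (Rabs K * 2 ^ m)) as [h [Hh Hhu]]; auto.
  { intros s Hs; rewrite E0 in Hs; destruct (Hu (/ s)%C) as [l Hl]; [left; auto|].
    destruct (C_derive_at_inv u s) as [_ [l' Hl']]; eauto.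
    eexists; apply (cder_mult (fun s => s ^ m)%C); [|exact Hl'].
    apply (cder_ext_ball (fun s => (s - 0) ^ m)%C _ _ _ 1); [lra | intros; now rewrite E0 | apply cder_pow]. }
  { intros s Hs; rewrite E0 in Hs; rewrite Cmod_mult, Cmod_pow.
    pose proof (HK (/ s)%C ltac:(left; auto)) as H; rewrite Cmod_inv in H by auto.
    assert (Hp : 0 <= Cmod s ^ m) by (apply pow_le; lra).
    apply Rle_trans with (Cmod s ^ m * (Rabs K * (1 + / Cmod s) ^ m)).
    - apply Rmult_le_compat_l; auto; eapply Rle_trans; [apply H|].
      apply Rmult_le_compat_r; [apply pow_le; assert (0 < / Cmod s) by (apply Rinv_0_lt_compat; lra); lra | apply Rle_abs].
    - replace (Cmod s ^ m * (Rabs K * (1 + / Cmod s) ^ m)) with (Rabs K * (Cmod s + 1) ^ m).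
      + apply Rmult_le_compat_l; [apply Rabs_pos|]; apply pow_incr; lra.
      + replace (Cmod s + 1) with (Cmod s * (1 + / Cmod s)) by (field; lra); rewrite Rpow_mult_distr; ring. }
  assert (Hback : forall z, / r < Cmod z -> 0 < Cmod (/ z) < r /\ z <> 0%C).
  { intros z Hz; assert (0 < / r) by now apply Rinv_0_lt_compat.
    assert (Hz0 : z <> 0%C) by (apply Cmod_gt_0; lra); split; auto; rewrite Cmod_inv by auto; split.
    - apply Rinv_0_lt_compat; lra.
    - rewrite <- (Rinv_inv r); apply Rinv_lt_contravar; auto; nra. }
  assert (Hir : 0 < / r) by now apply Rinv_0_lt_compat.
  destruct (hol_factor h 0 r Hr Hh) as [Hz | (j & g & Hg & Hg0 & Hhg)].
  (* Degenerate case: [u] vanishes near infinity, and the bound holds with constant 0. *)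
  - exists (8 / r), 0; intros z Hz'; rewrite Rmult_0_l.
    assert (H8 : 8 / r = 8 * / r) by reflexivity.
    destruct (Hback z ltac:(lra)) as [Hz1 Hz0].
    assert (Hsm : Cmod (/ z) < r / 4).
    { rewrite Cmod_inv by auto; apply Rlt_le_trans with (/ (4 / r)).
      - apply Rinv_lt_contravar; [apply Rmult_lt_0_compat; [apply Rdiv_lt_0_compat|]; lra|]; unfold Rdiv in *; lra.
      - right; field; lra. }
    assert (E : (( / z) ^ m * u (/ / z))%C = 0%C).
    { rewrite <- Hhu by (rewrite E0; auto); apply Hz; rewrite E0; auto. }
    replace (/ / z)%C with z in E by (field; auto).
    assert (Hu0 : u z = 0%C).
    { apply NNPP; intros Hn; refine (Cmult_neq_0 _ _ _ Hn E); apply Cpow_neq0, Cmod_gt_0; lra. }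
    rewrite Hu0, Cmod_0; lra.
  - assert (Huz : forall s, 0 < Cmod s < r -> u (/ s)%C = (g s * s ^ j / s ^ m)%C).
    { intros s Hs; pose proof (Hs0 s Hs) as Hsn; pose proof (Cpow_neq0 s m Hsn) as Hsm.
      assert (E : (s ^ m * u (/ s))%C = (s ^ j * g s)%C).
      { rewrite <- Hhu, Hhg by (rewrite E0; lra); now rewrite E0. }
      replace (u (/ s)%C) with (s ^ m * u (/ s) / s ^ m)%C by (field; auto); rewrite E; field; auto. }
    destruct (le_lt_dec m (j + 2)) as [Hmj|Hmj].
    + destruct (disc_bounded g 0 r (r / 2) Hg ltac:(lra)) as [M HM].
      exists (2 / r), (Rabs M); intros z Hz.
      assert (Hz2 : / (r / 2) <= Cmod z) by (replace (/ (r / 2)) with (2 / r) by (field; lra); auto).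
      assert (Hlt : / r < Cmod z) by (unfold Rdiv in Hz; lra).
      destruct (Hback z Hlt) as [Hz1 Hz0].
      assert (Hzs : Cmod (/ z) <= r / 2).
      { rewrite Cmod_inv by auto; rewrite <- (Rinv_inv (r / 2)); apply Rinv_le_contravar; auto.
        apply Rinv_0_lt_compat; lra. }
      pose proof (Huz _ Hz1) as E; replace (/ / z)%C with z in E by (field; auto).
      pose proof (Hs0 _ Hz1) as Hsn; pose proof (Cpow_neq0 _ m Hsn) as Hsm.
      rewrite E, Cmod_div, Cmod_mult, !Cmod_pow by auto.
      set (t := Cmod (/ z)) in *.
      assert (Ht : Cmod z = / t) by (unfold t; rewrite Cmod_inv, Rinv_inv; auto).
      assert (Htm : 0 < t ^ m) by (apply pow_lt; lra).
      apply (Rmult_le_reg_r (t ^ m)); auto; unfold Rdiv; rewrite Rmult_assoc, Rinv_l, Rmult_1_r by lra.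
      assert (Hgb : Cmod (g (/ z)%C) <= Rabs M) by (eapply Rle_trans; [apply HM; rewrite E0; auto | apply Rle_abs]).
      rewrite Rmult_assoc; apply Rmult_le_compat; auto using Cmod_ge_0; [apply pow_le; lra|].
      rewrite Ht; apply Rle_trans with ((/ t) ^ 2 * t ^ m).
      * apply Rle_trans with ((/ t) ^ 2 * t ^ (j + 2)).
        { rewrite pow_add; right; simpl; field; lra. }
        apply Rmult_le_compat_l; [apply pow2_ge_0|].
        replace (j + 2)%nat with (m + (j + 2 - m))%nat by lia; rewrite pow_add.
        assert (t ^ (j + 2 - m) <= 1 ^ (j + 2 - m)) by (apply pow_incr; lra); rewrite pow1 in *; nra.
      * apply Rmult_le_compat_r; [lra|]; apply pow_incr; split; [left; apply Rinv_0_lt_compat; lra | lra].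
    + exfalso; apply (ode_order_at_infinity A B al be ga de u g (m - j - 3) r); auto.
      * intros s Hs; exists (Cmod (/ s) - r0); split; [specialize (Hinv s Hs); lra|].
        intros w Hw; apply Hu; pose proof (Cmod_tri2 (/ s)%C w); rewrite Cmod_sym in Hw; lra.
      * intros s Hs; apply Hode; left; auto.
      * intros s Hs; rewrite Huz by auto; pose proof (Hs0 s Hs) as Hsn.
        replace m with (j + (m - j - 3 + 3))%nat at 1 by lia; rewrite (Cpow_add_r s j).
        field; split; now apply Cpow_neq0.
Qed.

(** * Periods *)

Definition simple_pole_at (u : C -> C) (S : C -> Prop) (rho p : C) : Prop :=
  exists (r : R) (G : C -> C), 0 < r /\ hol G p r /\ G p = rho /\
    forall z, 0 < Cmod (z - p) < r -> ~ S z /\ u z = (G z / (z - p))%C.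

(** On punctured neighbourhoods, because the values of [u] on [S] carry no information. *)
Definition translation_invariant (u : C -> C) (S : C -> Prop) : Prop :=
  forall p q z, S p -> S q -> near z (fun w => u (w + (q - p))%C = u w).

Record pole_data (u : C -> C) (S : C -> Prop) (rho : C) : Prop := {
  pd_iso : forall z, near z (fun w => ~ S w);
  pd_hol : forall z, ~ S z -> exists l, cder u z l;
  pd_inf : forall p, S p -> forall M, near p (fun z => M < Cmod (u z));
  pd_pole : forall p, S p -> simple_pole_at u S rho p
}.

Lemma ode_at_translate (A B al be ga de : R) (u : C -> C) (om z : C) (r : R) : 0 < r ->
  hol u (z + om)%C r -> ode_at A B al be ga de u (z + om)%C ->
  ode_at A B al be ga de (fun w => u (w + om)%C) z.
Proof.
  intros Hr Hu Hode.
  assert (Hd : forall (f g : C -> C), hol f (z + om)%C r ->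
     (forall w, Cmod (w - z) < r -> g w = f (w + om)%C) ->
     forall w, Cmod (w - z) < r -> C_derive g w = C_derive f (w + om)%C).
  { intros f g Hf E w Hw; apply C_derive_cder.
    apply (cder_ext_ball (fun w => f (w + om)%C) _ _ _ (r - Cmod (w - z))); [lra| |].
    - intros y Hy; symmetry; apply E; pose proof (Cmod_tri y w z); lra.
    - apply (cder_eq _ _ (C_derive f (w + om)%C * (1 + 0))%C); [ring|].
      apply (cder_comp f (fun w => w + om)%C).
      + apply cder_plus; [apply cder_id | apply cder_const].
      + apply (hol_cder f (z + om)%C r); auto; replace (w + om - (z + om))%C with (w - z)%C by ring; auto. }
  pose proof (Hd u (fun w => u (w + om)%C) Hu (fun w _ => eq_refl)) as E1.
  pose proof (Hd (D1 u) _ (hol_derive _ _ _ Hu) E1) as E2.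
  pose proof (Hd (D2 u) _ (hol_derive _ _ _ (hol_derive _ _ _ Hu)) E2) as E3.
  assert (Hz : Cmod (z - z) < r) by (rewrite Cmod_diag; lra).
  unfold ode_at, D1, D2, D3 in *; rewrite E1, E2, E3 by auto; exact Hode.
Qed.

Lemma open_complement (S : C -> Prop) (z : C) : (forall z, near z (fun w => ~ S w)) -> ~ S z ->
  exists r, 0 < r /\ forall w, Cmod (w - z) < r -> ~ S w.
Proof. intros H Hz; now apply near_nbhd. Qed.

Lemma solution_pole_data (A B al be ga de : R) (u : C -> C) (S : C -> Prop) :
  A + B <> 0 -> A + 2 * B <> 0 -> (forall n : Z, (n <> 0)%Z -> B / (A + B) <> IZR n) ->
  meromorphic_with_poles u S -> solves_ode A B al be ga de u S ->
  pole_data u S (RtoC (- 6 / (A + 2 * B))).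
Proof.
  intros HAB HA2B Hii (Hiso & Hhol & Hinf) Hode.
  assert (Hh : forall z, ~ S z -> exists l, cder u z l).
  { intros z Hz; destruct (Hhol z Hz) as [l Hl]; exists l; now apply cder_is_derive. }
  split; auto.
  intros p Hp; destruct (Hiso p) as [r0 [Hr0 Hr]].
  destruct (simple_pole A B al be ga de u p r0) as (r & G & H1 & H2 & H3 & H4); auto.
  { intros z Hz; apply Hh, Hr, Hz. }
  { intros M; apply (Hinf p Hp M). }
  { intros z Hz; apply Hode, Hr, Hz. }
  exists (Rmin r r0), G; pose proof (Rmin_l r r0); pose proof (Rmin_r r r0).
  split; [now apply Rmin_pos|]; split; [now apply (hol_mono G p r)|]; split; auto.
  intros z Hz; split; [apply Hr | apply H4]; lra.
Qed.

Lemma pole_data_mero (u : C -> C) (S : C -> Prop) (rho z : C) : pole_data u S rho -> mero_at u z.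
Proof.
  intros [Hiso Hhol _ Hpole]; destruct (classic (S z)) as [Hz|Hz].
  - destruct (Hpole z Hz) as (r & G & Hr & HG & _ & H); exists 1%nat, r, G; repeat split; auto.
    intros w Hw; destruct (H w Hw) as [_ E]; rewrite E; simpl; now rewrite Cmult_1_r.
  - destruct (open_complement S z Hiso Hz) as [r [Hr H]].
    apply (hol_mero_at u z r); auto; intros w Hw; apply Hhol, H, Hw.
Qed.

Lemma mero_at_translate (u : C -> C) (om z : C) : mero_at u (z + om)%C -> mero_at (fun w => u (w + om)%C) z.
Proof.
  intros (n & r & G & Hr & HG & H).
  assert (E : forall w, (w + om - (z + om))%C = (w - z)%C) by (intros; ring).
  exists n, r, (fun w => G (w + om)%C); split; auto; split.
  - intros w Hw; destruct (HG (w + om)%C) as [l Hl]; [now rewrite E|].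
    eexists; apply (cder_comp G (fun w => w + om)%C); [|exact Hl].
    apply cder_plus; [apply cder_id | apply cder_const].
  - intros w Hw; rewrite H by (now rewrite E); now rewrite E.
Qed.

(** The equation is autonomous, so the translate by [q - p] is a second solution with the same
    residue at [p]. [laurent_unique] gives agreement near [p], and the identity theorem spreads it
    over the plane. *)
Lemma solution_translation_invariant (A B al be ga de : R) (u : C -> C) (S : C -> Prop) :
  A + 2 * B <> 0 ->
  (forall (s : R), (s = 1 \/ s = -1) -> forall n : nat, fuchs_index A B s <> RtoC (INR n)) ->
  pole_data u S (RtoC (- 6 / (A + 2 * B))) -> solves_ode A B al be ga de u S ->
  translation_invariant u S.
Proof.
  intros HA2B Hiii Hpd Hode p q z Hp Hq; set (om := (q - p)%C).
  destruct (pd_pole _ _ _ Hpd p Hp) as (r & G & Hr & HG & HGp & HuG).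
  destruct (pd_pole _ _ _ Hpd q Hq) as (s & H & Hs & HH & HHq & HuH).
  assert (E : forall w, (w + om - q)%C = (w - p)%C) by (intros; unfold om; ring).
  set (t := Rmin r s); assert (Ht : 0 < t) by now apply Rmin_pos.
  assert (Htr : t <= r) by apply Rmin_l; assert (Hts : t <= s) by apply Rmin_r.
  assert (Hnear : near p (fun w => u w = u (w + om)%C)).
  { apply (laurent_unique A B al be ga de u (fun w => u (w + om)%C) G (fun w => H (w + om)%C) p t); auto.
    - now apply (hol_mono G p r).
    - intros w Hw; destruct (HH (w + om)%C) as [l Hl]; [rewrite E; lra|].
      eexists; apply (cder_comp H (fun w => w + om)%C); [|exact Hl].
      apply cder_plus; [apply cder_id | apply cder_const].
    - replace (p + om)%C with q by (unfold om; ring); auto.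
    - intros w Hw; apply HuG; lra.
    - intros w Hw; destruct (HuH (w + om)%C) as [_ EH]; [rewrite E; lra|]; now rewrite EH, E.
    - intros w Hw; apply Hode, HuG; lra.
    - intros w Hw; destruct (HuH (w + om)%C) as [HS _]; [rewrite E; lra|].
      destruct (open_complement S (w + om)%C (pd_iso _ _ _ Hpd) HS) as [r1 [Hr1 H1]].
      apply (ode_at_translate _ _ _ _ _ _ u om w r1); auto.
      + intros y Hy; apply (pd_hol _ _ _ Hpd), H1, Hy.
      + apply Hode, HS. }
  assert (Hz : near z (fun w => (u w - u (w + om))%C = 0%C)).
  { apply (identity_theorem (fun w => u w - u (w + om))%C p z).
    - intros y; apply mero_at_minus; [|apply mero_at_translate]; eapply pole_data_mero; eauto.
    - generalize Hnear; apply near_imp; intros w Ew; rewrite <- Ew; ring. }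
  generalize Hz; apply near_imp; intros w Hw; symmetry; now apply Cminus_diag_eq.
Qed.

Lemma near_translate (z om : C) (P : C -> Prop) : near (z + om)%C P -> near z (fun w => P (w + om)%C).
Proof.
  intros [d [Hd H]]; exists d; split; auto; intros w Hw; apply H.
  replace (w + om - (z + om))%C with (w - z)%C by ring; auto.
Qed.

(** Near [z] the function is unbounded, and so is its translate; at a regular point the translate
    would stay bounded by continuity. *)
Lemma pole_translate (u : C -> C) (S : C -> Prop) (rho p q z : C) :
  pole_data u S rho -> translation_invariant u S -> S p -> S q -> S z -> S (z + (q - p))%C.
Proof.
  intros Hpd HT Hp Hq Hz; apply NNPP; intros Hn.
  destruct (pd_hol _ _ _ Hpd _ Hn) as [l Hl]; apply cder_ccont in Hl.
  pose proof (near_translate _ _ _ (Hl 1 ltac:(lra))) as H1.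
  set (v := u (z + (q - p))%C) in *.
  destruct (near_exists _ _ (near_and _ _ _ H1 (near_and _ _ _ (HT p q z Hp Hq)
     (pd_inf _ _ _ Hpd z Hz (Cmod v + 1))))) as [w (W1 & W2 & W3)].
  rewrite W2 in W1; pose proof (Cmod_tri2 (u w) v); lra.
Qed.

(** Both points are regular, so the equality on a punctured neighbourhood passes to the limit. *)
Lemma u_translate (u : C -> C) (S : C -> Prop) (rho p q z : C) :
  pole_data u S rho -> translation_invariant u S -> S p -> S q -> ~ S z -> u (z + (q - p))%C = u z.
Proof.
  intros Hpd HT Hp Hq Hz.
  assert (Hz' : ~ S (z + (q - p))%C).
  { intros H; apply Hz; replace z with (z + (q - p) + (p - q))%C by ring.
    eapply pole_translate; eauto. }
  destruct (pd_hol _ _ _ Hpd _ Hz) as [l Hl]; destruct (pd_hol _ _ _ Hpd _ Hz') as [m Hm].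
  apply (tends_unique u z); [|exact (cder_ccont _ _ _ Hl)].
  apply (tends_ext (fun w => u (w + (q - p))%C)); [now apply HT|].
  apply (tends_comp_ccont u (fun w => w + (q - p))%C z (z + (q - p))%C); [|exact (cder_ccont _ _ _ Hm)].
  apply tends_plus; [apply tends_id | apply tends_const].
Qed.

Lemma Cexp_eq_1 (w : C) : Cexp w = 1%C -> exists n : Z, w = (Ci * RtoC (IZR n * (2 * PI)))%C.
Proof.
  intros H; assert (Hm : exp (fst w) = 1) by (rewrite <- Cmod_Cexp, H; apply Cmod_1).
  assert (Hf : fst w = 0) by (rewrite <- exp_0 in Hm; now apply exp_inv).
  apply (f_equal fst) in H; simpl in H; rewrite Hm, Rmult_1_l in H.
  assert (Hs : sin (snd w / 2) = 0).
  { replace (snd w) with (2 * (snd w / 2)) in H by field; rewrite cos_2a_sin in H.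
    apply Rsqr_0_uniq; unfold Rsqr; lra. }
  apply sin_eq_0_0 in Hs; destruct Hs as [n Hn]; exists n.
  destruct w as [a b]; simpl in *; subst a; unfold Ci, RtoC, Cmult; simpl; f_equal; lra.
Qed.

Lemma Cexp_2PI (n : Z) : Cexp (Ci * RtoC (IZR n * (2 * PI))) = 1%C.
Proof.
  assert (Hp : forall m : nat, Cexp (Ci * RtoC (INR m * (2 * PI))) = 1%C).
  { intros m; unfold Cexp, Ci, RtoC, Cmult; simpl.
    replace (0 * (INR m * (2 * PI)) - 1 * 0) with 0 by ring.
    replace (0 * 0 + 1 * (INR m * (2 * PI))) with (0 + 2 * INR m * PI) by ring.
    rewrite cos_period, sin_period, exp_0, cos_0, sin_0; f_equal; ring. }
  destruct (Z_le_gt_dec 0 n) as [Hn|Hn].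
  - rewrite <- (Z2Nat.id n) by auto; rewrite <- INR_IZR_INZ; apply Hp.
  - assert (E : (Cexp (Ci * RtoC (IZR n * (2 * PI))) * Cexp (Ci * RtoC (INR (Z.to_nat (- n)) * (2 * PI))))%C = 1%C).
    { rewrite <- Cexp_plus, INR_IZR_INZ, Z2Nat.id, opp_IZR by lia.
      replace (Ci * RtoC (IZR n * (2 * PI)) + Ci * RtoC (- IZR n * (2 * PI)))%C with (RtoC 0); [apply Cexp_0|].
      rewrite <- Cmult_plus_distr_l, <- RtoC_plus; replace (IZR n * (2 * PI) + - IZR n * (2 * PI)) with 0 by ring; ring. }
    rewrite Hp, Cmult_1_r in E; auto.
Qed.

Definition progression (p0 om z : C) : Prop := exists n : Z, z = (p0 + RtoC (IZR n) * om)%C.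

Lemma period_neq0 (k om : C) : (k * om = Ci * RtoC (2 * PI))%C -> k <> 0%C /\ om <> 0%C.
Proof.
  intros Hk; assert (Hki : (Ci * RtoC (2 * PI))%C <> 0%C).
  { apply Cmult_neq_0; [intros E; apply (f_equal snd) in E; simpl in E; lra|].
    intros E; apply RtoC_inj in E; pose proof PI2_pos; lra. }
  split; intros E; apply Hki; rewrite <- Hk, E; ring.
Qed.

Lemma progression_iff (k om p0 z : C) : (k * om = Ci * RtoC (2 * PI))%C ->
  (Cexp (k * z) - Cexp (k * p0) = 0)%C <-> progression p0 om z.
Proof.
  intros Hk; destruct (period_neq0 k om Hk) as [Hk0 Hom0].
  split.
  - intros H; apply Cminus_diag_eq in H.
    assert (H1 : Cexp (k * (z - p0)) = 1%C).
    { assert (E : (Cexp (k * (z - p0)) * Cexp (k * p0) = Cexp (k * p0))%C).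
      { rewrite <- Cexp_plus, <- H; f_equal; ring. }
      pose proof (Cexp_neq0 (k * p0)) as Hn.
      transitivity (Cexp (k * (z - p0)) * Cexp (k * p0) / Cexp (k * p0))%C; [field; auto|].
      rewrite E; field; auto. }
    destruct (Cexp_eq_1 _ H1) as [n Hn]; exists n.
    assert (E : (k * (z - p0) = k * (RtoC (IZR n) * om))%C).
    { rewrite Hn; transitivity (RtoC (IZR n) * (k * om))%C; [|ring]; rewrite Hk, RtoC_mult; ring. }
    transitivity (p0 + k * (z - p0) / k)%C; [field; auto|]; rewrite E; field; auto.
  - intros [n ->].
    replace (k * (p0 + RtoC (IZR n) * om))%C with (Ci * RtoC (IZR n * (2 * PI)) + k * p0)%C.
    + rewrite Cexp_plus, Cexp_2PI; ring.
    + transitivity (RtoC (IZR n) * (k * om) + k * p0)%C; [rewrite Hk, RtoC_mult; ring | ring].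
Qed.

(* The subtracted function is simply periodic and has the same principal parts as [u] along the progression. *)
Lemma subtract_periodic (u : C -> C) (S : C -> Prop) (rho k om p0 : C) :
  pole_data u S rho -> (k * om = Ci * RtoC (2 * PI))%C ->
  (forall z, progression p0 om z -> S z) ->
  exists g, (forall z, progression p0 om z \/ ~ S z -> exists l, cder g z l) /\
    forall z, ~ progression p0 om z ->
      g z = (u z - rho * k * Cexp (k * p0) / (Cexp (k * z) - Cexp (k * p0)))%C.
Proof.
  intros Hpd Hk HS1; set (z0 := Cexp (k * p0)); set (h0 := (rho * k * z0)%C).
  set (c := fun z => (h0 / (Cexp (k * z) - z0))%C).
  destruct (period_neq0 k om Hk) as [Hk0 _].
  assert (Hz0 : z0 <> 0%C) by apply Cexp_neq0.
  set (e := fun z => (Cexp (k * z) - z0)%C).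
  assert (He : forall z, cder e z (k * Cexp (k * z))%C).
  { intros z; apply (cder_eq _ _ (Cexp (k * z) * (k * 1) - 0)%C); [ring|].
    apply cder_minus; [|apply cder_const].
    apply (cder_comp Cexp (fun z => k * z)%C); [apply cder_scal, cder_id | apply cder_Cexp]. }
  assert (Hprog : forall z, e z = 0%C <-> progression p0 om z) by (intros; now apply progression_iff).
  assert (Hc : forall z, ~ progression p0 om z -> exists l, cder c z l).
  { intros z Hz; eexists; apply cder_div; [|apply cder_const | apply He].
    intros E; now apply Hz, Hprog. }
  destruct (removable_set (fun z => u z - c z)%C (progression p0 om)) as [g [Hg1 Hg2]].
  - intros p Hp; destruct (pd_pole _ _ _ Hpd p (HS1 p Hp)) as (r & G & Hr & HG & HGp & HuG).
    set (E := dquot e p (C_derive e p)).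
    assert (HE : entire E) by (apply entire_dquot; intros z; eexists; apply He).
    assert (Hep : e p = 0%C) by now apply Hprog.
    (* The denominator of [c] has derivative [k * z0] at each pole, so [c] has residue
       [h0 / (k * z0) = rho] there. *)
    assert (HEp : E p = (k * z0)%C).
    { unfold E; rewrite dquot_diag, (C_derive_cder _ _ _ (He p)).
      replace (Cexp (k * p)) with (e p + z0)%C by (unfold e; ring); rewrite Hep; ring. }
    destruct (ccont_neq0_ball E p) as [d [Hd HEd]].
    { destruct (HE p) as [l Hl]; eapply cder_ccont; eauto. }
    { rewrite HEp; now apply Cmult_neq_0. }
    set (t := Rmin r d); assert (Ht : 0 < t) by now apply Rmin_pos.
    assert (Htr : t <= r) by apply Rmin_l; assert (Htd : t <= d) by apply Rmin_r.
    (* Numerator of [u - c] over [z - p]. It vanishes at [p], hence its difference quotient is the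
       regular extension. *)
    set (N := fun z => (G z - h0 * / E z)%C).
    assert (HN : hol N p t).
    { apply hol_minus; [now apply (hol_mono G p r)|]; apply hol_mult; [apply hol_const|].
      apply hol_inv; [intros z Hz; apply HEd; lra | now apply entire_hol]. }
    assert (HNp : N p = 0%C) by (unfold N, h0; rewrite HGp, HEp; field; auto).
    assert (Huc : forall z, 0 < Cmod (z - p) < t -> (u z - c z)%C = dquot N p (C_derive N p) z).
    { intros z Hz; assert (Hx : (z - p)%C <> 0%C) by (apply Cmod_gt_0; lra).
      assert (HEz : E z <> 0%C) by (apply HEd; lra).
      rewrite dquot_off, HNp by (intros ->; apply Hx; ring).
      destruct (HuG z ltac:(lra)) as [_ Eu]; unfold c; fold (e z).
      rewrite (dquot_eq e p (C_derive e p) z), Hep, Eu; fold E; unfold N.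
      replace (0 + (z - p) * E z)%C with ((z - p) * E z)%C by ring; field; auto. }
    destruct (disc_bounded (dquot N p (C_derive N p)) p t (t / 2)) as [M HM]; [now apply hol_dquot | lra |].
    exists (t / 2), M; split; [lra|]; split.
    + intros z Hz; destruct (hol_dquot N p t Ht HN z ltac:(lra)) as [l Hl]; exists l.
      apply (cder_ext (dquot N p (C_derive N p))); [|symmetry; apply Huc; lra | exact Hl].
      destruct (punctured_disc_open p z t ltac:(lra)) as [d' [Hd' Hin]]; exists d'; split; auto.
      intros w Hw; symmetry; apply Huc, Hin, Hw.
    + intros z Hz; split.
      * intros Hpr; destruct (HuG z ltac:(lra)) as [HnS _]; auto.
      * rewrite Huc by lra; apply HM; lra.
  - exists g; split; [|exact Hg2].
    intros z [Hz|Hz]; [now apply Hg1|].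
    assert (Hnp : ~ progression p0 om z) by (intros H; now apply Hz, HS1).
    destruct (open_complement S z (pd_iso _ _ _ Hpd) Hz) as [r [Hr H]].
    destruct (pd_hol _ _ _ Hpd z Hz) as [l Hl]; destruct (Hc z Hnp) as [m Hm].
    eexists; apply (cder_ext_ball (fun z => u z - c z)%C _ _ _ r); auto; [|apply cder_minus; eauto].
    intros w Hw; symmetry; apply Hg2; intros Hpr; now apply (H w Hw), HS1.
Qed.

Lemma progression_translate (u : C -> C) (S : C -> Prop) (rho om p0 z : C) (n : Z) :
  pole_data u S rho -> translation_invariant u S -> (forall z, progression p0 om z -> S z) ->
  ~ S z -> ~ S (z + RtoC (IZR n) * om)%C /\ u (z + RtoC (IZR n) * om)%C = u z.
Proof.
  intros Hpd HT HS1 Hz.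
  assert (Hp0 : S p0) by (apply HS1; exists 0%Z; simpl; ring).
  assert (Hq : forall m : Z, S (p0 + RtoC (IZR m) * om)%C) by (intros m; apply HS1; exists m; auto).
  pose proof (u_translate u S rho p0 _ z Hpd HT Hp0 (Hq n) Hz) as E.
  replace (p0 + RtoC (IZR n) * om - p0)%C with (RtoC (IZR n) * om)%C in E by ring; split; auto.
  intros H; apply Hz.
  pose proof (pole_translate u S rho p0 _ _ Hpd HT Hp0 (Hq (- n)%Z) H) as H1.
  replace (z + RtoC (IZR n) * om + (p0 + RtoC (IZR (- n)) * om - p0))%C with z in H1; auto.
  rewrite opp_IZR, RtoC_opp; ring.
Qed.

Lemma Cexp_periodic_lattice (k om z : C) (n : Z) : (k * om = Ci * RtoC (2 * PI))%C ->
  Cexp (k * (z + RtoC (IZR n) * om)) = Cexp (k * z).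
Proof.
  intros Hk; replace (k * (z + RtoC (IZR n) * om))%C with (k * z + Ci * RtoC (IZR n * (2 * PI)))%C.
  - rewrite Cexp_plus, Cexp_2PI; ring.
  - rewrite RtoC_mult; transitivity (k * z + RtoC (IZR n) * (k * om))%C; [rewrite Hk; ring | ring].
Qed.

Lemma subtract_periodic_periodic (u : C -> C) (S : C -> Prop) (rho k om p0 h0 z0 : C) (g : C -> C) (z : C) (n : Z) :
  pole_data u S rho -> translation_invariant u S -> (k * om = Ci * RtoC (2 * PI))%C ->
  (forall z, progression p0 om z -> S z) ->
  (forall z, ~ progression p0 om z -> g z = (u z - h0 / (Cexp (k * z) - z0))%C) ->
  (exists l, cder g z l) -> (exists l, cder g (z + RtoC (IZR n) * om)%C l) ->
  g (z + RtoC (IZR n) * om)%C = g z.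
Proof.
  intros Hpd HT Hk HS1 Hg [l Hl] [m Hm].
  apply (tends_unique g z); [|exact (cder_ccont _ _ _ Hl)].
  apply (tends_ext (fun w => g (w + RtoC (IZR n) * om)%C)).
  - generalize (pd_iso _ _ _ Hpd z); apply near_imp; intros w Hw.
    destruct (progression_translate u S rho om p0 w n Hpd HT HS1 Hw) as [H1 H2].
    rewrite !Hg by (intros H; auto).
    now rewrite H2, (Cexp_periodic_lattice k om w n Hk).
  - apply (tends_comp_ccont g (fun w => w + RtoC (IZR n) * om)%C z (z + RtoC (IZR n) * om)%C); [|exact (cder_ccont _ _ _ Hm)].
    apply tends_plus; [apply tends_id | apply tends_const].
Qed.

(** In the coordinate [q = z / om] a multiple of the period brings the real part of [q] into the
    unit interval. As [e * om] is purely imaginary, [Re (e * z)] is, up to sign, [Cmod om] times the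
    imaginary part of [q]. *)
Lemma reduce_mod_period (e om z : C) : Cmod e = 1 -> om <> 0%C -> Re (e * om)%C = 0 ->
  exists n : Z, Cmod (z + RtoC (IZR n) * om) <= Cmod om + Rabs (Re (e * z)%C).
Proof.
  intros He Hom Hre; set (q := (z / om)%C).
  assert (Hq : z = (q * om)%C) by (unfold q; field; auto).
  exists (1 - up (fst q))%Z.
  destruct (archimed (fst q)) as [A1 A2].
  replace (z + RtoC (IZR (1 - up (fst q))) * om)%C with (((fst q - IZR (up (fst q)) + 1)%R, snd q) * om)%C.
  2:{ rewrite Hq, minus_IZR; destruct q as [a b], om as [c d]; unfold RtoC, Cmult, Cplus; simpl; f_equal; ring. }
  rewrite Cmod_mult.
  assert (Hb : Cmod om * Rabs (snd q) = Rabs (Re (e * z)%C)).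
  { assert (E1 : Re (e * z)%C = - (Im (e * om)%C * snd q)).
    { replace (e * z)%C with (q * (e * om))%C by (rewrite Hq; ring).
      transitivity (fst q * Re (e * om)%C - snd q * Im (e * om)%C); [destruct q; simpl; ring | rewrite Hre; ring]. }
    assert (E2 : Cmod om = Rabs (Im (e * om)%C)).
    { rewrite <- (Rmult_1_l (Cmod om)), <- He, <- Cmod_mult.
      transitivity (Cmod (0, Im (e * om)%C)).
      - f_equal; rewrite <- Hre at 1; unfold Re, Im; now destruct (e * om)%C.
      - unfold Cmod; simpl; rewrite Rmult_0_l, Rplus_0_l, Rmult_1_r; apply sqrt_Rsqr_abs. }
    rewrite E1, E2, Rabs_Ropp, Rabs_mult; auto. }
  pose proof (Cmod_le_sum (fst q - IZR (up (fst q)) + 1) (snd q)) as Hs.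
  assert (Hr : Rabs (fst q - IZR (up (fst q)) + 1) <= 1) by (apply Rabs_le; lra).
  pose proof (Cmod_ge_0 om); nra.
Qed.

(** All poles have the same value of [Re (e * z)], at most [Cmod p0], so the half plane in question
    is free of them and the linear gauge applies. *)
Lemma half_plane_growth (A B al be ga de : R) (u : C -> C) (S : C -> Prop) (rho om p0 e : C) :
  A + B <> 0 -> pole_data u S rho -> translation_invariant u S -> solves_ode A B al be ga de u S ->
  (forall z, S z <-> progression p0 om z) -> om <> 0%C -> Cmod e = 1 -> Re (e * om)%C = 0 ->
  exists (m : nat) (K : R), 0 <= K /\
    forall z, Cmod p0 + 1 <= Re (e * z)%C -> Cmod (u z) <= K * (1 + Re (e * z)%C) ^ m.
Proof.
  intros HAB Hpd HT Hode HS Hom He Hre; set (r0 := Cmod p0 + 1).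
  pose proof (Cmod_ge_0 p0) as Hp0.
  assert (Hoff : forall z, r0 <= Re (e * z)%C -> ~ S z).
  { intros z Hz HSz; apply HS in HSz; destruct HSz as [n ->].
    assert (E : Re (e * (p0 + RtoC (IZR n) * om))%C = Re (e * p0)%C + IZR n * Re (e * om)%C)
      by (destruct e, p0, om; simpl; ring).
    rewrite E, Hre in Hz; pose proof (re_le_Cmod (e * p0)%C) as Hm; rewrite Cmod_mult, He in Hm.
    pose proof (Rle_abs (Re (e * p0)%C)); unfold r0 in Hz; lra. }
  apply (growth A B al be ga de (fun z => Re (e * z)%C) u r0); auto.
  - now apply gauge_Re.
  - unfold r0; lra.
  - intros z Hz; pose proof (Hoff z Hz) as HSz; split; [now apply (pd_hol _ _ _ Hpd) | now apply Hode].
  - intros X.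
    (* The strip is unbounded, but periodicity reduces its points to a bounded part. *)
    destruct (region_bounded u (fun z => r0 <= Re (e * z)%C <= X /\ Cmod z <= Cmod om + Rabs X) (Cmod om + Rabs X)) as [M HM].
    + intros z Hz; apply Hz.
    + intros p; destruct (classic (S p)) as [Hp|Hp].
      * assert (Hlt : Re (e * p)%C < r0) by (apply Rnot_le_lt; intros H; now apply (Hoff p)).
        exists (r0 - Re (e * p)%C), 0; split; [lra|]; intros w Hw [Hq _]; exfalso.
        pose proof (re_le_Cmod (e * (w - p))%C) as Hm; rewrite Cmod_mult, He in Hm.
        pose proof (Rle_abs (Re (e * (w - p))%C)) as Ha.
        assert (E : Re (e * (w - p))%C = Re (e * w)%C - Re (e * p)%C) by (destruct e, w, p; simpl; ring).
        rewrite E in Ha, Hm; lra.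
      * destruct (pd_hol _ _ _ Hpd p Hp) as [l Hl].
        destruct (ccont_nbhd _ _ (cder_ccont _ _ _ Hl) 1 ltac:(lra)) as [d [Hd H]].
        exists d, (Cmod (u p) + 1); split; auto; intros w Hw _; specialize (H w Hw).
        pose proof (Cmod_tri2 (u w) (u p)); lra.
    + exists M; intros z Hz.
      destruct (reduce_mod_period e om z He Hom Hre) as [n Hn].
      destruct (progression_translate u S rho om p0 z n Hpd HT) as [_ E]; [intros; now apply HS | apply Hoff; lra |].
      rewrite <- E; apply HM.
      assert (E2 : Re (e * (z + RtoC (IZR n) * om))%C = Re (e * z)%C + IZR n * Re (e * om)%C)
        by (destruct e, z, om; simpl; ring).
      rewrite E2, Hre, Rmult_0_r, Rplus_0_r; split; auto.
      eapply Rle_trans; [apply Hn|]; apply Rplus_le_compat_l.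
      unfold r0 in Hz; rewrite !Rabs_pos_eq; lra.
Qed.

(** [g - g 0] vanishes at all multiples of [om], infinitely many zeros for a function of polynomial
    growth. *)
Lemma poly_growth_periodic_const (g : C -> C) (om : C) (m : nat) :
  entire g -> poly_growth g m -> om <> 0%C ->
  (forall n : Z, g (RtoC (IZR n) * om)%C = g 0%C) -> forall z, g z = g 0%C.
Proof.
  intros Hg [K HK] Hom Hper z; apply Cminus_diag_eq.
  apply (poly_growth_zeros (fun z => g z - g 0)%C m (fun n => RtoC (INR n) * om)%C).
  - intros w; destruct (Hg w) as [l Hl]; eexists; apply cder_minus; [exact Hl | apply cder_const].
  - exists (K + Cmod (g 0%C)); intros w; eapply Rle_trans; [apply Cmod_triangle|]; rewrite Cmod_opp.
    specialize (HK w); pose proof (Cmod_ge_0 (g 0%C)); pose proof (Cmod_ge_0 w).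
    assert (1 <= (1 + Cmod w) ^ m) by (apply pow_R1_Rle; lra); nra.
  - intros i j E; apply INR_eq, RtoC_inj.
    transitivity (RtoC (INR i) * om / om)%C; [field; auto|]; rewrite E; field; auto.
  - intros i; rewrite INR_IZR_INZ, Hper; ring.
Qed.

(** Polynomial growth of the remainder [g] is checked in three zones: a strip around the line of
    poles, where periodicity reduces to a disc, and the two half planes beside it, reached with [e]
    and [- e]. *)
Lemma rank_one (A B al be ga de : R) (u : C -> C) (S : C -> Prop) (rho k om p0 : C) :
  A + B <> 0 -> pole_data u S rho -> translation_invariant u S -> solves_ode A B al be ga de u S ->
  (forall z, S z <-> progression p0 om z) -> rho <> 0%C -> (k * om = Ci * RtoC (2 * PI))%C ->
  exists (h0 k zeta0 c0 : C), h0 <> 0%C /\ k <> 0%C /\ zeta0 <> 0%C /\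
    forall z : C, ~ S z -> u z = (h0 / (Cexp (k * z) - zeta0) + c0)%C.
Proof.
  intros HAB Hpd HT Hode HS Hrho Hk.
  destruct (period_neq0 k om Hk) as [Hk0 Hom].
  assert (HS1 : forall z, progression p0 om z -> S z) by (intros; now apply HS).
  destruct (subtract_periodic u S rho k om p0 Hpd Hk HS1) as [g [Hg1 Hg2]].
  set (z0 := Cexp (k * p0)) in *; set (h0 := (rho * k * z0)%C) in *.
  assert (Hz0 : z0 <> 0%C) by apply Cexp_neq0.
  assert (Hge : entire g).
  { intros z; apply Hg1; destruct (classic (S z)); [left; now apply HS | now right]. }
  assert (Hper : forall z (n : Z), g (z + RtoC (IZR n) * om)%C = g z).
  { intros z n; apply (subtract_periodic_periodic u S rho k om p0 h0 z0 g); auto. }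
  set (kk := Cmod k); assert (Hkk : 0 < kk) by now apply Cmod_gt_0.
  assert (Hkk0 : RtoC kk <> 0%C) by (intros E; apply RtoC_inj in E; lra).
  set (e := (k / RtoC kk)%C).
  assert (He : Cmod e = 1).
  { unfold e; rewrite Cmod_div, Cmod_R, Rabs_pos_eq by (auto; lra); fold kk; field; lra. }
  assert (Hke : k = (RtoC kk * e)%C) by (unfold e; field; auto).
  assert (Hrek : forall z, Re (k * z)%C = kk * Re (e * z)%C).
  { intros z; rewrite Hke; destruct e, z; simpl; ring. }
  assert (Hre : Re (e * om)%C = 0).
  { apply (Rmult_eq_reg_l kk); [|lra]; rewrite <- Hrek, Hk; unfold Ci, RtoC; simpl; ring. }
  assert (He' : Cmod (- e) = 1) by now rewrite Cmod_opp.
  assert (Hre' : Re (- e * om)%C = 0) by (replace (Re (- e * om)%C) with (- Re (e * om)%C) by (destruct e, om; simpl; ring); lra).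
  destruct (half_plane_growth A B al be ga de u S rho om p0 e) as (m1 & K1 & HK1 & Hb1); auto.
  destruct (half_plane_growth A B al be ga de u S rho om p0 (- e)) as (m2 & K2 & HK2 & Hb2); auto.
  pose proof (Cmod_ge_0 p0) as Hp0.
  set (r0 := Cmod p0 + 1) in *; set (t0 := Re (e * p0)%C).
  assert (Ht0 : - Cmod p0 <= t0 <= Cmod p0).
  { apply Rabs_le_between; unfold t0; eapply Rle_trans; [apply re_le_Cmod|]; rewrite Cmod_mult, He; lra. }
  (* Lower bound for the denominator off the strip: there [Re (e * z)] differs from its value [t0]
     on the poles by at least 1, so the two exponentials differ in modulus by a definite amount. *)
  set (del := exp (kk * t0) * (1 - exp (- kk))).
  assert (Hek : exp (- kk) < 1) by (rewrite <- exp_0; apply exp_increasing; lra).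
  assert (Hdel : 0 < del) by (apply Rmult_lt_0_compat; [apply exp_pos | lra]).
  assert (Hc : forall z, r0 <= Rabs (Re (e * z)%C) -> Cmod (h0 / (Cexp (k * z) - z0)) <= Cmod h0 / del).
  { intros z Hz; set (t := Re (e * z)%C) in *.
    assert (Hge2 : del <= Cmod (Cexp (k * z) - z0)).
    { pose proof (Cmod_tri2 (Cexp (k * z)) z0) as T1; pose proof (Cmod_tri2 z0 (Cexp (k * z))) as T2.
      rewrite Cmod_sym in T2.
      assert (Ez : Cmod (Cexp (k * z)) = exp (kk * t)) by (rewrite Cmod_Cexp; f_equal; apply Hrek).
      assert (Ez0 : Cmod z0 = exp (kk * t0)) by (unfold z0; rewrite Cmod_Cexp; f_equal; apply Hrek).
      rewrite Ez, Ez0 in T1, T2; unfold del.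
      pose proof (exp_pos (kk * t0)) as Hpos.
      destruct (Rle_dec 0 t) as [Hts|Hts].
      - rewrite Rabs_pos_eq in Hz by auto.
        assert (Hx : exp (kk * t0) * exp kk <= exp (kk * t)) by (rewrite <- exp_plus; apply exp_le; unfold r0 in Hz; nra).
        assert (Hinv : exp (- kk) * exp kk = 1) by (rewrite <- exp_plus, Rplus_opp_l; apply exp_0).
        pose proof (exp_pos (- kk)); pose proof (exp_pos kk).
        assert (1 - exp (- kk) <= exp kk - 1) by nra; nra.
      - rewrite Rabs_left in Hz by lra.
        assert (Hx : exp (kk * t) <= exp (kk * t0) * exp (- kk)) by (rewrite <- exp_plus; apply exp_le; unfold r0 in Hz; nra).
        lra. }
    rewrite Cmod_div by (apply Cmod_gt_0; lra).
    apply Rmult_le_compat_l; [apply Cmod_ge_0|]; apply Rinv_le_contravar; auto. }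
  destruct (disc_bounded g 0 (Cmod om + r0 + 1) (Cmod om + r0)) as [M HM]; [now apply entire_hol | lra |].
  assert (HM0 : 0 <= M).
  { eapply Rle_trans; [apply Cmod_ge_0 | apply (HM 0%C)]; rewrite Cmod_diag; unfold r0; pose proof (Cmod_ge_0 om); lra. }
  assert (Hh0d : 0 <= Cmod h0 / del) by (apply Rdiv_le_0_compat; [apply Cmod_ge_0 | auto]).
  assert (Hgrow : poly_growth g (m1 + m2)).
  { exists (M + K1 + K2 + Cmod h0 / del); intros z; pose proof (Cmod_ge_0 z) as Hz0'.
    assert (H1 : 1 <= (1 + Cmod z) ^ (m1 + m2)) by (apply pow_R1_Rle; lra).
    assert (Hm1 : (1 + Cmod z) ^ m1 <= (1 + Cmod z) ^ (m1 + m2)) by (apply Rle_pow; [lra | lia]).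
    assert (Hm2 : (1 + Cmod z) ^ m2 <= (1 + Cmod z) ^ (m1 + m2)) by (apply Rle_pow; [lra | lia]).
    assert (Hmz : Rabs (Re (e * z)%C) <= Cmod z).
    { eapply Rle_trans; [apply re_le_Cmod|]; rewrite Cmod_mult, He; lra. }
    set (X := (1 + Cmod z) ^ (m1 + m2)) in *.
    destruct (Rle_dec (Rabs (Re (e * z)%C)) r0) as [Hsm|Hbig].
    - destruct (reduce_mod_period e om z He Hom Hre) as [n Hn].
      rewrite <- (Hper z n).
      assert (Cmod (g (z + RtoC (IZR n) * om)%C) <= M).
      { apply HM; replace (z + RtoC (IZR n) * om - 0)%C with (z + RtoC (IZR n) * om)%C by ring; lra. }
      nra.
    - assert (Hb : r0 <= Rabs (Re (e * z)%C)) by lra.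
      assert (Hnp : ~ progression p0 om z).
      { intros [n ->].
        assert (E : Re (e * (p0 + RtoC (IZR n) * om))%C = t0 + IZR n * Re (e * om)%C)
          by (unfold t0; destruct e, p0, om; simpl; ring).
        rewrite E, Hre, Rmult_0_r, Rplus_0_r in Hb.
        assert (Rabs t0 <= Cmod p0) by (apply Rabs_le; lra); unfold r0 in Hb; lra. }
      rewrite Hg2 by auto; specialize (Hc z Hb).
      eapply Rle_trans; [apply Cmod_triangle|]; rewrite Cmod_opp.
      assert (Hu : Cmod (u z) <= (K1 + K2) * X).
      { apply Rabs_le_between in Hmz.
        destruct (Rle_dec 0 (Re (e * z)%C)) as [Hs|Hs].
        - rewrite Rabs_pos_eq in Hb by auto.
          eapply Rle_trans; [now apply Hb1|].
          apply Rle_trans with (K1 * X); [|nra]; apply Rmult_le_compat_l; auto.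
          eapply Rle_trans; [|apply Hm1]; apply pow_incr; lra.
        - rewrite Rabs_left in Hb by lra.
          assert (E : Re (- e * z)%C = - Re (e * z)%C) by (destruct e, z; simpl; ring).
          eapply Rle_trans; [apply Hb2; lra|]; rewrite E.
          apply Rle_trans with (K2 * X); [|nra]; apply Rmult_le_compat_l; auto.
          eapply Rle_trans; [|apply Hm2]; apply pow_incr; lra. }
      nra. }
  exists h0, k, z0, (g 0%C); repeat split; auto.
  - unfold h0; apply Cmult_neq_0; auto; now apply Cmult_neq_0.
  - intros z Hz.
    assert (Hnp : ~ progression p0 om z) by (intros H; now apply Hz, HS).
    rewrite <- (poly_growth_periodic_const g om (m1 + m2) Hge Hgrow Hom) with (z := z).
    + rewrite Hg2 by auto; ring.
    + intros n; rewrite <- (Hper 0%C n); f_equal; ring.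
Qed.

(** * Two independent periods *)

Lemma CInt_periodic_shift (f : R -> C) (T c : R) : 0 < T -> (forall t, rcont f t) ->
  (forall t, f (t + T) = f t) -> CInt f c (c + T) = CInt f 0 T.
Proof.
  intros HT Hf Hper.
  assert (Hco : forall a b, rcont_on f a b) by (intros a b t _; apply Hf).
  assert (Hpos : forall c f, (forall t, rcont f t) -> (forall t, f (t + T) = f t) -> 0 <= c ->
     CInt f c (c + T) = CInt f 0 T).
  { clear f Hf Hper Hco c; intros c f Hf Hper Hc.
    assert (Hco : forall a b, rcont_on f a b) by (intros a b t _; apply Hf).
    assert (E1 : (CInt f 0 c + CInt f c (c + T))%C = CInt f 0 (c + T)) by (apply CInt_Chasles; auto; lra).
    assert (E2 : (CInt f 0 T + CInt f T (c + T))%C = CInt f 0 (c + T)) by (apply CInt_Chasles; auto; lra).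
    assert (E3 : CInt f T (c + T) = CInt f 0 c).
    { rewrite <- (Rplus_0_l T) at 1; rewrite <- CInt_shift by auto; apply CInt_ext; auto. }
    rewrite E3 in E2; rewrite <- E2 in E1.
    replace (CInt f c (c + T)) with (CInt f 0 c + CInt f c (c + T) - CInt f 0 c)%C by ring.
    rewrite E1; ring. }
  destruct (Rle_dec 0 c) as [Hc|Hc]; [now apply Hpos|].
  (* For negative [c] the case of a positive shift is applied to the translated function with shift
     [- c]. *)
  transitivity (CInt (fun t => f (t + c)) 0 T).
  - rewrite CInt_shift by (auto; lra); f_equal; ring.
  - rewrite <- (Hpos (- c) (fun t => f (t + c))).
    + rewrite CInt_shift by (auto; lra); f_equal; ring.
    + intros t e0 He0; destruct (Hf (t + c) e0 He0) as [d [Hd H]]; exists d; split; auto.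
      intros s Hs; apply H; replace (s + c - (t + c)) with (s - t) by ring; auto.
    + intros t; rewrite <- (Hper (t + c)); f_equal; ring.
    + lra.
Qed.

(** With [w = Cexp s], 1/(w - z0) = (w/(w - z0) - 1)/z0, and [winding] makes the two parts
    cancel. *)
Lemma VInt_simple_pole_right (z0 : C) (x : R) : z0 <> 0%C -> Cmod z0 < exp x ->
  VInt (fun s => / (Cexp s - z0))%C x 0 (2 * PI) = 0%C.
Proof.
  intros Hz0 Hx; pose proof PI2_pos as HPI; pose proof (exp_pos x) as Hex.
  assert (Hz : Cmod (z0 - 0) < exp x) by (replace (z0 - 0)%C with z0 by ring; auto).
  pose proof (winding 0 z0 (exp x) Hex Hz) as HW; rewrite ln_exp in HW.
  assert (Hn : forall t, (0 + Cexp (x, t) - z0)%C <> 0%C).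
  { intros t; pose proof (circle_neq 0 z0 (exp x) t Hex Hz) as H; now rewrite ln_exp in H. }
  assert (Hc : rcont_on (fun t => Cexp (x, t) / (0 + Cexp (x, t) - z0))%C 0 (2 * PI)).
  { apply (rcont_on_vert_line (fun s => Cexp s / (0 + Cexp s - z0))%C); intros t _.
    apply ccont_div; [apply Hn | apply ccont_Cexp |].
    apply ccont_circle. }
  transitivity (CInt (fun t => / z0 * (Cexp (x, t) / (0 + Cexp (x, t) - z0)) + - / z0)%C 0 (2 * PI)).
  - apply CInt_ext; [lra|]; intros t _; specialize (Hn t).
    assert (Hn' : (Cexp (x, t) - z0)%C <> 0%C) by (intros E; apply Hn; transitivity (Cexp (x, t) - z0)%C; [ring | exact E]).
    field; repeat split; auto.
  - rewrite CInt_plus, CInt_scal, CInt_const by (auto using rcont_on_scal, rcont_on_const; lra).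
    unfold VInt in HW; rewrite HW, Rminus_0_r; field; auto.
Qed.

(** Cauchy's formula at the centre 0 for [/ (w - z0)]. The difference from the value on the right is
    the jump caused by the pole. *)
Lemma VInt_simple_pole_left (z0 : C) (x : R) : exp x < Cmod z0 ->
  VInt (fun s => / (Cexp s - z0))%C x 0 (2 * PI) = (RtoC (2 * PI) * - / z0)%C.
Proof.
  intros Hx; pose proof PI2_pos as HPI; pose proof (exp_pos x) as Hex.
  assert (E0 : forall s : C, (s - 0)%C = s) by (intros; ring).
  assert (Hz0 : z0 <> 0%C) by (apply Cmod_gt_0; lra).
  assert (Hf : hol (fun w => / (w - z0))%C 0 (Cmod z0)).
  { intros w Hw; rewrite E0 in Hw; eexists; apply cder_inv; [|apply cder_sub_const].
    apply Cminus_neq; intros ->; lra. }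
  pose proof (cauchy_formula _ 0 0 (Cmod z0) (exp x) Hf ltac:(lra) ltac:(rewrite Cmod_diag; auto)) as H.
  rewrite ln_exp in H; simpl in H.
  assert (Hmz : (0 - z0)%C <> 0%C).
  { apply Cmod_gt_0; replace (0 - z0)%C with (- z0)%C by ring; rewrite Cmod_opp; lra. }
  replace (- / z0)%C with (/ (0 - z0))%C by (field; auto).
  rewrite <- H; apply CInt_ext; [lra|]; intros t _.
  pose proof (Cexp_neq0 (x, t)).
  assert ((Cexp (x, t) - z0)%C <> 0%C).
  { apply Cminus_neq; intros E; rewrite <- E, Cmod_Cexp in Hx; simpl in Hx; lra. }
  replace (0 + Cexp (x, t))%C with (Cexp (x, t)) by ring; rewrite E0; field; auto.
Qed.

(* With a second independent period, integrating over two vertical period segments on either side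
   of a column of poles contradicts the jump caused by the simple poles between them. *)
Lemma rank_two (u : C -> C) (S : C -> Prop) (rho k om om2 p0 : C) :
  pole_data u S rho -> translation_invariant u S -> rho <> 0%C -> (k * om = Ci * RtoC (2 * PI))%C ->
  (forall z, progression p0 om z -> S z) -> S (p0 + om2)%C -> 0 < Re (k * om2)%C ->
  (forall z, S z -> Rabs (Re (k * (z - p0))%C) < Re (k * om2)%C -> progression p0 om z) -> False.
Proof.
  intros Hpd HT Hrho Hk HS1 Hom2 Hmu Hmin.
  set (mu := Re (k * om2)%C) in *; set (sg := Re (k * p0)%C).
  pose proof PI2_pos as HPI.
  destruct (period_neq0 k om Hk) as [Hk0 _].
  assert (Hp0 : S p0) by (apply HS1; exists 0%Z; simpl; ring).
  destruct (subtract_periodic u S rho k om p0 Hpd Hk HS1) as [g [Hg1 Hg2]].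
  set (z0 := Cexp (k * p0)) in *; set (h0 := (rho * k * z0)%C) in *.
  assert (Hz0 : z0 <> 0%C) by apply Cexp_neq0.
  assert (Hh0 : h0 <> 0%C) by (unfold h0; apply Cmult_neq_0; auto; now apply Cmult_neq_0).
  assert (Hks : forall s : C, (k * (s / k))%C = s) by (intros; field; auto).
  assert (Hprog : forall z, progression p0 om z -> Re (k * z)%C = sg).
  { intros z [n ->]; replace (k * (p0 + RtoC (IZR n) * om))%C with (k * p0 + RtoC (IZR n) * (k * om))%C by ring.
    rewrite Hk; unfold sg; destruct (k * p0)%C; simpl; ring. }
  assert (Hcase : forall s, Rabs (Re s - sg) < mu -> progression p0 om (s / k)%C \/ ~ S (s / k)%C).
  { intros s Hs; destruct (classic (S (s / k)%C)) as [HS|HS]; [left | now right].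
    apply Hmin; auto; replace (k * (s / k - p0))%C with (k * (s / k) - k * p0)%C by ring; rewrite Hks.
    unfold sg in Hs; destruct s, (k * p0)%C; simpl in *; exact Hs. }
  assert (Hlin : forall (f : C -> C) s l, cder f (s / k)%C l -> cder (fun s => f (s / k)%C) s (l * / k)%C).
  { intros f s l Hl; apply (cder_comp f (fun s => s / k)%C); auto.
    apply (cder_eq _ _ (1 * / k + s * 0)%C); [ring|]; apply (cder_mult (fun s => s) (fun _ => / k)%C); [apply cder_id | apply cder_const]. }
  (* In the coordinate [s = k * z] the period [om] becomes [2 * PI] in the vertical direction, and
     the poles of the progression lie on the line [Re s = sg]. *)
  set (G := fun s => g (s / k)%C); set (v := fun s => u (s / k)%C).
  assert (HG : forall s, Rabs (Re s - sg) < mu -> exists l, cder G s l).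
  { intros s Hs; destruct (Hg1 (s / k)%C (Hcase s Hs)) as [l Hl]; eexists; apply Hlin, Hl. }
  assert (Hshift : forall x y, ((x, (y + 2 * PI)%R) / k)%C = ((x, y) / k + RtoC (IZR 1) * om)%C).
  { intros x y; assert (E : ((x, y + 2 * PI) : C) = ((x, y) + k * om)%C).
    { rewrite Hk; unfold Ci, RtoC, Cmult, Cplus; simpl; f_equal; ring. }
    rewrite E; field; auto. }
  assert (HGper : forall x y, Rabs (x - sg) < mu -> G (x, y + 2 * PI) = G (x, y)).
  { intros x y Hx; unfold G; rewrite Hshift.
    apply (subtract_periodic_periodic u S rho k om p0 h0 z0 g); auto.
    rewrite <- Hshift; apply Hg1, Hcase; auto. }
  (* The two lines lie on either side of the column and are exactly [mu] apart, so the second period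
     maps one to the other. *)
  set (x1 := sg - mu / 2); set (x2 := sg + mu / 2).
  assert (HI : VInt G x1 0 (2 * PI) = VInt G x2 0 (2 * PI)).
  { apply periodic_integral; auto; [unfold x1, x2; lra | |].
    - intros x y Hx; apply HG; simpl; apply Rabs_def1; unfold x1, x2 in Hx; lra.
    - intros x y Hx; apply HGper, Rabs_def1; unfold x1, x2 in Hx; lra. }
  assert (Hline : forall x t, 0 < Rabs (x - sg) < mu -> ~ S ((x, t) / k)%C).
  { intros x t Hx HS; destruct (Hcase (x, t)) as [Hpr|Hn]; [apply Hx | | auto].
    apply Hprog in Hpr; rewrite Hks in Hpr; simpl in Hpr; subst x.
    rewrite Rminus_diag, Rabs_R0 in Hx; lra. }
  assert (Hx1 : 0 < Rabs (x1 - sg) < mu) by (unfold x1; rewrite Rabs_left; lra).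
  assert (Hx2 : 0 < Rabs (x2 - sg) < mu) by (unfold x2; rewrite Rabs_pos_eq; lra).
  assert (Hv : forall x t, 0 < Rabs (x - sg) < mu -> ccont v (x, t)).
  { intros x t Hx; destruct (pd_hol _ _ _ Hpd _ (Hline x t Hx)) as [l Hl].
    eapply cder_ccont, Hlin, Hl. }
  assert (Hz0m : Cmod z0 = exp sg) by (unfold z0; rewrite Cmod_Cexp; reflexivity).
  assert (HGv : forall x, 0 < Rabs (x - sg) < mu ->
     VInt G x 0 (2 * PI) = (VInt v x 0 (2 * PI) - h0 * VInt (fun s => / (Cexp s - z0)) x 0 (2 * PI))%C).
  { intros x Hx.
    assert (Hn : forall t, (Cexp (x, t) - z0)%C <> 0%C).
    { intros t; apply Cminus_neq; intros E; rewrite <- E, Cmod_Cexp in Hz0m; simpl in Hz0m.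
      apply exp_inv in Hz0m; subst x; rewrite Rminus_diag, Rabs_R0 in Hx; lra. }
    assert (Hi : rcont_on (fun t => / (Cexp (x, t) - z0))%C 0 (2 * PI)).
    { apply (rcont_on_vert_line (fun s => / (Cexp s - z0))%C); intros t _; apply ccont_inv; auto.
      apply ccont_minus; [apply ccont_Cexp | apply ccont_const]. }
    assert (Hvc : rcont_on (fun t => v (x, t)) 0 (2 * PI)) by (apply rcont_on_vert_line; auto).
    unfold VInt; rewrite <- CInt_scal, <- CInt_minus by (auto using rcont_on_scal; lra).
    apply CInt_ext; [lra|]; intros t _; unfold G, v.
    rewrite Hg2, Hks; [reflexivity|]; intros Hp; apply (Hline x t Hx); auto. }
  (* Translation by [om2] carries the left line to the right one; the vertical shift [eta] drops out
     because the segment is a full period. *)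
  assert (HV : VInt v x2 0 (2 * PI) = VInt v x1 0 (2 * PI)).
  { set (eta := Im (k * om2)%C).
    transitivity (CInt (fun t => v (x1, t + - eta)) 0 (2 * PI)).
    - apply CInt_ext; [lra|]; intros t _; unfold v.
      rewrite <- (u_translate u S rho p0 (p0 + om2)%C _ Hpd HT Hp0 Hom2 (Hline x1 (t + - eta) Hx1)).
      f_equal; assert (E : ((x2, t) : C) = ((x1, (t + - eta)%R) + k * om2)%C).
      { unfold x1, x2, mu, eta; destruct (k * om2)%C as [a b]; unfold Cplus; simpl; f_equal; field. }
      rewrite E; field; auto.
    - assert (Hrc : forall t, rcont (fun t => v (x1, t)) t).
      { intros t; apply (rcont_comp v (fun t => (x1, t))); [apply Hv; auto | apply rcont_vert]. }
      rewrite (CInt_shift (fun t => v (x1, t))) by (try lra; intros t _; apply Hrc).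
      rewrite Rplus_0_l; replace (2 * PI + - eta) with (- eta + 2 * PI) by ring.
      apply (CInt_periodic_shift (fun t => v (x1, t))); auto.
      intros t; unfold v; rewrite Hshift.
      apply (progression_translate u S rho om p0 _ 1%Z Hpd HT HS1); auto. }
  rewrite !HGv, HV in HI by auto.
  rewrite VInt_simple_pole_left in HI by (rewrite Hz0m; apply exp_increasing; unfold x1; lra).
  rewrite VInt_simple_pole_right in HI by (auto; rewrite Hz0m; apply exp_increasing; unfold x2; lra).
  set (V := VInt v x1 0 (2 * PI)) in *.
  (* [G] and [v] have no jump, so that of the subtracted function would have to vanish. *)
  assert (E : (h0 * (RtoC (2 * PI) * / z0))%C = 0%C).
  { transitivity ((V - h0 * (RtoC (2 * PI) * - / z0)) - (V - h0 * 0))%C; [ring | rewrite HI; ring]. }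
  revert E; apply Cmult_neq_0; auto; apply Cmult_neq_0.
  - intros E; apply RtoC_inj in E; lra.
  - apply Cmod_gt_0; rewrite Cmod_inv by auto; now apply Rinv_0_lt_compat, Cmod_gt_0.
Qed.

(** The differences of poles form a discrete group. [om] is a shortest nonzero element, and [om2],
    if the group is not contained in the real line through [om], is an element as close to that line
    as possible without lying on it. *)
Lemma period_dichotomy (u : C -> C) (S : C -> Prop) (rho p0 p1 : C) :
  pole_data u S rho -> translation_invariant u S -> S p0 -> S p1 -> p1 <> p0 ->
  exists k om, (k * om = Ci * RtoC (2 * PI))%C /\ (forall z, progression p0 om z -> S z) /\
    ((forall z, S z -> progression p0 om z) \/
     exists om2, S (p0 + om2)%C /\ 0 < Re (k * om2)%C /\
       forall z, S z -> Rabs (Re (k * (z - p0))%C) < Re (k * om2)%C -> progression p0 om z).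
Proof.
  intros Hpd HT Hp0 Hp1 Hn.
  set (L := fun w => S (p0 + w)%C).
  assert (Hsub : forall w, (p0 + w - p0)%C = w) by (intros; ring).
  assert (Ladd : forall a b, L a -> L b -> L (a + b)%C).
  { intros a b Ha Hb; unfold L; pose proof (pole_translate u S rho p0 _ _ Hpd HT Hp0 Hb Ha) as H.
    rewrite Hsub in H; now replace (p0 + (a + b))%C with (p0 + a + b)%C by ring. }
  assert (Lopp : forall a, L a -> L (- a)%C).
  { intros a Ha; unfold L; pose proof (pole_translate u S rho _ p0 p0 Hpd HT Ha Hp0 Hp0) as H.
    now replace (p0 + - a)%C with (p0 + (p0 - (p0 + a)))%C by ring. }
  assert (Lz : forall a (n : Z), L a -> L (RtoC (IZR n) * a)%C).
  { intros a n Ha.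
    assert (Hnat : forall m : nat, L (RtoC (INR m) * a)%C).
    { induction m.
      - unfold L; replace (p0 + RtoC (INR 0) * a)%C with p0 by (simpl; ring); auto.
      - rewrite S_INR, RtoC_plus; replace ((RtoC (INR m) + 1) * a)%C with (RtoC (INR m) * a + a)%C by ring; auto. }
    destruct (Z_le_gt_dec 0 n).
    - rewrite <- (Z2Nat.id n), <- INR_IZR_INZ by auto; apply Hnat.
    - replace (RtoC (IZR n) * a)%C with (- (RtoC (INR (Z.to_nat (- n))) * a))%C; auto.
      rewrite INR_IZR_INZ, Z2Nat.id, opp_IZR, RtoC_opp by lia; ring. }
  assert (Liso : forall z, near z (fun w => ~ L w)).
  { intros z; pose proof (near_translate z p0 _ (pd_iso _ _ _ Hpd (z + p0)%C)) as H; revert H.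
    apply near_imp; intros w Hw HL; apply Hw; now rewrite Cplus_comm. }
  assert (HL1 : L (p1 - p0)%C) by (unfold L; now replace (p0 + (p1 - p0))%C with p1 by ring).
  destruct (locally_finite_min (fun w => L w /\ w <> 0%C /\ Cmod w <= Cmod (p1 - p0)) Cmod (Cmod (p1 - p0)))
    as (om & (Hom & Hom0 & _) & Hmin).
  { intros z; generalize (Liso z); apply near_imp; intros w Hw [H _]; auto. }
  { intros z Hz; apply Hz. }
  { exists (p1 - p0)%C; repeat split; auto; [now apply Cminus_neq | lra]. }
  assert (Hmin' : forall w, L w -> Cmod w < Cmod om -> w = 0%C).
  { intros w Hw Hlt; apply NNPP; intros Hw0.
    destruct (Rle_dec (Cmod w) (Cmod (p1 - p0))) as [H|H].
    - pose proof (Hmin w (conj Hw (conj Hw0 H))); lra.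
    - pose proof (Hmin (p1 - p0)%C (conj HL1 (conj (Cminus_neq _ _ Hn) (Rle_refl _)))); lra. }
  set (k := (Ci * RtoC (2 * PI) / om)%C).
  assert (Hk : (k * om = Ci * RtoC (2 * PI))%C) by (unfold k; field; auto).
  assert (Hrek : forall w, Re (k * w)%C = - (2 * PI) * Im (w / om)%C).
  { intros w; replace (k * w)%C with (Ci * RtoC (2 * PI) * (w / om))%C by (unfold k; field; auto).
    destruct (w / om)%C; simpl; ring. }
  assert (HS1 : forall z, progression p0 om z -> S z) by (intros z [n ->]; apply Lz, Hom).
  assert (Hfloor : forall w, exists n : Z, 0 <= Re ((w - RtoC (IZR n) * om) / om)%C <= 1 /\
      Re ((w - RtoC (IZR n) * om) / om)%C < 1 /\ Im ((w - RtoC (IZR n) * om) / om)%C = Im (w / om)%C).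
  { intros w; destruct (archimed (Re (w / om)%C)) as [A1 A2]; exists (up (Re (w / om)%C) - 1)%Z.
    replace ((w - RtoC (IZR (up (Re (w / om)%C) - 1)) * om) / om)%C
      with (w / om - RtoC (IZR (up (Re (w / om)%C) - 1)))%C by (field; auto).
    rewrite minus_IZR; destruct (w / om)%C as [a b]; unfold Re, Im in *; simpl in *; lra. }
  assert (Hom1 : 0 < Cmod om) by now apply Cmod_gt_0.
  (* An element on the real line through [om], reduced modulo [om], becomes shorter than [om] and is
     therefore 0. *)
  assert (Hcol : forall w, L w -> Im (w / om)%C = 0 -> progression p0 om (p0 + w)%C).
  { intros w Hw Him; destruct (Hfloor w) as (n & H1 & H2 & H3); exists n; f_equal.
    apply Cminus_diag_eq, Hmin'.
    - replace (w - RtoC (IZR n) * om)%C with (w + RtoC (IZR (- n)) * om)%C by (rewrite opp_IZR, RtoC_opp; ring); auto.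
    - set (q := ((w - RtoC (IZR n) * om) / om)%C) in *.
      replace (w - RtoC (IZR n) * om)%C with (q * om)%C by (unfold q; field; auto).
      rewrite Cmod_mult; assert (Hq : Cmod q = Re q).
      { rewrite Him in H3; transitivity (Cmod (RtoC (Re q))); [|rewrite Cmod_R; apply Rabs_pos_eq; lra].
        f_equal; destruct q as [a b]; unfold Re, Im, RtoC in *; simpl in *; now subst b. }
      rewrite Hq; nra. }
  exists k, om; split; auto; split; auto.
  destruct (classic (exists w, L w /\ Im (w / om)%C <> 0)) as [[w2 [Hw2 Him2]]|Hno].
  2:{ left; intros z Hz; replace z with (p0 + (z - p0))%C by ring; apply Hcol.
      - unfold L; now replace (p0 + (z - p0))%C with z by ring.
      - apply NNPP; intros H; apply Hno; exists (z - p0)%C; split; auto.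
        unfold L; now replace (p0 + (z - p0))%C with z by ring. }
  right; set (b := Rabs (Im (w2 / om)%C)).
  (* Bounding both coordinates with respect to [om] makes the set bounded, so that a minimum exists;
     [Hred] moves any element within the height bound into it without changing its height. *)
  set (T := fun w => L w /\ Im (w / om)%C <> 0 /\ Rabs (Im (w / om)%C) <= b /\ 0 <= Re (w / om)%C <= 1).
  assert (Hred : forall w, L w -> Im (w / om)%C <> 0 -> Rabs (Im (w / om)%C) <= b ->
     exists w', T w' /\ Im (w' / om)%C = Im (w / om)%C).
  { intros w Hw Him Hb; destruct (Hfloor w) as (n & H1 & H2 & H3).
    exists (w - RtoC (IZR n) * om)%C; split; auto; unfold T; rewrite H3; repeat split; auto; try apply H1.
    replace (w - RtoC (IZR n) * om)%C with (w + RtoC (IZR (- n)) * om)%C by (rewrite opp_IZR, RtoC_opp; ring); auto. }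
  destruct (locally_finite_min T (fun w => Rabs (Im (w / om)%C)) ((1 + b) * Cmod om)) as (w3 & Hw3 & Hmin3).
  { intros z; generalize (Liso z); apply near_imp; intros w Hw [H _]; auto. }
  { intros z (_ & _ & Hb & Hr); replace z with (z / om * om)%C at 1 by (field; auto).
    rewrite Cmod_mult; apply Rmult_le_compat_r; [lra|].
    destruct (z / om)%C as [x y]; unfold Re, Im in *; simpl in *.
    eapply Rle_trans; [apply Cmod_le_sum|]; rewrite (Rabs_pos_eq x); lra. }
  { destruct (Hred w2 Hw2 Him2 (Rle_refl _)) as [w' [H _]]; eauto. }
  destruct Hw3 as (HL3 & Him3 & Hb3 & _).
  assert (Hbest : forall z, S z -> Rabs (Im ((z - p0) / om)%C) < Rabs (Im (w3 / om)%C) -> progression p0 om z).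
  { intros z Hz Hlt; replace z with (p0 + (z - p0))%C by ring; apply Hcol.
    - unfold L; now replace (p0 + (z - p0))%C with z by ring.
    - apply NNPP; intros H.
      destruct (Hred (z - p0)%C) as [w' [Hw' E]]; auto; [unfold L; now replace (p0 + (z - p0))%C with z by ring | lra |].
      pose proof (Hmin3 w' Hw') as Hm; rewrite E in Hm; lra. }
  pose proof PI2_pos as HPI.
  (* [Re (k * w)] is [- (2 * PI)] times the imaginary part of [w / om]. The positive sign is
     therefore obtained from whichever of [w3] and [- w3] has negative height. *)
  assert (Hfin : forall om2, L om2 -> Im (om2 / om)%C < 0 -> Rabs (Im (om2 / om)%C) = Rabs (Im (w3 / om)%C) ->
     exists om2, S (p0 + om2)%C /\ 0 < Re (k * om2)%C /\
       forall z, S z -> Rabs (Re (k * (z - p0))%C) < Re (k * om2)%C -> progression p0 om z).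
  { intros om2 H2 Hneg E; exists om2; split; auto; rewrite !Hrek; split; [nra|].
    intros z Hz Hlt; apply Hbest; auto; rewrite <- E, (Rabs_left (Im (om2 / om)%C)) by auto.
    rewrite Hrek, Rabs_mult, Rabs_Ropp, (Rabs_pos_eq (2 * PI)) in Hlt by lra; nra. }
  destruct (Rlt_le_dec (Im (w3 / om)%C) 0) as [Hs|Hs]; [now apply (Hfin w3)|].
  assert (E : Im (- w3 / om)%C = - Im (w3 / om)%C).
  { replace (- w3 / om)%C with (- (w3 / om))%C by (field; auto); destruct (w3 / om)%C; reflexivity. }
  apply (Hfin (- w3)%C); auto; rewrite E; [lra | apply Rabs_Ropp].
Qed.

Lemma at_most_one_pole (A B al be ga de : R) (u : C -> C) (S : C -> Prop) (rho z0 : C) :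
  A + B <> 0 -> (forall n : Z, (n <> 0)%Z -> B / (A + B) <> IZR n) ->
  pole_data u S rho -> solves_ode A B al be ga de u S -> (forall z, S z -> z = z0) ->
  exists (u0 p0 p1 p2 : C), forall z : C, ~ S z -> u z = (u0 / (z - z0) + (p0 + p1 * z + p2 * z * z))%C.
Proof.
  intros HAB Hii Hpd Hode HS; pose proof (Cmod_ge_0 z0) as Hz0.
  set (r0 := Cmod z0 + 1).
  assert (Hoff : forall z, r0 <= Cmod z -> ~ S z).
  { intros z Hz H; apply HS in H; subst z; unfold r0 in Hz; lra. }
  assert (Hu : forall z, r0 <= Cmod z -> exists l, cder u z l) by (intros z Hz; apply (pd_hol _ _ _ Hpd); auto).
  assert (Ho : forall z, r0 <= Cmod z -> ode_at A B al be ga de u z) by (intros z Hz; apply Hode; auto).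
  destruct (growth A B al be ga de Cmod u r0 HAB gauge_Cmod) as (m & K & HK & Hgr); auto.
  { unfold r0; lra. }
  { intros X; apply (region_bounded u _ X); [intros z Hz; apply Hz|].
    intros p; destruct (classic (S p)) as [Hp|Hp].
    - exists 1, 0; split; [lra|]; intros w Hw [Hq _]; exfalso; apply HS in Hp; subst p.
      pose proof (Cmod_tri2 w z0); unfold r0 in Hq; lra.
    - destruct (pd_hol _ _ _ Hpd p Hp) as [l Hl].
      destruct (ccont_nbhd _ _ (cder_ccont _ _ _ Hl) 1 ltac:(lra)) as [d [Hd H]].
      exists d, (Cmod (u p) + 1); split; auto; intros w Hw _; specialize (H w Hw).
      pose proof (Cmod_tri2 (u w) (u p)); lra. }
  destruct (quadratic_at_infinity A B al be ga de u r0 K m HAB Hii) as (r1 & K1 & HK1); auto.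
  { unfold r0; lra. }
  (* Without a pole at [z0] the coefficient is 0, and the final formula then holds at [z0] as
     well. *)
  set (a := if excluded_middle_informative (S z0) then rho else RtoC 0).
  assert (Ha : ~ S z0 -> a = 0%C) by (intros H; unfold a; now destruct excluded_middle_informative).
  set (f := fun z => (u z - a * / (z - z0))%C).
  assert (Hf : forall z, ~ S z -> exists l, cder f z l).
  { intros z Hz; destruct (pd_hol _ _ _ Hpd z Hz) as [l Hl].
    destruct (classic (S z0)) as [Hs|Hs].
    - assert (Hn : z <> z0) by (intros ->; auto).
      eexists; apply cder_minus; [exact Hl|]; apply cder_scal, cder_inv; [now apply Cminus_neq | apply cder_sub_const].
    - exists l; apply (cder_ext_ball u f z l 1); auto; [lra|]; intros w _; unfold f; rewrite Ha by auto; ring. }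
  destruct (removable_set f S) as [g [Hg1 Hg2]].
  { intros p Hp; pose proof (HS p Hp) as E; subst p.
    destruct (pd_pole _ _ _ Hpd z0 Hp) as (r & G & Hr & HG & HGp & HuG).
    destruct (disc_bounded (dquot G z0 (C_derive G z0)) z0 r (r / 2)) as [M HM]; [now apply hol_dquot | lra |].
    exists (r / 2), M; split; [lra|]; split.
    - intros z Hz; apply Hf, HuG; lra.
    - intros z Hz; destruct (HuG z ltac:(lra)) as [H1 H2]; split; auto.
      assert (Hx : (z - z0)%C <> 0%C) by (apply Cmod_gt_0; lra).
      replace (f z) with (dquot G z0 (C_derive G z0) z); [apply HM; lra|].
      rewrite dquot_off by (intros ->; apply Hx; ring).
      unfold f, a; destruct excluded_middle_informative as [_|n]; [|now destruct n].
      rewrite H2, HGp; field; auto. }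
  assert (Hge : entire g).
  { intros z; destruct (classic (S z)) as [Hz|Hz]; auto.
    destruct (open_complement S z (pd_iso _ _ _ Hpd) Hz) as [r [Hr H]]; destruct (Hf z Hz) as [l Hl].
    exists l; apply (cder_ext_ball f g z l r); auto; intros w Hw; symmetry; auto. }
  set (r2 := Rmax r0 r1).
  assert (H20 : r0 <= r2) by apply Rmax_l; assert (H21 : r1 <= r2) by apply Rmax_r.
  destruct (disc_bounded g 0 (r2 + 1) r2) as [M HM]; [now apply entire_hol | lra |].
  destruct (poly_growth_quadratic g Hge) as (p0 & p1 & p2 & Hp).
  { exists (Rabs M + Rabs K1 + Cmod a); intros z; pose proof (Cmod_ge_0 z).
    pose proof (Cmod_ge_0 a); pose proof (Rabs_pos M); pose proof (Rabs_pos K1).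
    assert (HX1 : 1 <= (1 + Cmod z) ^ 2) by (apply pow_R1_Rle; lra).
    set (X := (1 + Cmod z) ^ 2) in *.
    destruct (Rle_dec (Cmod z) r2) as [Hz|Hz].
    - specialize (HM z); replace (z - 0)%C with z in HM by ring; specialize (HM Hz).
      pose proof (Rle_abs M); nra.
    - rewrite Hg2 by (apply Hoff; lra); unfold f; eapply Rle_trans; [apply Cmod_triangle|]; rewrite Cmod_opp.
      specialize (HK1 z ltac:(lra)); fold X in HK1; pose proof (Rle_abs K1).
      assert (Hd : 1 <= Cmod (z - z0)) by (pose proof (Cmod_tri2 z z0); unfold r0 in H20; lra).
      assert (Hi : Cmod (a * / (z - z0)) <= Cmod a * / 1).
      { rewrite Cmod_mult; apply Rmult_le_compat_l; auto; apply Cmod_inv_le; lra. }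
      rewrite Rinv_1, Rmult_1_r in Hi; nra. }
  exists a, p0, p1, p2; intros z Hz; rewrite <- Hp, Hg2 by auto; unfold f, Cdiv; ring.
Qed.

Theorem theorem1 (A B al be ga de : R) :
  A * B * (A + B) <> 0 ->
  (forall n : Z, (n <> 0)%Z -> B / (A + B) <> IZR n) ->
  (A + 2 * B <> 0 /\
   forall (s : R), (s = 1 \/ s = -1) -> forall n : nat, fuchs_index A B s <> RtoC (INR n)) ->
  forall (u : C -> C) (S : C -> Prop),
    meromorphic_with_poles u S ->
    solves_ode A B al be ga de u S ->
    (exists (u0 z0 p0 p1 p2 : C),
        forall z : C, ~ S z -> u z = (u0 / (z - z0) + (p0 + p1 * z + p2 * z * z))%C)
    \/
    (exists (h0 k zeta0 c0 : C),
        h0 <> 0%C /\ k <> 0%C /\ zeta0 <> 0%C /\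
        forall z : C, ~ S z -> u z = (h0 / (Cexp (k * z) - zeta0) + c0)%C).
Proof.
  intros HAB0 Hii [HA2B Hiii] u S Hmero Hode.
  assert (HAB : A + B <> 0) by (intros E; apply HAB0; rewrite E; ring).
  pose proof (solution_pole_data A B al be ga de u S HAB HA2B Hii Hmero Hode) as Hpd.
  pose proof (solution_translation_invariant A B al be ga de u S HA2B Hiii Hpd Hode) as HT.
  set (rho := RtoC (- 6 / (A + 2 * B))) in *.
  assert (Hrho : rho <> 0%C).
  { intros E; apply RtoC_inj in E.
    assert (E2 : - 6 / (A + 2 * B) * (A + 2 * B) = - 6) by (field; auto).
    rewrite E in E2; lra. }
  (* This case includes the entire solutions, for which [S] is empty and [z0] arbitrary. *)
  destruct (classic (exists z0, forall z, S z -> z = z0)) as [[z0 Hz0]|Hno].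
  { left; destruct (at_most_one_pole A B al be ga de u S rho z0) as (u0 & p0 & p1 & p2 & H); auto.
    exists u0, z0, p0, p1, p2; exact H. }
  right.
  assert (Hex : exists p0 p1, S p0 /\ S p1 /\ p1 <> p0).
  { apply NNPP; intros Hn; destruct (classic (exists p0, S p0)) as [[p0 Hp0]|He].
    - apply Hno; exists p0; intros z Hz; apply NNPP; intros Hzn; apply Hn; exists p0, z; auto.
    - apply Hno; exists 0%C; intros z Hz; destruct He; eauto. }
  destruct Hex as (p0 & p1 & Hp0 & Hp1 & Hne).
  destruct (period_dichotomy u S rho p0 p1 Hpd HT Hp0 Hp1 Hne) as (k & om & Hk & HS1 & [HS2 | (om2 & H1 & H2 & H3)]).
  - apply (rank_one A B al be ga de u S rho k om p0); auto; intros z; split; auto.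
  - destruct (rank_two u S rho k om om2 p0); auto.
Qed.
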